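(* Fix $\gamma\in(1,2]$ and an integer $\mathtt b\ge 2$. Let $\mu$ be a probability measure on $\mathbb N=\{0,1,2,\dots\}$ satisfying: (H1) $\sum_{k\in\mathbb N}k\mu(k)=1$; (H2) $\mu$ is aperiodic, i.e. $\mu$ is not supported by a proper subgroup of $\mathbb Z$; (H3) either $\gamma=2$ and $\sum_{k}k^2\mu(k)<\infty$, or $\gamma\in(1,2)$ and $\mu$ is in the domain of attraction of a $\gamma$-stable law. Let $\tau$ be a Galton–Watson tree with offspring distribution $\mu$ and let $(u_k)_{0\le k<\#\tau}$ be its depth-first exploration. Conditionally given $\tau$, let $(Y_v)_{v\in\tau}$ be a $\mathbb W_{\mathtt b}$-valued $\tau$-indexed critical branching random walk with $Y_{\mathtt{root}}=\varnothing$. Then there exists a constant $c_{\mu,\mathtt b}\in(0,\infty)$ depending only on $\mu$ and $\mathtt b$ such that for every $\varepsilon\in(0,\infty)$, $$\lim_{n\to\infty}\mathbf P\Big(\tfrac1n\max_{1\le k\le n}\big|\#\{Y_{u_l};0\le l<k\}-c_{\mu,\mathtt b}\,k\big|>\varepsilon\,\Big|\,\#\tau=n\Big)=0 .$$ In particular, writing $\mathcal R_{\mathtt b}=\{Y_v;v\in\tau\}$, for every $\varepsilon>0$, $\lim_{n\to\infty}\mathbf P\big(|\tfrac1n\#\mathcal R_{\mathtt b}-c_{\mu,\mathtt b}|>\varepsilon\,\big|\,\#\tau=n\big)=0$.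
   Context: $\mathbb W_{\mathtt b}$ is the $\mathtt b$-ary tree: the set of finite words $(a_1,\dots,a_n)$, $n\ge0$, with letters in $\{1,\dots,\mathtt b\}$; $\varnothing$ is the empty word (root); the parent of $x=(a_1,\dots,a_n)$, $n\ge1$, is $\overleftarrow x=(a_1,\dots,a_{n-1})$ and its children are $x\ast(i)=(a_1,\dots,a_n,i)$, $1\le i\le\mathtt b$. The critical transition kernel $p^+_{\mathtt b}$ on $\mathbb W_{\mathtt b}$: from $x\neq\varnothing$ jump to $\overleftarrow x$ with probability $1/2$ and to each $x\ast(i)$ with probability $1/(2\mathtt b)$; from $\varnothing$ jump to each $(i)$ with probability $1/\mathtt b$. A $\tau$-indexed branching random walk with kernel $p^+_{\mathtt b}$ started at $\varnothing$ is a family $(Y_v)_{v\in\tau}$ with $Y_{\mathtt{root}}=\varnothing$ whose joint law is $\delta_\varnothing(dy_{\mathtt{root}})\prod_{v\neq\mathtt{root}}p^+_{\mathtt b}(y_{\overleftarrow v},dy_v)$, $\overleftarrow v$ being the parent of $v$ in $\tau$. A Galton–Watson tree with offspring distribution $\mu$ is a random rooted ordered (plane) tree in which the root has a $\mu$-distributed number of children, each of which independently starts an independent copy of the tree. The depth-first exploration $(u_k)$: $u_0$ is the root and $u_{k+1}$ is the unexplored child with least birth rank of the most recent ancestor of $u_k$ (possibly $u_k$ itself) having an unexplored child. *)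

(* Defs.v *)
From HB Require Import structures.
From mathcomp Require Import all_boot all_order all_algebra finmap.
From mathcomp Require Import all_classical all_reals all_analysis.
Set Implicit Arguments. Unset Strict Implicit. Unset Printing Implicit Defensive.
Import Order.TTheory GRing.Theory Num.Theory.
Local Open Scope classical_set_scope.
Local Open Scope ring_scope.
Import numFieldNormedType.Exports.

Definition word := seq nat.

Definition wparent (x : word) : word := take (size x).-1 x.

Definition inW (b : nat) (x : word) : bool := all (fun a => (1 <= a <= b)%N) x.

Definition pker {R : realType} (b : nat) (x y : word) : R :=
  if x == [::] then
    (if (size y == 1%N) && inW b y then (b%:R)^-1 else 0)
  else if y == wparent x then 2^-1
  else if (size y == (size x).+1) && (take (size x) y == x) && inW b (drop (size x) y)
  then (2 * b%:R)^-1 else 0.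

(* Plane trees (Ulam-Harris-Neveu formalism): a finite set of words    *)
(* with positive letters, containing the root, closed under parent and *)
(* under "younger siblings".                                           *)
Definition is_plane_tree (t : {fset word}) : Prop :=
  [::] \in t /\
  (forall u, u \in t -> all (fun a => (1 <= a)%N) u) /\
  (forall u i, rcons u i \in t -> u \in t) /\
  (forall u i j, rcons u i \in t -> (1 <= j <= i)%N -> rcons u j \in t).

Definition nchildren (t : {fset word}) (u : word) : nat :=
  count (fun v : word => (size v == (size u).+1) && (take (size u) v == u)) t.

Definition gw_weight {R : realType} (mu : nat -> R) (t : {fset word}) : R :=
  \prod_(u <- t) mu (nchildren t u).

(* Depth-first exploration (literally as in the paper):                *)
(* u_{k+1} is the unexplored child with least birth rank of the most   *)
(* recent ancestor of u_k (possibly u_k itself) having an unexplored   *)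
(* child.                                                              *)
Definition unexplored_children (t : {fset word}) (explored : seq word) (a : word)
  : seq word :=
  [seq rcons a i | i <- iota 1 #|` t| &
     (rcons a i \in t) && (rcons a i \notin explored)].

Definition dfs_next (t : {fset word}) (explored : seq word) (u : word)
  : option word :=
  let ancs := [seq take j u | j <- rev (iota 0 (size u).+1)] in
  ohead (flatten [seq take 1 (unexplored_children t explored a) | a <- ancs]).

Fixpoint dfs_aux (t : {fset word}) (fuel : nat) (explored : seq word) (u : word)
  : seq word :=
  match fuel with
  | 0 => explored
  | S f => match dfs_next t explored u with
           | None => explored
           | Some v => dfs_aux t f (rcons explored v) v
           end
  end.

Definition dfs (t : {fset word}) : seq word := dfs_aux t #|` t| [:: [::]] [::].

Definition lab (y : {fmap word -> word}) (v : word) : word := odflt [::] (y.[? v])%fmap.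

Definition is_labelling (t : {fset word}) (y : {fmap word -> word}) : Prop :=
  domf y = t /\ lab y [::] = [::].

Definition brw_weight {R : realType} (b : nat) (t : {fset word})
  (y : {fmap word -> word}) : R :=
  \prod_(v <- t | v != [::]) pker b (lab y (wparent v)) (lab y v).

(* Conditional probability P(E | #tau = n) for an event E depending on  *)
(* the tree and its labels; the joint law of (tau, Y) gives mass        *)
(* gw_weight mu t * brw_weight b t y to (t, y).                         *)
Definition joint_prob {R : realType} (mu : nat -> R) (b n : nat)
  (E : {fset word} -> {fmap word -> word} -> Prop) : \bar R :=
  (\esum_(t in [set t : {fset word} | is_plane_tree t /\ #|` t| = n])
     \esum_(y in [set y | is_labelling t y /\ E t y])
        ((gw_weight mu t * brw_weight b t y)%:E))%E.

Definition size_prob {R : realType} (mu : nat -> R) (n : nat) : \bar R :=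
  (\esum_(t in [set t : {fset word} | is_plane_tree t /\ #|` t| = n])
     (gw_weight mu t)%:E)%E.

Definition cond_prob {R : realType} (mu : nat -> R) (b n : nat)
  (E : {fset word} -> {fmap word -> word} -> Prop) : R :=
  fine (joint_prob mu b n E) / fine (size_prob mu n).

Definition range_upto (t : {fset word}) (y : {fmap word -> word}) (k : nat) : nat :=
  size (undup [seq lab y u | u <- take k (dfs t)]).

Definition range_size (t : {fset word}) (y : {fmap word -> word}) : nat :=
  size (undup [seq lab y v | v <- t]).

Definition is_prob_nat {R : realType} (mu : nat -> R) : Prop :=
  (forall k, 0 <= mu k) /\ series mu @ \oo --> (1 : R).

Definition aperiodic {R : realType} (mu : nat -> R) : Prop :=
  forall d : nat, d != 1%N -> ~ (forall k, mu k != 0 -> (d %| k)%N).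

Fixpoint convpow {R : realType} (mu : nat -> R) (n : nat) : nat -> R :=
  match n with
  | 0 => fun k => if k == 0%N then 1 else 0
  | S m => fun k => \sum_(j < k.+1) convpow mu m j * mu (k - j)%N
  end.

Definition convpow_cdf {R : realType} (mu : nat -> R) (n : nat) (x : R) : R :=
  \sum_(k < (Num.truncn x).+1 | (k%:R <= x)) convpow mu n k.

Definition cdfR {R : realType} (nu : probability R R) (x : R) : R :=
  fine (nu `]-oo, x]%classic).

Definition stable_law {R : realType} (gam : R) (nu : probability R R) : Prop :=
  (forall x : R, (nu [set x] < 1)%E) /\
  forall a b : R, 0 < a -> 0 < b -> exists c : R,
    forall A : set R, measurable A ->
      product_measure1 nu nu [set p : R * R | A (a * p.1 + b * p.2)] =
      nu [set x : R | A ((a `^ gam + b `^ gam) `^ gam^-1 * x + c)].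

Definition domain_of_attraction {R : realType} (gam : R) (mu : nat -> R) : Prop :=
  exists (nu : probability R R) (an bn : nat -> R),
    stable_law gam nu /\ (forall n, 0 < an n) /\
    forall x : R, {for x, continuous (cdfR nu)} ->
      (fun n => convpow_cdf mu n (bn n + an n * x)) @ \oo --> cdfR nu x.

(* Main.v *)
Require Import Defs.
From HB Require Import structures.
From mathcomp Require Import all_boot all_order all_algebra finmap.
From mathcomp Require Import all_classical all_reals all_analysis.
From mathcomp Require Import ring lra zify.
Set Implicit Arguments. Unset Strict Implicit. Unset Printing Implicit Defensive.
Import Order.TTheory GRing.Theory Num.Theory.
Local Open Scope classical_set_scope.
Local Open Scope ring_scope.
Import numFieldNormedType.Exports.

(** The vertices of the tree, listed in depth-first order, carry i.i.d. data: a
    number of children, a direction (down or up in W_b) and a letter.  Conditioning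
    on #tau = n divides probabilities by P(#tau = n) = P(xi_1 + ... + xi_n = n - 1) / n,
    which is only subexponentially small, so it is enough to control the range along
    an unconditioned i.i.d. sequence up to exponentially small probabilities.

    A vertex is new when its label was not seen before.  Seen from the vertex,
    going backwards, its ancestral line makes a critical walk on W_b, and a label at
    formal depth D above the oldest label of a window of M vertices carries D letters
    that are independent of everything before the window.  So, up to an error
    M b^-D plus the probability that the depth is less than D, being new is a function
    of the window alone, and its probability, conditionally on the past, is close to a
    constant c > 0.  An exponential moment bound along each residue class modulo M
    then gives the concentration.

    The depth is large because an ancestral line of a long window is long, and this
    needs one regularity property of mu: the mean carried by the values above k^q is
    O(1/k) for some q.  It is clear for a finite variance.  In the domain of attraction
    of a stable law of index gam > 1 with normalisations a_n, comparing S_2n with two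
    copies of S_n gives a_2n <= rho a_n with rho < 2, and P(xi > K a_n) = O(1/n). *)

(** * Finitely supported laws *)

(** Only one-sided comparisons are needed: an upper bound for the weight of the bad labelled trees
    and a lower bound for P(#tau = n). Both live on finitely many vertices, so the offspring law is
    capped at a large [N] and every probability is a finite sum. Depth: not finding the parent
    within x vertices is a first-passage event of the Lukasiewicz walk, and Kemperman's formula
    bounds its probability by the mean deficit of the walk divided by x. Over the generations that
    are found, the depth dominates a reflected simple walk. Positivity of c does not follow from the
    window estimate, whose errors are not small for short windows. It comes from forcing the last J
    vertices to be a descending chain, which provides J letters, and then revealing the past in
    blocks of geometric size. The errors are summable and, for J large, cost at most half the
    probability of the chain. Exponents: for n of order y^P the windows have about y^Q vertices. Bad
    events have probability exp(- a n / y^Q) up to a polynomial factor, while P(#tau = n) is at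
    least exp(- const n / y^(Q+1)) up to such a factor; the spare factor y in the exponent
    decides. *)

Section FiniteLaws.
Variable R : realType.

Definition Ex (X : Type) (d : seq (R * X)) (f : X -> R) : R :=
  \sum_(p <- d) p.1 * f p.2.

Definition is_law (X : Type) (d : seq (R * X)) : Prop :=
  all (fun p => 0 <= p.1) d /\ Ex d (fun=> 1) = 1.

Definition Pr (X : Type) (d : seq (R * X)) (P : X -> bool) : R :=
  Ex d (fun x => (P x)%:R).

Fixpoint iid (X : Type) (d : seq (R * X)) (n : nat) : seq (R * seq X) :=
  if n is m.+1 then
    [seq (p.1 * q.1, p.2 :: q.2) | p <- d, q <- iid d m]
  else [:: (1, [::])].

Definition dprod (X Y : Type) (d : seq (R * X)) (e : seq (R * Y)) : seq (R * (X * Y)) :=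
  [seq (p.1 * q.1, (p.2, q.2)) | p <- d, q <- e].

Section OneLaw.
Variables (X : Type) (d : seq (R * X)).

Lemma eq_Ex f g : f =1 g -> Ex d f = Ex d g.
Proof. by move=> fg; apply: eq_bigr => p _; rewrite fg. Qed.

Lemma ExD f g : Ex d (fun x => f x + g x) = Ex d f + Ex d g.
Proof. by rewrite /Ex -big_split /=; apply: eq_bigr => p _; rewrite mulrDr. Qed.

Lemma ExZ c f : Ex d (fun x => c * f x) = c * Ex d f.
Proof. by rewrite /Ex mulr_sumr; apply: eq_bigr => p _; rewrite mulrCA. Qed.

Lemma ExZr c f : Ex d (fun x => f x * c) = Ex d f * c.
Proof. by rewrite mulrC -ExZ; apply: eq_Ex => x; rewrite mulrC. Qed.

Lemma ExN f : Ex d (fun x => - f x) = - Ex d f.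
Proof. by rewrite /Ex -sumrN; apply: eq_bigr => p _; rewrite mulrN. Qed.

Lemma ExB f g : Ex d (fun x => f x - g x) = Ex d f - Ex d g.
Proof. by rewrite ExD ExN. Qed.

Lemma Ex0 : Ex d (fun=> 0) = 0.
Proof. by rewrite /Ex big1 // => p _; rewrite mulr0. Qed.

Lemma Ex_sum (I : Type) (r : seq I) (P : pred I) (F : I -> X -> R) :
  Ex d (fun x => \sum_(i <- r | P i) F i x) = \sum_(i <- r | P i) Ex d (F i).
Proof.
rewrite /Ex exchange_big /=; apply: eq_bigr => p _; by rewrite mulr_sumr.
Qed.

Hypothesis dlaw : is_law d.

Lemma Ex_cst c : Ex d (fun=> c) = c.
Proof.
by rewrite (_ : (fun=> c) = (fun x => c * 1)) ?ExZ ?dlaw.2 ?mulr1 //;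
   apply/funext => x; rewrite mulr1.
Qed.

Lemma le_Ex f g : (forall x, f x <= g x) -> Ex d f <= Ex d g.
Proof.
case: dlaw => + _ fg; rewrite /Ex.
elim: d => [|p s IH] /=; first by rewrite !big_nil.
by case/andP=> p0 /IH sp; rewrite !big_cons lerD // ler_wpM2l.
Qed.

Lemma Ex_ge0 f : (forall x, 0 <= f x) -> 0 <= Ex d f.
Proof. by move=> f0; rewrite -Ex0; apply: le_Ex. Qed.

Lemma Ex_lec f c : (forall x, f x <= c) -> Ex d f <= c.
Proof. by move=> fc; rewrite -[leRHS](Ex_cst c); apply: le_Ex. Qed.

Lemma Pr_ge0 P : 0 <= Pr d P.
Proof. exact: Ex_ge0. Qed.

Lemma Pr_le1 P : Pr d P <= 1.
Proof. by apply: Ex_lec => x; case: (P x). Qed.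

Lemma le_Pr (P Q : X -> bool) : (forall x, P x -> Q x) -> Pr d P <= Pr d Q.
Proof.
by move=> PQ; apply: le_Ex => x; case: (P x) (PQ x) => [/(_ isT) ->|_] //; rewrite ?ler01 ?ler0n.
Qed.

Lemma PrC P : Pr d (fun x => ~~ P x) = 1 - Pr d P.
Proof.
rewrite -[X in X - _]Ex_cst /Pr -ExB; apply: eq_Ex => x.
by case: (P x); rewrite ?subrr ?subr0.
Qed.

Lemma markov f c : 0 < c -> (forall x, 0 <= f x) ->
  Pr d (fun x => c <= f x) <= Ex d f / c.
Proof.
move=> c0 f0; rewrite ler_pdivlMr // /Pr -ExZr; apply: le_Ex => x.
by case: (leP c (f x)) => cf; rewrite ?mul1r ?mul0r.
Qed.

End OneLaw.

Lemma Ex_swap (X Y : Type) (d : seq (R * X)) (e : seq (R * Y)) f :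
  Ex d (fun x => Ex e (fun y => f x y)) = Ex e (fun y => Ex d (fun x => f x y)).
Proof.
rewrite /Ex; under eq_bigr do rewrite mulr_sumr.
rewrite exchange_big /=; apply: eq_bigr => q _; rewrite mulr_sumr.
by apply: eq_bigr => p _; rewrite mulrCA.
Qed.

Lemma Ex_dprod (X Y : Type) (d : seq (R * X)) (e : seq (R * Y)) f :
  Ex (dprod d e) f = Ex d (fun x => Ex e (fun y => f (x, y))).
Proof.
rewrite /Ex big_allpairs_dep /=; apply: eq_bigr => p _.
by rewrite mulr_sumr; apply: eq_bigr => q _; rewrite mulrA.
Qed.

Lemma dprod_law (X Y : Type) (d : seq (R * X)) (e : seq (R * Y)) :
  is_law d -> is_law e -> is_law (dprod d e).
Proof.
move=> dl el; split; last first.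
  by rewrite Ex_dprod; under eq_Ex do rewrite el.2; rewrite dl.2.
case: dl el => + _ [+ _]; rewrite /dprod; elim: d => //= p s IH /andP[p0 sp] ep.
rewrite all_cat IH // andbT all_map; apply: sub_all ep => q /= q0.
exact: mulr_ge0.
Qed.

Section IID.
Variables (X : Type) (d : seq (R * X)).

Lemma Ex_iid0 f : Ex (iid d 0) f = f [::].
Proof. by rewrite /Ex /= big_seq1 mul1r. Qed.

Lemma Ex_iidS n f :
  Ex (iid d n.+1) f = Ex d (fun x => Ex (iid d n) (fun s => f (x :: s))).
Proof.
rewrite {1}/Ex /= big_allpairs_dep /=; apply: eq_bigr => p _.
by rewrite mulr_sumr; apply: eq_bigr => q _; rewrite mulrA.
Qed.

Lemma eq_Ex_iid n f g : (forall s, size s = n -> f s = g s) ->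
  Ex (iid d n) f = Ex (iid d n) g.
Proof.
elim: n f g => [|n IH] f g fg; first by rewrite !Ex_iid0 fg.
by rewrite !Ex_iidS; apply: eq_Ex => x; apply: IH => s ss; apply: fg; rewrite /= ss.
Qed.

Lemma Ex_iidD m n f : Ex (iid d (m + n)) f =
  Ex (iid d m) (fun s => Ex (iid d n) (fun t => f (s ++ t))).
Proof.
elim: m f => [|m IH] f; first by rewrite Ex_iid0.
by rewrite addSn !Ex_iidS; apply: eq_Ex => x; rewrite IH.
Qed.

Lemma Ex_iidSr n f : Ex (iid d n.+1) f =
  Ex (iid d n) (fun s => Ex d (fun x => f (rcons s x))).
Proof.
rewrite -addn1 Ex_iidD; apply: eq_Ex => s; rewrite Ex_iidS; apply: eq_Ex => x.
by rewrite Ex_iid0 cats1.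
Qed.

Lemma Ex_iid_rev n f : Ex (iid d n) (fun s => f (rev s)) = Ex (iid d n) f.
Proof.
elim: n f => [|n IH] f; first by rewrite !Ex_iid0.
rewrite [LHS]Ex_iidS [RHS]Ex_iidSr -(IH (fun s => Ex d (fun x => f (rcons s x)))).
rewrite [RHS]Ex_swap; apply: eq_Ex => x; apply: eq_Ex => s; by rewrite rev_cons.
Qed.

Hypothesis dlaw : is_law d.

Lemma iid_law n : is_law (iid d n).
Proof.
elim: n => [|n IH]; first by split; rewrite ?Ex_iid0 //= ler01.
split; last by rewrite Ex_iidS IH.2 dlaw.2.
case: dlaw IH => + _ [+ _]; rewrite /=.
move: (iid d n) => e; elim: d => //= p s IH /andP[p0 sp] ep.
rewrite all_cat IH // andbT all_map; apply: sub_all ep => q /= q0.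
exact: mulr_ge0.
Qed.

Lemma le_Ex_iid n f g : (forall s, size s = n -> f s <= g s) ->
  Ex (iid d n) f <= Ex (iid d n) g.
Proof.
elim: n f g => [|n IH] f g fg; first by rewrite !Ex_iid0 fg.
rewrite !Ex_iidS; apply: le_Ex => // x; apply: IH => s ss.
by apply: fg; rewrite /= ss.
Qed.

Lemma le_Pr_iid n (P Q : seq X -> bool) : (forall s, size s = n -> P s -> Q s) ->
  Pr (iid d n) P <= Pr (iid d n) Q.
Proof.
by move=> PQ; apply: le_Ex_iid => s /PQ; case: (P s) => [/(_ isT) ->|_].
Qed.

Lemma Ex_iid_suffix m n f :
  Ex (iid d (m + n)) (fun s => f (drop m s)) = Ex (iid d n) f.
Proof.
rewrite Ex_iidD -[RHS](Ex_cst (iid_law m)); apply: eq_Ex_iid => s ss.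
by apply: eq_Ex => t; rewrite drop_cat ss ltnn subnn drop0.
Qed.

End IID.

Lemma Ex_iid_pair (X Y : Type) (d : seq (R * X)) (e : seq (R * Y)) n f :
  Ex (iid (dprod d e) n) f =
  Ex (iid d n) (fun s => Ex (iid e n) (fun l => f (zip s l))).
Proof.
elim: n f => [|n IH] f; first by rewrite !Ex_iid0.
rewrite !Ex_iidS Ex_dprod; apply: eq_Ex => x.
under eq_Ex do rewrite IH.
by rewrite Ex_swap; apply: eq_Ex => s; rewrite Ex_iidS.
Qed.

Lemma Ex_iid_map (X Y : Type) (g : X -> Y) (d : seq (R * X)) (e : seq (R * Y)) n f :
  (forall h, Ex d (fun x => h (g x)) = Ex e h) ->
  Ex (iid d n) (fun s => f (map g s)) = Ex (iid e n) f.
Proof.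
move=> gd; elim: n f => [|n IH] f; first by rewrite !Ex_iid0.
rewrite !Ex_iidS -gd; apply: eq_Ex => x /=.
by rewrite -IH; apply: eq_Ex.
Qed.

End FiniteLaws.

(** * Labels along the depth-first exploration *)

(* A vertex is ((number of children, direction), letter): the label moves down to the
   child given by the letter if the direction is [true], and up otherwise; at the root
   of W_b, where the walk must go down, the letter is also used when it is [false].
   Lists of vertices are reversed: their head is the last vertex visited. *)
Definition vtx : Type := ((nat * bool) * nat)%type.

Section Machine.
Variables (B : Type) (dn : B -> nat -> B) (up : nat -> nat -> B -> B) (s0 : nat -> B).

Definition mstep (i : nat) (x : vtx) (y : B) : B :=
  if x.1.2 then dn y x.2 else up i x.2 y.

(* Label of the parent of the [d]-th pending child, the next vertex to be visited
   being pending child 0; [s0] labels the parents pending before the list starts. *)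
Fixpoint stk (t : seq vtx) (d : nat) : B :=
  if t is x :: t' then
    if (d < x.1.1)%N then mstep (size t') x (stk t' 0) else stk t' (d - x.1.1).+1
  else s0 d.

Definition lbl (x : vtx) (t : seq vtx) : B := mstep (size t) x (stk t 0).

Fixpoint visited (t : seq vtx) : seq B :=
  if t is x :: t' then lbl x t' :: visited t' else [::].

Lemma size_visited t : size (visited t) = size t.
Proof. by elim: t => //= x t ->. Qed.

End Machine.

(** Markov property of the exploration: the recent part [t] sees the history [h] only through the
    stack that [h] leaves, with vertex indices shifted. *)
Lemma stk_cat (B : Type) dn up s0 t h d :
  @stk B dn up s0 (t ++ h) d =
  stk dn (fun i => up (i + size h)%N) (stk dn up s0 h) t d.
Proof.
elim: t d => //= x t IH d; rewrite !IH; case: ifP => // _.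
by rewrite /mstep size_cat.
Qed.

Lemma visited_cat (B : Type) dn up s0 t h :
  @visited B dn up s0 (t ++ h) =
  visited dn (fun i => up (i + size h)%N) (stk dn up s0 h) t ++ visited dn up s0 h.
Proof. by elim: t => //= x t ->; rewrite /lbl stk_cat /mstep size_cat. Qed.

Section Morphism.
Variables (B B' : Type) (phi : B -> B').
Variables (dn : B -> nat -> B) (up : nat -> nat -> B -> B) (s0 : nat -> B).
Variables (dn' : B' -> nat -> B') (up' : nat -> nat -> B' -> B') (s0' : nat -> B').
Hypothesis phi_dn : forall y l, phi (dn y l) = dn' (phi y) l.
Hypothesis phi_up : forall i l y, phi (up i l y) = up' i l (phi y).
Hypothesis phi_s0 : forall d, phi (s0 d) = s0' d.

Lemma stk_morph t d : phi (stk dn up s0 t d) = stk dn' up' s0' t d.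
Proof.
elim: t d => //= x t IH d; case: ifP => // _.
by rewrite /mstep -IH; case: ifP.
Qed.

Lemma lbl_morph x t : phi (lbl dn up s0 x t) = lbl dn' up' s0' x t.
Proof. by rewrite /lbl /mstep -stk_morph; case: ifP. Qed.

Lemma visited_morph t : map phi (visited dn up s0 t) = visited dn' up' s0' t.
Proof. by elim: t => //= x t ->; rewrite lbl_morph. Qed.

End Morphism.

Lemma wparent_rcons x a : wparent (rcons x a) = x.
Proof. by rewrite /wparent size_rcons /= -cats1 take_size_cat. Qed.

Definition dnW (y : word) (l : nat) : word := rcons y l.
Definition upW (i l : nat) (y : word) : word :=
  if y is [::] then [:: l] else wparent y.

Definition cls := (nat + nat)%type.

(* A formal label is the class of a label together with the letters appended
   since the class was created; a class is an entry of the initial stack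
   ([inl]) or a vertex that moved up from an empty suffix ([inr]). *)
Definition dnF (y : cls * word) (l : nat) : cls * word := (y.1, rcons y.2 l).
Definition upF (i l : nat) (y : cls * word) : cls * word :=
  if y.2 is [::] then (inr i, [::]) else (y.1, wparent y.2).
Definition s0F (d : nat) : cls * word := (inl d, [::]).

(** Formal labels with the suffix reduced to its length. This is enough to name classes and measure
    depth, and it does not depend on the letters ([stkK_struct]). *)
Definition dnK (y : cls * nat) (l : nat) : cls * nat := (y.1, y.2.+1).
Definition upK (i l : nat) (y : cls * nat) : cls * nat :=
  if y.2 is k.+1 then (y.1, k) else (inr i, 0%N).
Definition s0K (d : nat) : cls * nat := (inl d, 0%N).

(** A collision visible from the window alone: the entries of the initial stack and the newly
    created classes are treated as pairwise distinct unknown labels. *)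
Definition fcoll (t : seq vtx) : bool :=
  if t is x :: t' then lbl dnF upF s0F x t' \in visited dnF upF s0F t' else false.

Section Decorated.
Variables (B : Type) (dn : B -> nat -> B) (up : nat -> nat -> B -> B) (s0 : nat -> B).

(** Formal labels that also carry the true label of their class. They couple the two machines: [toF]
    recovers the formal label and [toB] the true one. *)
Definition dnT (y : cls * B * word) (l : nat) : cls * B * word := (y.1, rcons y.2 l).
Definition upT (i l : nat) (y : cls * B * word) : cls * B * word :=
  if y.2 is [::] then (inr i, up i l y.1.2, [::]) else (y.1, wparent y.2).
Definition s0T (d : nat) : cls * B * word := (inl d, s0 d, [::]).

Definition toF (y : cls * B * word) : cls * word := (y.1.1, y.2).
Definition toB (y : cls * B * word) : B := foldl dn y.1.2 y.2.

Lemma toF_dn y l : toF (dnT y l) = dnF (toF y) l. Proof. by []. Qed.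
Lemma toF_up i l y : toF (upT i l y) = upF i l (toF y).
Proof. by case: y => [[c e] [|a w]]. Qed.
Lemma toF_s0 d : toF (s0T d) = s0F d. Proof. by []. Qed.

Lemma toB_dn y l : toB (dnT y l) = dn (toB y) l.
Proof. by rewrite /toB /dnT /= foldl_rcons. Qed.

Hypothesis up_dn : forall i l y a, up i l (dn y a) = y.

Lemma toB_up i l y : toB (upT i l y) = up i l (toB y).
Proof.
case: y => [[c e] w]; rewrite /toB /upT /=; case/lastP: w => [|w a] //=.
rewrite wparent_rcons foldl_rcons up_dn; by case: w.
Qed.

Lemma toB_s0 d : toB (s0T d) = s0 d. Proof. by []. Qed.

(** A new class is named after the index of the vertex creating it, and all earlier names are
    smaller, so [g] can be extended at the new name without touching earlier values. The last two
    clauses carry this freshness through the induction. *)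
Lemma class_ext t : exists g : cls -> B,
  [/\ forall d, (stk dnT upT s0T t d).1.2 = g (stk dnT upT s0T t d).1.1,
      forall i, (i < size t)%N -> let p := nth (s0T 0) (visited dnT upT s0T t) i in
         p.1.2 = g p.1.1,
      forall d j, (stk dnT upT s0T t d).1.1 = inr j -> (j < size t)%N &
      forall i j, (i < size t)%N ->
         (nth (s0T 0) (visited dnT upT s0T t) i).1.1 = inr j -> (j < size t)%N].
Proof.
elim: t => [|x t [g [gs gv bs bv]]].
  by exists (fun c => if c is inl d then s0 d else s0 0%N); split.
pose h (c : cls) := if c == inr (size t) then (lbl dnT upT s0T x t).1.2 else g c.
have hold c e : e = g c -> (forall j, c = inr j -> (j < size t)%N) -> e = h c.
  move=> -> bc; rewrite /h; case: eqP => // cE.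
  by have := bc _ cE; rewrite ltnn.
have hnew : (lbl dnT upT s0T x t).1.2 = h (lbl dnT upT s0T x t).1.1.
  rewrite /h; case: eqP => //; rewrite /lbl /mstep.
  have gs0 := gs 0%N; case: ifP => [_ _|_]; first exact: gs0.
  by move: gs0; case: (stk dnT upT s0T t 0) => [[c e] [|a w]].
have bnew j : (lbl dnT upT s0T x t).1.1 = inr j -> (j < (size t).+1)%N.
  rewrite /lbl /mstep; case: ifP => [_ /=|_]; first by move/bs/ltnW.
  have := bs 0%N j; case: (stk dnT upT s0T t 0) => [[c e] [|a w]] /=.
    by move=> _ [->].
  by move=> + cj => /(_ cj)/ltnW.
exists h; split.
- move=> d /=; case: ifP => _; first exact: hnew.
  by apply: hold (gs _) _ => j; apply: bs.
- case=> [|i] /= it; first exact: hnew.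
  by apply: hold (gv _ it) _ => j; apply: bv.
- move=> d j /=; case: ifP => _; first exact: bnew.
  by move/bs/ltnW.
- case=> [|i] j /= it; first exact: bnew.
  by move/(bv _ _ it)/ltnW.
Qed.

End Decorated.

(** Equal formal labels have the same class, hence by [class_ext] the same true class label, and the
    same suffix; replaying the suffix gives equal true labels. *)
Lemma fcoll_coll (B : eqType) (dn : B -> nat -> B) up s0 x t :
  (forall i l y a, up i l (dn y a) = y) ->
  fcoll (x :: t) -> lbl dn up s0 x t \in visited dn up s0 t.
Proof.
move=> up_dn; rewrite /fcoll.
rewrite -(lbl_morph (toF_dn (B:=B)) (toF_up up) (toF_s0 s0) x t).
rewrite -(visited_morph (toF_dn (B:=B)) (toF_up up) (toF_s0 s0) t).
rewrite -(lbl_morph (toB_dn dn) (toB_up up_dn) (toB_s0 dn s0) x t).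
rewrite -(visited_morph (toB_dn dn) (toB_up up_dn) (toB_s0 dn s0) t).
case: (class_ext up s0 (x :: t)) => g [_ gv _ _] /mapP[p pv].
have := gv 0%N isT; rewrite /= => e1.
have [i it pE] : exists2 i, (i < size t)%N & p = nth (s0T s0 0) (visited (dnT (B:=B)) (upT up) (s0T s0) t) i.
  exists (index p (visited (dnT (B:=B)) (upT up) (s0T s0) t)); last by rewrite nth_index.
  by rewrite -(size_visited (dnT (B:=B)) (upT up) (s0T s0)) index_mem.
have := gv i.+1 it; rewrite /= -pE => e2 [c w].
by apply/mapP; exists p => //; rewrite /toB e1 e2 c w.
Qed.

Definition lblK := lbl dnK upK s0K.

(* Two lists with the same genealogy and moves whose letters agree, except
   possibly those appended within the class [c]. *)
Fixpoint agree (c : cls) (t t' : seq vtx) : bool :=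
  match t, t' with
  | [::], [::] => true
  | x :: u, x' :: u' =>
      [&& x.1 == x'.1, (x.1.2 && ((lblK x u).1 == c)) || (x.2 == x'.2) & agree c u u']
  | _, _ => false
  end.

Lemma agree_refl c t : agree c t t.
Proof. by elim: t => //= x t ->; rewrite !eqxx orbT. Qed.

Lemma agree_size c t t' : agree c t t' -> size t = size t'.
Proof. by elim: t t' => [|x t IH] [|x' t'] //= /and3P[_ _ /IH ->]. Qed.

Definition toK (y : cls * word) : cls * nat := (y.1, size y.2).
Lemma toK_dn y l : toK (dnF y l) = dnK (toK y) l.
Proof. by rewrite /toK /dnF /= size_rcons. Qed.
Lemma toK_up i l y : toK (upF i l y) = upK i l (toK y).
Proof.
case: y => [c w]; rewrite /toK /upF /upK /=; case: w => //= a w.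
by rewrite /wparent size_take /= ltnSn.
Qed.
Lemma toK_s0 d : toK (s0F d) = s0K d. Proof. by []. Qed.

Lemma stkK_struct t t' d : map fst t = map fst t' ->
  stk dnK upK s0K t d = stk dnK upK s0K t' d.
Proof.
elim: t t' d => [|x t IH] [|x' t'] d //= [xx tt].
have -> : size t = size t' by rewrite -(size_map fst) tt size_map.
rewrite /mstep xx (IH _ _ tt); by case: ifP => // _; apply: IH.
Qed.

Section AgreeT.
Variables (B : Type) (up : nat -> nat -> B -> B) (s0 : nat -> B).
Local Notation stkT := (stk (@dnT B) (upT up) (s0T s0)).
Local Notation lblT := (lbl (@dnT B) (upT up) (s0T s0)).
Local Notation visT := (visited (@dnT B) (upT up) (s0T s0)).

Definition relT (c : cls) (p q : cls * B * word) : Prop :=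
  [/\ p.1 = q.1, size p.2 = size q.2 & p.1.1 <> c -> p.2 = q.2].

Lemma lblT_K x t : ((lblT x t).1.1, size (lblT x t).2) = lblK x t.
Proof.
rewrite -[RHS](lbl_morph toK_dn toK_up toK_s0).
by rewrite -(lbl_morph (toF_dn (B:=B)) (toF_up up) (toF_s0 s0)).
Qed.

Lemma agree_lblT c x x' t t' :
  x.1 = x'.1 -> (x.1.2 && ((lblK x t).1 == c)) || (x.2 == x'.2) ->
  size t = size t' -> relT c (stkT t 0) (stkT t' 0) ->
  relT c (lblT x t) (lblT x' t').
Proof.
move=> xx mask st; rewrite -lblT_K in mask; move: mask.
rewrite /lbl /mstep -xx -st.
case: (stkT t 0) => [[i e] w]; case: (stkT t' 0) => [[i' e'] w'] mask [/= [ii ee]] sw ww.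
move: mask; rewrite {}ii {}ee in ww *.
case: (x.1.2) => /=.
  case/orP => [/eqP ic|/eqP ->]; split => //=; rewrite ?size_rcons ?sw //.
  by move/ww ->.
move=> /eqP ->; rewrite /upT /=; case: w w' sw ww => [|a w] [|a' w'] //= sw ww.
split; [by [] | | by move/ww => ->].
by case: sw => sw; rewrite /= /wparent !size_takel ?leq_pred //= sw.
Qed.

Lemma agree_stkT c t t' d : agree c t t' -> relT c (stkT t d) (stkT t' d).
Proof.
elim: t t' d => [|x t IH] [|x' t'] d //= /and3P[/eqP xx mask ag].
rewrite -xx; case: ifP => _; last exact: IH.
by apply: agree_lblT => //; [exact: agree_size ag | exact: IH].
Qed.

Lemma agree_visT c t t' i : agree c t t' ->
  relT c (nth (s0T s0 0) (visT t) i) (nth (s0T s0 0) (visT t') i).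
Proof.
elim: t t' i => [|x t IH] [|x' t'] [|i] //= /and3P[/eqP xx mask ag]; last exact: IH.
apply: agree_lblT => //; [exact: agree_size ag | exact: agree_stkT].
Qed.

End AgreeT.

(** * Independence of the letters within a class *)

Section Independence.
Variables (R : realType) (dL : seq (R * nat)).
Hypothesis dLlaw : is_law dL.

Definition KS (S : seq (nat * bool)) (d : nat) := stk dnK upK s0K [seq (s, 0%N) | s <- S] d.

Lemma stkF_KS S L d : size L = size S -> toK (stk dnF upF s0F (zip S L) d) = KS S d.
Proof.
move=> sL; rewrite (stk_morph toK_dn toK_up toK_s0); apply: stkK_struct.
by rewrite -/(unzip1 _) unzip1_zip ?sL // -map_comp map_id_in.
Qed.

(* Given the genealogy and the moves, the [k] letters appended within a class are
   uniform and independent of every function of the other letters. *)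
Lemma class_letters S c d k (Phi : word -> seq nat -> R) :
  (forall u L L', size L = size S -> size L' = size S ->
     agree c (zip S L) (zip S L') -> Phi u L = Phi u L') ->
  KS S d = (c, k) ->
  Ex (iid dL (size S)) (fun L => Phi (stk dnF upF s0F (zip S L) d).2 L) =
  Ex (iid dL k) (fun u => Ex (iid dL (size S)) (Phi u)).
Proof.
elim: S c d k Phi => [|s S IH] c d k Phi PhiH Kd.
  by case: Kd => _ <-; rewrite !Ex_iid0.
case: k Kd => [|k] Kd.
  rewrite Ex_iid0; apply: eq_Ex_iid => L sL; congr Phi; apply: size0nil.
  by have := stkF_KS d sL; rewrite Kd => -[].
rewrite /= Ex_iidS.
under eq_Ex => l.
  rewrite (_ : (fun L => _) = (fun L => Phi (if (d < s.1)%N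
     then mstep dnF upF (size (zip S L)) (s, l) (stk dnF upF s0F (zip S L) 0)
     else stk dnF upF s0F (zip S L) (d - s.1).+1).2 (l :: L))) //.
  over.
have agl l L L' : agree c (zip S L) (zip S L') ->
    agree c (zip (s :: S) (l :: L)) (zip (s :: S) (l :: L')).
  by move=> /= ->; rewrite !eqxx orbT.
move: Kd; rewrite /KS /= size_map; case: ifP => ds Kd; last first.
  transitivity (Ex dL (fun l => Ex (iid dL k.+1) (fun u =>
     Ex (iid dL (size S)) (fun L => Phi u (l :: L))))).
    apply: eq_Ex => l; apply: (IH c (d - s.1).+1 k.+1 (fun u L => Phi u (l :: L))) => //.
    by move=> u L L' sL sL' /(agl l) ag; apply: PhiH; rewrite //= ?sL ?sL'.
  by rewrite Ex_swap; apply: eq_Ex => u; rewrite Ex_iidS.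
case: s ds agl Kd PhiH => xi [] ds agl; rewrite /mstep /=; last first.
  rewrite /upK; move EK: (stk _ _ _ _ 0) => [c0 [|k0]] //= [cc kk] PhiH.
  rewrite cc kk in EK => {c0 k0 cc kk}.
  have hIH l u : forall L L', size L = size S -> size L' = size S ->
      agree c (zip S L) (zip S L') -> Phi (wparent u) (l :: L) = Phi (wparent u) (l :: L').
    by move=> L L' sL sL' /(agl l) ag; apply: PhiH; rewrite //= ?sL ?sL'.
  (* An upward move shortens the suffix: the induction hypothesis is used with one more letter,
     which is then dropped and averaged out. *)
  transitivity (Ex dL (fun l => Ex (iid dL k.+2) (fun u =>
     Ex (iid dL (size S)) (fun L => Phi (wparent u) (l :: L))))).
    apply: eq_Ex => l.
    rewrite -(IH c 0%N k.+2 (fun u L => Phi (wparent u) (l :: L))) //; last by move=> u; apply: hIH.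
    apply: eq_Ex_iid => L sL; congr Phi.
    rewrite /upF; have := stkF_KS 0 sL; rewrite /KS EK.
    by case: (stk dnF _ _ _ _) => c1 [|a w].
  rewrite Ex_swap Ex_iidSr; apply: eq_Ex => u.
  under eq_Ex do under eq_Ex do rewrite wparent_rcons.
  by rewrite Ex_cst // Ex_iidS.
case EK: (stk _ _ _ _ 0) => [c0 k0] [cc kk] PhiH; rewrite cc kk in EK => {c0 k0 cc kk}.
have hIH l u : forall L L', size L = size S -> size L' = size S ->
    agree c (zip S L) (zip S L') -> Phi (rcons u l) (l :: L) = Phi (rcons u l) (l :: L').
  by move=> L L' sL sL' /(agl l) ag; apply: PhiH; rewrite //= ?sL ?sL'.
transitivity (Ex dL (fun l => Ex (iid dL k) (fun u =>
   Ex (iid dL (size S)) (fun L => Phi (rcons u l) (l :: L))))).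
  apply: eq_Ex => l.
  by rewrite -(IH c 0%N k (fun u L => Phi (rcons u l) (l :: L))) // => u; apply: hIH.
rewrite Ex_swap Ex_iidSr; apply: eq_Ex => u; apply: eq_Ex => l.
(* A downward move appends the head letter [l] to the suffix. That letter belongs to the class [c],
   so [Phi] does not see it in the list and its copy there may be replaced by an independent
   [l']. *)
rewrite Ex_iidS -[LHS](Ex_cst dLlaw); apply: eq_Ex => l'.
apply: eq_Ex_iid => L sL; apply: PhiH; rewrite /= ?sL //.
rewrite eqxx agree_refl /= andbT.
suff -> : stk dnK upK s0K (zip S L) 0 = (c, k) by rewrite eqxx.
rewrite -EK; apply: stkK_struct.
by rewrite -/(unzip1 _) unzip1_zip ?sL // -map_comp map_id_in.
Qed.

End Independence.

Lemma upW_dnW i l y a : upW i l (dnW y a) = y.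
Proof. by rewrite /upW /dnW; case: y => // c y; rewrite -[RHS](wparent_rcons _ a). Qed.

(** [A] stands for the labels met before the list starts. *)
Definition coll (s0 : nat -> word) (A : seq word) (t : seq vtx) : bool :=
  if t is x :: t' then lbl dnW upW s0 x t' \in A ++ visited dnW upW s0 t' else false.

(** Giving the head exactly one child makes its own label the parent label of pending child 0, so
    [KS] reads the depth of the head itself. *)
Definition khead (S : seq (nat * bool)) : nat :=
  if S is s :: S0 then (KS ((1%N, s.2) :: S0) 0).2 else 0%N.

Section StructureCollision.
Variables (R : realType) (dL : seq (R * nat)) (pb : R).
Hypothesis dLlaw : is_law dL.
Hypothesis dLpoint : forall a, Pr dL (fun l => l == a) <= pb.

Lemma pb_ge0 : 0 <= pb.
Proof. exact: le_trans (Pr_ge0 dLlaw _) (dLpoint 0%N). Qed.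

Lemma point_iid (e y : word) k :
  Ex (iid dL k) (fun u => (e ++ u == y)%:R) <= pb ^+ k.
Proof.
elim: k y => [|k IH] y; first by rewrite Ex_iid0 expr0; case: eqP => _ //=.
rewrite Ex_iidSr; case/lastP: y => [|y a].
  rewrite (_ : Ex _ _ = 0) ?exprn_ge0 ?pb_ge0 // -[RHS](Ex0 (iid dL k)).
  apply: eq_Ex => u; rewrite -[RHS](Ex0 dL); apply: eq_Ex => x.
  by case: eqP => // /(congr1 size); rewrite size_cat size_rcons addnS.
rewrite (@eq_Ex _ _ _ _ (fun u => Pr dL (fun l => l == a) * (e ++ u == y)%:R)); last first.
  move=> u; rewrite -ExZr; apply: eq_Ex => x.
  by rewrite -rcons_cat eqseq_rcons -natrM mulnb andbC.
by rewrite ExZ exprS ler_pM ?Pr_ge0 // Ex_ge0 //; exact: iid_law.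
Qed.

(** Union bound over [A] and the visited labels. The head label is its class label followed by
    [khead S] letters, which are independent of the class label and of every visited label of
    another class, so each match costs [pb ^+ khead S]. A match within the same class has equal
    suffixes and is therefore formal. *)
Lemma structure_collision (s0 : nat -> word) (A : seq word) S :
  Ex (iid dL (size S))
     (fun L => (coll s0 A (zip S L) && ~~ fcoll (zip S L))%:R)
  <= (size A + size S)%:R * pb ^+ khead S.
Proof.
case: S => [|s S0]; first by rewrite Ex_iid0 /= mulr_ge0 ?exprn_ge0 ?pb_ge0.
set S' := (1%N, s.2) :: S0; rewrite /khead -/S'.
pose c := (KS S' 0).1; pose k := (KS S' 0).2.
have KE : KS S' 0 = (c, k) by rewrite /c /k; case: (KS S' 0).
pose TL L := stk (@dnT word) (upT upW) (s0T s0) (zip S' L) 0.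
pose q i L := nth (s0T s0 0) (visited (@dnT word) (upT upW) (s0T s0) (zip S' L)) i.
pose PA y u L : R := ((TL L).1.2 ++ u == y)%:R.
pose PV i u L : R := ((q i L).1.1 != c)%:R * ((TL L).1.2 ++ u == toB dnW (q i L))%:R.
have law' := iid_law dLlaw.
have foldlE e w : foldl dnW e w = e ++ w.
  by elim/last_ind: w e => [|w a IH] e; rewrite ?cats0 // foldl_rcons IH /dnW -rcons_cat.
have wE L : (TL L).2 = (stk dnF upF s0F (zip S' L) 0).2.
  by rewrite -(stk_morph (toF_dn (B:=word)) (toF_up upW) (toF_s0 s0)).
have bnd (Phi : word -> seq nat -> R) :
    (forall u L L', size L = size S' -> size L' = size S' ->
      agree c (zip S' L) (zip S' L') -> Phi u L = Phi u L') ->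
    (forall L, Ex (iid dL k) (fun u => Phi u L) <= pb ^+ k) ->
    Ex (iid dL (size S')) (fun L => Phi (TL L).2 L) <= pb ^+ k.
  move=> off pt; under eq_Ex do rewrite wE.
  by rewrite (class_letters dLlaw off KE) Ex_swap; apply: Ex_lec.
have bA y : Ex (iid dL (size S')) (fun L => PA y (TL L).2 L) <= pb ^+ k.
  apply: bnd => [u L L' _ _ ag|L]; last exact: point_iid.
  by rewrite /PA /TL; have [-> _ _] := agree_stkT upW s0 0 ag.
have bV i : Ex (iid dL (size S')) (fun L => PV i (TL L).2 L) <= pb ^+ k.
  apply: bnd => [u L L' _ _ ag|L]; last first.
    rewrite /PV ExZ; case: (_ != _); rewrite ?mul1r ?mul0r ?exprn_ge0 ?pb_ge0 //.
    exact: point_iid.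
  rewrite /PV /TL; have [-> _ _] := agree_stkT upW s0 0 ag.
  have := agree_visT upW s0 i ag; rewrite -/(q i L) -/(q i L').
  case: (q i L) => [[c1 e1] w1]; case: (q i L') => [[c2 e2] w2] [/= [-> ->] _ ww].
  by case: eqP => [_|/ww ->]; rewrite ?mul0r.
apply: (@le_trans _ _ (Ex (iid dL (size S')) (fun L =>
   (\sum_(y <- A) PA y (TL L).2 L + \sum_(i < size S') PV i (TL L).2 L)))); last first.
  rewrite ExD !Ex_sum natrD mulrDl -/k; apply: lerD.
    have -> : (size A)%:R * pb ^+ k = \sum_(y <- A) pb ^+ k.
      by rewrite big_const_seq count_predT iter_addr_0 mulr_natl.
    by apply: ler_sum.
  have -> : (size (s :: S0))%:R * pb ^+ k = \sum_(i < size S') pb ^+ k.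
    by rewrite sumr_const card_ord mulr_natl.
  by apply: ler_sum.
apply: le_Ex_iid => // -[//|l L0] sL.
have PA0 y u L : 0 <= PA y u L by [].
have PV0 i u L : 0 <= PV i u L by apply: mulr_ge0.
case: (boolP (_ && _)) => /=; last by move=> _; apply: addr_ge0; apply: sumr_ge0.
rewrite mem_cat -/(lbl dnW upW s0 (s, l) (zip S0 L0)).
set t := zip S0 L0.
have lE : lbl dnW upW s0 (s, l) t = (TL (l :: L0)).1.2 ++ (TL (l :: L0)).2.
  rewrite -foldlE -/(toB dnW (TL (l :: L0))) /TL.
  by rewrite (stk_morph (toB_dn dnW) (toB_up upW_dnW) (toB_s0 dnW s0)).
case/andP => /orP[lA|lV] nf.
  rewrite (perm_big _ (perm_to_rem lA)) big_cons -addrA ler_wpDr //.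
    by rewrite addr_ge0 // sumr_ge0.
  by rewrite /PA lE eqxx.
have [i it iE] : exists2 i, (i < size t)%N & lbl dnW upW s0 (s, l) t =
    toB dnW (q i.+1 (l :: L0)).
  exists (index (lbl dnW upW s0 (s, l) t) (visited dnW upW s0 t)).
    by rewrite -(size_visited dnW upW s0) index_mem.
  rewrite /q /= -/t.
  set i := index _ _; have it : (i < size t)%N.
    by rewrite -(size_visited dnW upW s0) index_mem.
  rewrite -(nth_map _ (toB dnW (s0T s0 0))) ?size_visited //.
  by rewrite (visited_morph (toB_dn dnW) (toB_up upW_dnW) (toB_s0 dnW s0)) nth_index.
have iS : (i.+1 < size S')%N.
  by rewrite /= ltnS; move: it; rewrite /t size_zip; case: sL => ->; rewrite minnn.
rewrite (bigD1 (Ordinal iS)) //= addrCA ler_wpDr //.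
  by rewrite addr_ge0 // sumr_ge0.
rewrite {1}/PV -lE iE eqxx mulr1.
suff -> : (q i.+1 (l :: L0)).1.1 != c by [].
apply: contra nf => /eqP ic; rewrite /= -/t.
rewrite -/(fcoll ((s, l) :: t)) /fcoll.
rewrite -(lbl_morph (toF_dn (B:=word)) (toF_up upW) (toF_s0 s0)).
rewrite -(visited_morph (toF_dn (B:=word)) (toF_up upW) (toF_s0 s0)).
have [g [gs gv _ _]] := class_ext upW s0 (zip S' (l :: L0)).
have e1 := gs 0%N; rewrite -/(TL _) in e1.
have cE : (TL (l :: L0)).1.1 = c.
  have := stkF_KS 0 (sL : size (l :: L0) = size S').
  rewrite -(stk_morph (toF_dn (B:=word)) (toF_up upW) (toF_s0 s0)) -/(TL _) KE.
  by case.
have e2 := gv i.+1 it; rewrite /= -/(q i.+1 (l :: L0)) in e2.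
have : toF (TL (l :: L0)) = toF (q i.+1 (l :: L0)).
  rewrite /toF cE ic; congr pair.
  move: iE; rewrite lE /toB foldlE e2 e1 ic cE => /eqP; rewrite eqseq_cat // eqxx /=.
  by move/eqP.
rewrite -[lbl _ _ _ _ _]/(TL (l :: L0)) => ->.
apply: map_f; rewrite /q /= -/t; apply: mem_nth; by rewrite size_visited.
Qed.

End StructureCollision.

(** Staying at 0 is intended: moving up from an empty suffix creates a class with an empty suffix.
    Iterating [pm] thus gives a reflected walk. *)
Definition pm (dir : bool) (k : nat) : nat := if dir then k.+1 else k.-1.

(* Number of letters of a label since its class was created. *)
Fixpoint kst (S : seq (nat * bool)) (d : nat) : nat :=
  if S is s :: S' then
    if (d < s.1)%N then pm s.2 (kst S' 0) else kst S' (d - s.1).+1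
  else 0%N.

Lemma KS_kst S d : (KS S d).2 = kst S d.
Proof.
rewrite /KS; elim: S d => //= s S IH d; rewrite -!IH; case: ifP => // _.
rewrite /mstep /pm /=; case: (s.2) => //; rewrite /upK.
by case: (stk _ _ _ _ 0) => [c [|k]].
Qed.

Lemma khead_kst s S : khead (s :: S) = pm s.2 (kst S 0).
Proof. by rewrite /khead KS_kst. Qed.

(* No vertex of the window [w] is the parent of pending child [d]. *)
Fixpoint np (w : seq nat) (d : nat) : bool :=
  if w is a :: w' then (a <= d)%N && np w' (d - a).+1 else true.

(** * Depth along the ancestral line *)

Section Depth.
Variable R : realType.

Definition ddir : seq (R * bool) := [:: (2^-1, true); (2^-1, false)].

Lemma Ex_ddir f : Ex ddir f = 2^-1 * f true + 2^-1 * f false.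
Proof. by rewrite /Ex /ddir big_cons big_seq1. Qed.

Lemma ddir_law : is_law ddir.
Proof. by split; rewrite ?Ex_ddir /=; lra. Qed.

Section Scan.
Variable dxi : seq (R * nat).
Hypothesis dxilaw : is_law dxi.
Let dS := dprod dxi ddir.
Let dSlaw : is_law dS := dprod_law dxilaw ddir_law.

(** Scanning backwards, either none of the [y] most recent vertices is the parent of pending child
    [d], which is [np], or the parent is found and at least [L] older vertices remain to determine
    its own depth. *)
Lemma scan_parent (f : nat -> R) (B : R) (L : nat) :
  (forall k, 0 <= f k <= 1) -> 0 <= B ->
  (forall m', (L <= m')%N -> Ex ddir (fun dir =>
      Ex (iid dS m') (fun S => f (pm dir (kst S 0)))) <= B) ->
  forall y d m, (L <= m)%N ->
    Ex (iid dS (y + m)) (fun S => f (kst S d)) <= Pr (iid dxi y) (np^~ d) + B.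
Proof.
move=> f01 B0 fB; elim=> [|y IH] d m Lm.
  rewrite /Pr Ex_iid0 /= add0n ler_wpDr //.
  by apply: Ex_lec => [|S]; [exact: iid_law|case/andP: (f01 (kst S d))].
rewrite addSn Ex_iidS Ex_dprod /Pr Ex_iidS -[X in _ + X](Ex_cst dxilaw) -ExD.
apply: le_Ex => // a /=; case: ltnP => da /=.
  rewrite [X in _ <= X + _](_ : _ = 0) ?add0r; last first.
    by rewrite -[RHS](Ex0 (iid dxi y)); apply: eq_Ex.
  by apply: fB; rewrite (leq_trans Lm) // leq_addl.
rewrite -/(Pr _ _) Ex_cst; last exact: ddir_law.
exact: IH.
Qed.

(** Climb [g] generations, allowing [x] vertices for each search of a parent. The directions of the
    ancestors are fair and independent, so unless a search fails the depth is at least that of a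
    reflected walk started at 0, because [pm] is monotone in the depth. *)
Lemma kst_law_le x g (f : nat -> R) m :
  (forall k, 0 <= f k <= 1) -> {homo f : i j / (i <= j)%N >-> j <= i} ->
  (g * x <= m)%N ->
  Ex (iid dS m) (fun S => f (kst S 0)) <=
  g%:R * Pr (iid dxi x) (np^~ 0%N) + Ex (iid ddir g) (fun ds => f (foldr pm 0%N ds)).
Proof.
elim: g f m => [|g IH] f m f01 fmon gm.
  rewrite mul0r add0r Ex_iid0 /=; apply: Ex_lec; first exact: iid_law.
  by move=> S; apply: fmon.
have pr0 : 0 <= Pr (iid dxi x) (np^~ 0%N) by apply: Pr_ge0; apply: iid_law.
have -> : (m = x + (m - x))%N by rewrite subnKC // (leq_trans _ gm) // mulSn leq_addr.
rewrite -natr1 mulrDl mul1r addrC addrA -addrA.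
rewrite [X in _ <= X](_ : _ = Pr (iid dxi x) (np^~ 0%N) +
   (g%:R * Pr (iid dxi x) (np^~ 0%N) + Ex (iid ddir g.+1) (fun ds => f (foldr pm 0%N ds)))); last by ring.
apply: (@scan_parent f _ (g * x)) => //.
- rewrite addr_ge0 ?mulr_ge0 // Ex_ge0 //; first exact/iid_law/ddir_law.
  by move=> ds; case/andP: (f01 (foldr pm 0%N ds)).
- move=> m' gm'; rewrite Ex_iidS -[X in X + _](Ex_cst ddir_law) -ExD.
  apply: le_Ex; first exact: ddir_law.
  move=> dir /=; apply: (IH (fun k => f (pm dir k))) => //.
  by move=> i j ij; apply: fmon; rewrite /pm; case: dir; rewrite ?ltnS //; lia.
- by rewrite leq_subRL ?(leq_trans _ gm) // mulSn ?leq_addr //.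
Qed.

End Scan.

(** Staying at 0 with probability 1/2 amounts to folding the simple walk on the integers by
    identifying [j] with [- j - 1]. Exactly one of the two has the parity of [g], whence a single
    binomial coefficient with [(g + j) / 2] rounded up. *)
Lemma reflected_pmf g j :
  Pr (iid ddir g) (fun ds => foldr pm 0%N ds == j) = 'C(g, (g + j).+1./2)%:R / 2 ^+ g.
Proof.
elim: g j => [|g IH] j.
  by rewrite /Pr Ex_iid0 /= expr0 divr1; case: j => [|[|j]] //=; rewrite bin0n.
rewrite /Pr Ex_iidS Ex_ddir /= exprS invfM.
have E1 k : Ex (iid ddir g) (fun s => (foldr pm 0%N s == k)%:R) =
   'C(g, (g + k).+1./2)%:R / 2 ^+ g by exact: IH.
case: j => [|j].
  rewrite (_ : Ex _ (fun s => (_.+1 == 0%N)%:R) = 0); last exact: Ex0.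
  rewrite (@eq_Ex _ _ _ _ (fun s => (foldr pm 0%N s == 0%N)%:R + (foldr pm 0%N s == 1%N)%:R)); last first.
    by move=> s; case: (foldr _ _ _) => [|[|k]] //=; rewrite ?addr0 ?add0r.
  rewrite ExD !E1 mulr0 add0r -mulrDl -natrD mulrCA; congr (_%:R * _).
  rewrite !addn0 addn1.
  have -> : (g.+2./2 = g./2.+1)%N by lia.
  rewrite binS; case/boolP: (odd g) => og; last first.
    by rewrite -[g.+1./2]/(uphalf g) uphalf_half (negbTE og) addnC.
  have gE := odd_double_half g; rewrite og in gE.
  rewrite -[g.+1./2]/(uphalf g) uphalf_half og add1n.
  congr addn; rewrite -[RHS]bin_sub; last by lia.
  by congr binomial; lia.
rewrite (@eq_Ex _ _ _ (fun s => ((foldr pm 0%N s).+1 == j.+1)%:R) (fun s => (foldr pm 0%N s == j)%:R)); last by [].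
rewrite (@eq_Ex _ _ _ (fun s => ((foldr pm 0%N s).-1 == j.+1)%:R) (fun s => (foldr pm 0%N s == j.+2)%:R)); last first.
  by move=> s; case: (foldr _ _ _).
rewrite !E1 -mulrDr -mulrDl -natrD mulrCA; congr (_%:R * _).
rewrite !addnS binS addnC -[(g + j).+3./2]/((g + j).+1./2.+1).
by [].
Qed.

End Depth.

(** * Lukasiewicz walks *)

(* The walk started with [j] pending vertices dies exactly at the end of [s]. *)
Fixpoint hit (s : seq nat) (j : nat) : bool :=
  if s is a :: s' then (0 < j)%N && hit s' (j.-1 + a) else j == 0%N.

(** A pending child whose parent precedes the window was already pending when the window began. The
    vertices then in front of it, [size w + d - sumn w] in number, are exhausted by the window and
    its continuation [s], so the forward walk started from that height dies on time. *)
Lemma np_hit w d : np w d -> (sumn w <= size w + d)%N /\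
  forall s, hit s d -> hit (rev w ++ s) (size w + d - sumn w).
Proof.
elim: w d => [|a w IH] d /=; first by move=> _; split => // s; rewrite add0n subn0.
case/andP=> ad /IH[le H]; split; first by lia.
move=> s sd; rewrite rev_cons cat_rcons.
have -> : ((size w).+1 + d - (a + sumn w) = size w + (d - a).+1 - sumn w)%N by lia.
by apply: H => /=; rewrite subnK.
Qed.

Lemma bin_central_max h i : ('C(h.*2, h + i) <= 'C(h.*2, h))%N.
Proof.
elim: i => [|i IH]; first by rewrite addn0.
apply: leq_trans IH; rewrite addnS -(@leq_pmul2l (h + i).+1) //.
by rewrite mul_bin_left leq_mul2r; apply/orP; right; lia.
Qed.

(** The usual bound of the central binomial coefficient by [4 ^ h] over the square root of
    [2 h + 1], squared to stay within the integers. *)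
Lemma bin_central_sqr h : ('C(h.*2, h) ^ 2 * h.*2.+1 <= 16 ^ h)%N.
Proof.
elim: h => [|h IH] //.
have E : (h.+1 * 'C(h.+1.*2, h.+1) = 2 * h.*2.+1 * 'C(h.*2, h))%N.
  rewrite doubleS -mul_bin_diag -[h.*2.+2]/(h.+1.*2) -mul2n -!mulnA; congr muln.
  rewrite mul_bin_diag; congr muln.
  by rewrite -bin_sub; [congr binomial; lia | lia].
rewrite -(@leq_pmul2l (h.+1 ^ 2)) // mulnA -expnMn E (expnS 16).
move: IH; move: ('C(h.*2, h)) => c IH.
rewrite !expnMn; apply: (@leq_trans (h.+1 ^ 2 * (16 * (c ^ 2 * h.*2.+1)))); last first.
  by rewrite !leq_mul2l IH !orbT.
rewrite -!mul2n; nia.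
Qed.

Section Passage.
Variable R : realType.

Lemma reflected_small h D y : (y ^ 2 <= h.*2.+1)%N -> (0 < y)%N ->
  Pr (iid (ddir R) h.*2) (fun ds => (foldr pm 0 ds < D)%N) <= D%:R / y%:R.
Proof.
move=> yh y0.
have cb : 'C(h.*2, h)%:R / 2 ^+ h.*2 <= y%:R^-1 :> R.
  rewrite ler_pdivrMr ?exprn_gt0 // mulrC ler_pdivlMr ?ltr0n //.
  rewrite -natrX -natrM ler_nat -(@leq_exp2r _ _ 2) // expnMn -expnM.
  rewrite -[X in (_ <= X)%N](_ : (16 ^ h = _)%N); last first.
    by rewrite -[16%N]/(2 ^ 4)%N -expnM; congr expn; lia.
  apply: leq_trans (bin_central_sqr h); by rewrite leq_mul2l yh orbT.
apply: (@le_trans _ _ (Ex (iid (ddir R) h.*2)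
   (fun ds => \sum_(j < D) (foldr pm 0%N ds == j)%:R))).
  apply: le_Ex; first exact/iid_law/ddir_law.
  move=> ds; case: ltnP => [lt|_]; last by apply: sumr_ge0.
  rewrite (bigD1 (Ordinal lt)) //= eqxx lerDl.
  by apply: sumr_ge0.
rewrite Ex_sum -[D in leRHS]card_ord mulr_natl -sumr_const; apply: ler_sum => j _.
rewrite -/(Pr _ _) reflected_pmf; apply: le_trans cb.
rewrite ler_wpM2r ?invr_ge0 ?exprn_ge0 // ler_nat.
have -> : ((h.*2 + j).+1./2 = h + (j.+1)./2)%N by lia.
exact: bin_central_max.
Qed.

Section Kemperman.
Variables (d : seq (R * nat)).
Hypothesis dlaw : is_law d.

Lemma Ex_iid_rot m n f :
  Ex (iid d (n + m)) (fun s => f (rot n s)) = Ex (iid d (m + n)) f.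
Proof.
rewrite !Ex_iidD Ex_swap; apply: eq_Ex_iid => s ss; apply: eq_Ex_iid => t st.
by rewrite /rot drop_size_cat // take_size_cat.
Qed.

(** Exchangeability, obtained from rotations: all entries have the same joint law with the sum. *)
Lemma Ex_head_sumn n (G : nat -> R) :
  n.+1%:R * Ex (iid d n.+1) (fun s => (head 0%N s)%:R * G (sumn s)) =
  Ex (iid d n.+1) (fun s => (sumn s)%:R * G (sumn s)).
Proof.
have E i : (i < n.+1)%N -> Ex (iid d n.+1) (fun s => (head 0%N s)%:R * G (sumn s)) =
    Ex (iid d n.+1) (fun s => (nth 0%N s i)%:R * G (sumn s)).
  move=> i_n; have nE : (n.+1 = (n.+1 - i) + i)%N by rewrite subnK // ltnW.
  rewrite {1}nE -Ex_iid_rot addnC -nE; apply: eq_Ex_iid => s ss.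
  have -> : sumn (rot i s) = sumn s by rewrite !sumnE; apply: perm_big; rewrite perm_rot.
  by congr (_%:R * _); rewrite /rot -nth0 nth_cat size_drop ss subn_gt0 i_n nth_drop addn0.
transitivity (\sum_(i < n.+1) Ex (iid d n.+1) (fun s => (nth 0%N s i)%:R * G (sumn s))).
  rewrite -(eq_bigr (fun=> _) (fun (i : 'I_n.+1) _ => E i (ltn_ord i))).
  by rewrite sumr_const card_ord mulr_natl.
rewrite -Ex_sum; apply: eq_Ex_iid => s ss.
by rewrite -mulr_suml -natr_sum; congr (_%:R * _); rewrite sumnE (big_nth 0%N) ss big_mkord.
Qed.

(** Kemperman's first-passage formula. Condition on the first step and apply the induction
    hypothesis; [Ex_head_sumn] then replaces the first step by the average of the steps, which the
    constraint on the sum determines. *)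
Lemma kemperman n j :
  n%:R * Pr (iid d n) (hit^~ j) = j%:R * Pr (iid d n) (fun s => (sumn s + j == n)%N).
Proof.
elim: n j => [|n IH] j.
  by rewrite mul0r /Pr Ex_iid0; case: j => [|j]; rewrite ?mul0r ?mulr0.
case: j => [|j].
  rewrite mul0r (_ : Pr _ _ = 0) ?mulr0 // /Pr Ex_iidS -[RHS](Ex0 d).
  by apply: eq_Ex => a; rewrite -[RHS](Ex0 (iid d n)).
case: (posnP n) => [->|n0].
  rewrite mul1r /Pr !Ex_iidS -ExZ; apply: eq_Ex => a; rewrite !Ex_iid0 /=.
  rewrite addn0 addnS eqSS [(a + j)%N]addnC; case: eqP => [e|_]; last by rewrite mulr0.
  have -> : j = 0%N by lia.
  by rewrite mulr1.
apply: (@mulfI _ (n%:R : R)); first by rewrite pnatr_eq0 -lt0n.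
rewrite mulrCA /Pr Ex_iidS /= -[n%:R * Ex d _]ExZ.
under eq_Ex => a do rewrite -[Ex (iid d n) _]/(Pr (iid d n) (hit^~ (j + a)%N)) IH -ExZ.
rewrite -(Ex_iidS d n (fun s => (j + head 0 s)%N%:R * (sumn (behead s) + (j + head 0 s) == n)%N%:R)).
rewrite (@eq_Ex_iid _ _ d n.+1 _ (fun s => j%:R * (sumn s + j == n)%N%:R +
   (head 0%N s)%:R * (sumn s + j == n)%N%:R)); last first.
  move=> [|a s] //= _; rewrite natrD mulrDl.
  by have -> : (sumn s + (j + a) = a + sumn s + j)%N by lia.
rewrite ExD mulrDr (Ex_head_sumn n (fun k => (k + j == n)%N%:R)).
rewrite -[X in X + _]ExZ -ExD [RHS]mulrA -[RHS]ExZ; apply: eq_Ex => s.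
rewrite addnS eqSS; case: eqP => [<-|]; last by rewrite !mulr0 addr0.
by rewrite !mulr1 -!natr1 natrD; ring.
Qed.

(** By [np_hit] the reversed window is a first passage from height [x - sumn w]; summing Kemperman's
    formula over all heights leaves the mean of the deficit. *)
Lemma np_deficit x :
  x%:R * Pr (iid d x) (np^~ 0%N) <= Ex (iid d x) (fun w => (x - sumn w)%N%:R).
Proof.
have law' := iid_law dlaw x.
apply: (@le_trans _ _ (x%:R * Ex (iid d x) (fun w => \sum_(j < x.+1) (hit (rev w) j)%:R))).
  apply: ler_wpM2l => //; apply: le_Ex_iid => // w wx.
  case: (boolP (np w 0)) => [|_]; last by apply: sumr_ge0.
  move/np_hit => [_ /(_ [::] isT)]; rewrite cats0 wx addn0 => wh.
  have lt : (x - sumn w < x.+1)%N by rewrite ltnS leq_subr.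
  rewrite (bigD1 (Ordinal lt)) //= wh lerDl; by apply: sumr_ge0.
rewrite Ex_sum mulr_sumr.
under eq_bigr => j _ do rewrite (Ex_iid_rev d x (fun w => (hit w j)%:R)) -/(Pr _ _) kemperman -ExZ.
rewrite -Ex_sum; apply: le_Ex => // w.
case: (leqP (sumn w) x) => wx; last first.
  rewrite big1 // => j _; rewrite (_ : (_ == _) = false) ?mulr0 //.
  by apply/negbTE; rewrite gtn_eqF // ltn_addr.
have lt : (x - sumn w < x.+1)%N by rewrite ltnS leq_subr.
rewrite (bigD1 (Ordinal lt)) //= big1 ?addr0; last first.
  move=> j jx; rewrite (_ : (_ == _) = false) ?mulr0 //; apply/negbTE.
  apply: contra jx => /eqP jE; apply/eqP/val_inj => /=.
  by apply/eqP; rewrite -(eqn_add2l (sumn w)) jE subnKC.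
by rewrite subnKC // eqxx mulr1.
Qed.

Lemma Ex_sum_sqr (f : nat -> R) n : Ex d f = 0 ->
  Ex (iid d n) (fun s => (\sum_(a <- s) f a) ^+ 2) = n%:R * Ex d (fun a => f a ^+ 2).
Proof.
move=> f0.
have m0 k : Ex (iid d k) (fun s => \sum_(a <- s) f a) = 0.
  elim: k => [|k IH]; first by rewrite Ex_iid0 big_nil.
  rewrite Ex_iidS (@eq_Ex _ _ _ _ f) // => a.
  under eq_Ex do rewrite big_cons.
  by rewrite ExD IH addr0 Ex_cst //; exact: iid_law.
elim: n => [|n IH]; first by rewrite Ex_iid0 big_nil expr0n mul0r.
rewrite Ex_iidS -natr1 mulrDl mul1r -IH -[X in X + _](Ex_cst dlaw) -ExD.
apply: eq_Ex => a.
under eq_Ex do rewrite big_cons sqrrD.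
rewrite !ExD Ex_cst; last exact: iid_law.
by rewrite ExZ m0 mulr0 addr0 addr0 addrC.
Qed.

End Kemperman.

End Passage.

(** * Capped offspring laws and the deficit of the walk *)

Section CappedOffspring.
Variables (R : realType) (mu : nat -> R).

(** For a probability [mu] this is the law of min(xi, N): finitely supported, and the same as [mu]
    for events that cannot tell apart values from [N] on. *)
Definition cap (N : nat) : seq (R * nat) :=
  rcons [seq (mu j, j) | j <- iota 0 N] (1 - \sum_(0 <= j < N) mu j, N).

Lemma Ex_cap N f : Ex (cap N) f =
  \sum_(0 <= j < N) mu j * f j + (1 - \sum_(0 <= j < N) mu j) * f N.
Proof.
rewrite /Ex /cap -cats1 big_cat big_seq1 big_map /=; congr (_ + _).
by rewrite /index_iota subn0.
Qed.

(* The tail clause is the common consequence of a finite variance and of the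
   attraction to a stable law of index greater than 1. *)
Record offspring (q : nat) (C : R) : Prop := Offspring {
  mu_ge0 : forall j, 0 <= mu j;
  mu_mass : forall N, \sum_(0 <= j < N) mu j <= 1;
  mu_cap_mean : forall N, Ex (cap N) (fun j => j%:R) <= 1;
  mu_C : 0 <= C;
  mu_tail : forall k, (0 < k)%N -> 1 - C / k%:R <= \sum_(0 <= j < k ^ q) mu j * j%:R }.

Variables (q : nat) (C : R).
Hypothesis H : offspring q C.

Lemma cap_law N : is_law (cap N).
Proof.
split; last by rewrite Ex_cap !mulr1; under eq_bigr do rewrite mulr1; rewrite subrKC.
rewrite /cap all_rcons /= subr_ge0 (mu_mass H) all_map /=.
by apply/allP => j _; apply: (mu_ge0 H).
Qed.

Lemma Ex_cap_stable N K f : (K <= N)%N -> (forall j, f j = f (minn j K)) ->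
  Ex (cap N) f = Ex (cap K) f.
Proof.
move=> KN fK; rewrite !Ex_cap !(big_cat_nat (leq0n K) KN) //=.
have fN j : (K <= j)%N -> f j = f K by move=> Kj; rewrite fK (minn_idPr Kj).
rewrite [\sum_(K <= j < N) mu j * _](_ : _ = (\sum_(K <= j < N) mu j) * f K); last first.
  by rewrite mulr_suml; apply: eq_big_nat => j /andP[/fN -> _].
by rewrite fN //; ring.
Qed.

Lemma truncated_mean_le1 t : \sum_(0 <= j < t) mu j * j%:R <= 1.
Proof.
apply: le_trans (mu_cap_mean H t); rewrite Ex_cap lerDl mulr_ge0 //.
by rewrite subr_ge0 (mu_mass H).
Qed.

(** Truncate the steps at [t = k ^ q]. By [mu_tail] this loses at most [C / k] of the mean per step,
    and truncated steps have variance at most [t], so their sum has variance at most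
    [x t <= (x / k) ^ 2]. *)
Lemma deficit_le N k x : (0 < k)%N -> (k ^ q <= N)%N -> (k ^ (q + 2) <= x)%N ->
  Ex (iid (cap N) x) (fun w => (x - sumn w)%N%:R) <= (1 + C) * (x%:R / k%:R).
Proof.
move=> k0 tN kx; set t := (k ^ q)%N in tN.
have law := cap_law N; have law' := iid_law law x.
have x0 : (0 < x)%N by rewrite (leq_trans _ kx) // expn_gt0 k0.
have kR : 0 < k%:R :> R by rewrite ltr0n.
have xR : 0 < x%:R :> R by rewrite ltr0n.
pose z (a : nat) : R := if (a < t)%N then a%:R else 0.
pose m := Ex (cap N) z.
have mE : m = \sum_(0 <= j < t) mu j * j%:R.
  rewrite /m Ex_cap {2}/z ltnNge tN /= mulr0 addr0 (big_cat_nat (leq0n t) tN) //=.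
  rewrite [X in _ + X]big_nat_cond [X in _ + X]big1 ?addr0; last first.
    by move=> j /andP[/andP[tj _] _]; rewrite /z ltnNge tj mulr0.
  by apply: eq_big_nat => j /andP[_ jt]; rewrite /z jt.
have m1 : m <= 1 by rewrite mE truncated_mean_le1.
have mC : 1 - m <= C / k%:R by rewrite mE; have := mu_tail H k0; rewrite -/t; lra.
have z0 a : 0 <= z a by rewrite /z; case: ifP.
have m0 : 0 <= m by apply: Ex_ge0.
pose f a := m - z a.
have f0 : Ex (cap N) f = 0 by rewrite ExB Ex_cst // subrr.
have f2 : Ex (cap N) (fun a => f a ^+ 2) <= t%:R.
  apply: (@le_trans _ _ (Ex (cap N) (fun a => t%:R * z a + m * (m - 2 * z a)))).
    apply: le_Ex => // a; rewrite /f.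
    have : z a ^+ 2 <= t%:R * z a.
      by rewrite /z; case: ltnP => // at_; rewrite ?expr2 ?mulr0 // ler_wpM2r // ler_nat ltnW.
    by move: (z a) => b; nra.
  rewrite ExD !ExZ ExB Ex_cst // ExZ -/m.
  have t0 : 0 <= t%:R :> R by []; nra.
(* [A] bounds the standard deviation of the truncated sum; the inequality
   [s <= s ^ 2 / (2 A) + A / 2] replaces Cauchy-Schwarz. *)
pose A := x%:R / k%:R : R.
have A0 : 0 < A by apply: divr_gt0.
pose S (w : seq nat) := \sum_(a <- w) f a.
apply: (@le_trans _ _ (Ex (iid (cap N) x)
   (fun w => S w ^+ 2 * (2 * A)^-1 + (A / 2 + x%:R * (1 - m))))).
  apply: le_Ex_iid => // w wx.
  have SE : S w = x%:R * m - \sum_(a <- w) z a.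
    by rewrite /S sumrB big_const_seq count_predT iter_addr_0 wx mulr_natl.
  have zs : \sum_(a <- w) z a <= (sumn w)%:R.
    rewrite sumnE natr_sum; apply: ler_sum => a _; rewrite /z; by case: ifP.
  have yA : S w <= S w ^+ 2 * (2 * A)^-1 + A / 2.
    have -> : S w ^+ 2 * (2 * A)^-1 + A / 2 = S w + (S w - A) ^+ 2 / (2 * A).
      by field; rewrite gt_eqF.
    by rewrite lerDl divr_ge0 ?sqr_ge0 // mulr_ge0 // ltW.
  have g0 : 0 <= S w ^+ 2 * (2 * A)^-1 by rewrite mulr_ge0 ?sqr_ge0 // invr_ge0 mulr_ge0 // ltW.
  have e0 : 0 <= x%:R * (1 - m) by rewrite mulr_ge0 // subr_ge0.
  case: (leqP (sumn w) x) => wx'; last first.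
    by move: wx' => /ltnW; rewrite -subn_eq0 => /eqP ->; rewrite addr_ge0 // addr_ge0 // divr_ge0 // ltW.
  rewrite natrB //; move: yA zs SE; move: (S w) => s; lra.
rewrite ExD Ex_cst // ExZr Ex_sum_sqr //.
have tk : t%:R * k%:R ^+ 2 <= x%:R :> R.
  by rewrite -natrX -natrM ler_nat -expnD.
have -> : (1 + C) * (x%:R / k%:R) = A / 2 + A / 2 + x%:R * (C / k%:R) by rewrite /A; field; rewrite gt_eqF.
rewrite addrA; apply: lerD; last by rewrite ler_wpM2l // ltW.
rewrite lerD2r ler_pdivrMr; last exact: mulr_gt0 (ltr0Sn _ 1) A0.
apply: (@le_trans _ _ (x%:R * t%:R)); first by rewrite ler_wpM2l // ltW.
have -> : A / 2 * (2 * A) = x%:R * (x%:R / k%:R ^+ 2) by rewrite /A; field; rewrite gt_eqF.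
by apply: ler_wpM2l; rewrite ?(ltW xR) // ler_pdivlMr ?exprn_gt0.
Qed.

Notation dS N := (dprod (cap N) (ddir R)).

(** Take [2 y ^ 2] generations: the reflected walk is then below [D] with probability at most
    [D / y]. Each parent is sought among [y ^ (3 (q + 2))] vertices and missed with probability at
    most [(1 + C) / y ^ 3], which is [deficit_le] at [k = y ^ 3]. *)
Lemma depth_small N y D m : (0 < y)%N -> (y ^ (3 * q) <= N)%N ->
  (2 * y ^ (3 * q + 8) <= m)%N ->
  Pr (iid (dS N) m) (fun S => (kst S 0 < D)%N) <= (2 * (1 + C) + D%:R) / y%:R.
Proof.
move=> y0 yN ym.
have yR : 0 < y%:R :> R by rewrite ltr0n.
have x0 : (0 < y ^ (3 * (q + 2)))%N by rewrite expn_gt0 y0.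
have law := cap_law N.
apply: (@le_trans _ _ ((y ^ 2).*2%:R * Pr (iid (cap N) (y ^ (3 * (q + 2)))) (np^~ 0%N) +
   Pr (iid (ddir R) (y ^ 2).*2) (fun ds => (foldr pm 0 ds < D)%N))).
  apply: (kst_law_le law (f := fun k => (k < D)%N%:R)).
  - by move=> k; case: (_ < _)%N; rewrite ?lexx ?ler01.
  - by move=> i j ij /=; rewrite ler_nat; case: (ltnP j D) => // jD; rewrite (leq_ltn_trans ij jD).
  - apply: leq_trans ym; rewrite -mul2n -mulnA -expnD leq_mul2l /=.
    by have -> : (2 + 3 * (q + 2) = 3 * q + 8)%N by lia.
rewrite mulrDl; apply: lerD; last first.
  by apply: reflected_small => //; rewrite ltnW // ltnS -mul2n leq_pmull.
have np1 : Pr (iid (cap N) (y ^ (3 * (q + 2)))) (np^~ 0%N) <= (1 + C) / (y ^ 3)%:R.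
  have := np_deficit law (y ^ (3 * (q + 2))).
  have := @deficit_le N (y ^ 3) (y ^ (3 * (q + 2))).
  rewrite expn_gt0 y0 -!expnM => /(_ isT yN (leqnn _)) d1 d2.
  have := le_trans d2 d1; rewrite mulrCA ler_pM2l ?ltr0n //.
apply: le_trans (ler_wpM2l _ np1) _ => //.
rewrite -mul2n natrM !natrX le_eqVlt; apply/orP; left; apply/eqP.
by field; rewrite gt_eqF.
Qed.

End CappedOffspring.

Lemma upF_dnF i l y a : upF i l (dnF y a) = y.
Proof. by case: y => c w; rewrite /upF /dnF /= wparent_rcons; case: w. Qed.

(** Formal labels themselves form a machine in which [upF] undoes [dnF], so [fcoll_coll] applies
    with the formal labels of the longer list in the role of true labels. *)
Lemma fcoll_catr t h : fcoll t -> fcoll (t ++ h).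
Proof.
case: t => [//|x t] xt.
rewrite /= visited_cat mem_cat /lbl stk_cat /mstep size_cat; apply/orP; left.
apply: (@fcoll_coll _ dnF (fun i => upF (i + size h)%N) _ x t _ xt) => i l y a.
exact: upF_dnF.
Qed.

Definition capv (K : nat) (x : vtx) : vtx := ((minn x.1.1 K, x.1.2), x.2).

(** The recursion only inspects pending children of index below [d + size t], so offspring numbers
    from [K] on all act alike. *)
Lemma stk_capv (B : Type) dn up s0 K t d : (d + size t <= K)%N ->
  @stk B dn up s0 (map (capv K) t) d = stk dn up s0 t d.
Proof.
elim: t d => //= x t IH d dK; rewrite size_map leq_min.
have -> : (d < K)%N by lia.
rewrite andbT IH ?add0n; last by lia.
case: ltnP => // xd; rewrite (minn_idPl _); last by lia.
by apply: IH; lia.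
Qed.

Lemma visited_capv (B : Type) dn up s0 K t : (size t <= K)%N ->
  @visited B dn up s0 (map (capv K) t) = visited dn up s0 t.
Proof.
elim: t => //= x t IH tK; rewrite IH ?(ltnW tK) // /lbl stk_capv ?(ltnW tK) //.
by rewrite /mstep size_map.
Qed.

Lemma fcoll_capv K t : (size t <= K)%N -> fcoll (map (capv K) t) = fcoll t.
Proof.
case: t => //= x t tK; rewrite visited_capv ?(ltnW tK) //.
by rewrite /lbl stk_capv ?(ltnW tK) // /mstep size_map.
Qed.

Lemma coll_cat s0 x t h :
  coll s0 [::] ((x :: t) ++ h) = coll (stk dnW upW s0 h) (visited dnW upW s0 h) (x :: t).
Proof.
rewrite /= visited_cat /= !mem_cat orbC.
by rewrite /lbl stk_cat.
Qed.

(** A line of descent: each vertex is the parent of the next one visited, and each label is a child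
    of the previous one. *)
Definition chain (S : seq (nat * bool)) : bool := all (fun s => (0 < s.1)%N && s.2) S.

Lemma chain_kst e u : chain e -> kst (e ++ u) 0 = (size e + kst u 0)%N.
Proof. by elim: e => //= s e IH /andP[/andP[-> ->] /IH /= ->]. Qed.

Lemma chain_khead e u : chain e -> (0 < size e)%N ->
  khead (e ++ u) = (size e + kst u 0)%N.
Proof.
case: e => // s e ce _; rewrite cat_cons khead_kst.
by move: ce => /= /andP[/andP[_ ->] /chain_kst ->].
Qed.

(** Along a descending chain started at the root of W_b the labels become strictly longer. *)
Lemma chain_coll t : chain (map fst t) -> ~~ coll (fun=> [::]) [::] t.
Proof.
have H u : chain (map fst u) -> size (stk dnW upW (fun=> [::]) u 0) = size u /\
    forall y, y \in visited dnW upW (fun=> [::]) u -> (size y <= size u)%N.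
  elim: u => [|x u IH] //= /andP[/andP[x1 x2] /IH[su vu]].
  rewrite x1 /lbl /mstep x2; split; first by rewrite size_rcons su.
  move=> y; rewrite inE => /orP[/eqP ->|/vu/leqW//].
  by rewrite size_rcons su.
case: t => //= x t /andP[/andP[_ x2] /H[st vt]].
apply/negP => /vt; rewrite /lbl /mstep x2 size_rcons st ltnn //.
Qed.

(** * Novelty of a label given the past *)

Section Conditional.
Variables (R : realType) (mu : nat -> R) (q : nat) (C : R) (b : nat).
Hypothesis H : offspring mu q C.
Hypothesis b2 : (2 <= b)%N.

Definition letters : seq (R * nat) := [seq (b%:R^-1, i) | i <- iota 1 b].

Lemma Ex_letters f : Ex letters f = b%:R^-1 * \sum_(i <- iota 1 b) f i.
Proof. by rewrite /Ex /letters big_map mulr_sumr. Qed.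

Lemma letters_law : is_law letters.
Proof.
split; first by rewrite all_map; apply/allP => i _ /=.
rewrite Ex_letters big_const_seq count_predT size_iota iter_addr_0 mulVf //.
by rewrite pnatr_eq0; case: b b2.
Qed.

Lemma letters_point a : Pr letters (fun l => l == a) <= b%:R^-1.
Proof.
rewrite /Pr Ex_letters -[leRHS]mulr1 ler_wpM2l //.
rewrite -natr_sum -[1]/(1%:R) ler_nat.
rewrite (_ : (\sum_(i <- iota 1 b) _ = count_mem a (iota 1 b))%N).
  by rewrite count_uniq_mem ?iota_uniq // leq_b1.
by rewrite -sum1_count [RHS]big_mkcond; apply: eq_bigr => i _ /=; case: (i == a).
Qed.

Definition dS N := dprod (cap mu N) (ddir R).
Definition dX N := dprod (dS N) letters.

Lemma dS_law N : is_law (dS N).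
Proof. by apply: dprod_law; [exact: cap_law H N|exact: ddir_law]. Qed.

Lemma dX_law N : is_law (dX N).
Proof. by apply: dprod_law; [exact: dS_law|exact: letters_law]. Qed.

Lemma Pr_dX_struct N m (P : seq (nat * bool) -> bool) :
  Pr (iid (dX N) m) (fun t => P (map fst t)) = Pr (iid (dS N) m) P.
Proof.
rewrite /Pr Ex_iid_pair; apply: eq_Ex_iid => S sS.
rewrite -[RHS](Ex_cst (iid_law letters_law m)); apply: eq_Ex_iid => l sl.
by rewrite -/(unzip1 _) unzip1_zip // sS sl.
Qed.

(* A collision that does not occur formally matches [khead] fresh letters. *)
Lemma informal_collision N m s0 A D (chi : seq (nat * bool) -> bool) :
  Pr (iid (dX N) m) (fun t => [&& chi (map fst t), coll s0 A t & ~~ fcoll t]) <=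
  Pr (iid (dS N) m) (fun S => chi S && (khead S < D)%N) +
  (size A + m)%:R * b%:R^-1 ^+ D * Pr (iid (dS N) m) chi.
Proof.
have bb : (0 <= b%:R^-1 :> R) && (b%:R^-1 <= 1 :> R).
  by rewrite invr_ge0 ler0n invf_le1 ?ltr0n ?ler1n //; case: b b2.
rewrite {1}/Pr Ex_iid_pair -ExZ -ExD; apply: le_Ex_iid; first exact: dS_law.
move=> S sS.
have law' := iid_law letters_law m.
rewrite (@eq_Ex_iid _ _ _ _ _ (fun L => (chi S)%:R * (coll s0 A (zip S L) && ~~ fcoll (zip S L))%:R)); last first.
  move=> L sL; rewrite -natrM mulnb -/(unzip1 _) unzip1_zip //; first by rewrite sS sL.
rewrite ExZ; case: (chi S); rewrite ?mul0r ?mulr0 ?addr0 //= !mul1r mulr1.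
case: ltnP => kD.
  apply: (@le_trans _ _ 1); last by rewrite lerDl mulr_ge0 // exprn_ge0 //; case/andP: bb.
  by apply: Ex_lec => // L; case: (_ && _).
rewrite add0r -sS; apply: (le_trans (structure_collision letters_law letters_point s0 A S)).
by rewrite ler_wpM2l // ler_wiXn2l //; case/andP: bb.
Qed.

Lemma shallow_head N m D :
  Pr (iid (dS N) m.+1) (fun S => (khead S < D)%N) <=
  Pr (iid (dS N) m) (fun S => (kst S 0 < D.+1)%N).
Proof.
rewrite /Pr Ex_iidS; apply: Ex_lec; first exact: dS_law.
move=> s; apply: le_Ex; first exact: (iid_law (dS_law N)).
move=> S; rewrite khead_kst; case: (ltnP _ D) => // kD.
suff -> : (kst S 0 < D.+1)%N by [].
by move: kD; rewrite /pm; case: (s.2) => /=; lia.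
Qed.

(* Formal novelty only depends on the window; [fresh N m] decreases to the constant
   of the theorem. *)
Definition fresh N m : R := Pr (iid (dX N) m) (fun t => ~~ fcoll t).

(** A formal collision is a true one, so the difference is exactly the probability of a collision
    that is not formal. *)
Lemma fresh_cond N m s0 A D :
  `| Pr (iid (dX N) m.+1) (fun t => ~~ coll s0 A t) - fresh N m.+1 | <=
  Pr (iid (dS N) m) (fun S => (kst S 0 < D.+1)%N) + (size A + m.+1)%:R * b%:R^-1 ^+ D.
Proof.
have law' := iid_law (dX_law N) m.+1.
rewrite /fresh !PrC // opprB addrC addrA subrK distrC.
have -> : Pr (iid (dX N) m.+1) (coll s0 A) - Pr (iid (dX N) m.+1) fcoll =
    Pr (iid (dX N) m.+1) (fun t => coll s0 A t && ~~ fcoll t).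
  rewrite -ExB; apply: eq_Ex_iid => -[//|x t] _.
  have := @fcoll_coll _ dnW upW s0 x t upW_dnW.
  case: (fcoll _) => [/(_ isT) xt|_]; last by rewrite andbT subr0.
  by rewrite {1}/coll mem_cat xt orbT andbF subrr.
rewrite ger0_norm ?Pr_ge0 //.
apply: le_trans (informal_collision N m.+1 s0 A D predT) _.
apply: lerD; first exact: shallow_head.
apply: ler_piMr; first by rewrite mulr_ge0 ?exprn_ge0 ?invr_ge0.
exact: (Pr_le1 (iid_law (dS_law N) _)).
Qed.

Lemma fresh_nonincr N m : fresh N m.+1 <= fresh N m.
Proof.
rewrite /fresh /Pr -addn1 Ex_iidD; apply: le_Ex; first exact: (iid_law (dX_law N)).
move=> t; apply: Ex_lec; first exact: (iid_law (dX_law N)).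
by move=> h; have := @fcoll_catr t h; case: (fcoll t) => [->|_] //; case: (fcoll _).
Qed.

Lemma fresh_stable N K m : (m <= K)%N -> (K <= N)%N -> fresh N m = fresh K m.
Proof.
move=> mK KN; rewrite /fresh /Pr.
transitivity (Ex (iid (dX N) m) (fun t => (~~ fcoll (map (capv K) t))%:R : R)).
  by apply: eq_Ex_iid => t tm; rewrite fcoll_capv ?tm.
apply: (@Ex_iid_map _ _ _ (capv K) _ _ m (fun t => (~~ fcoll t)%:R)) => h.
rewrite !Ex_dprod /= (@Ex_cap_stable _ mu N K (fun j => Ex (ddir R) (fun y => Ex letters (fun l => h ((minn j K, y), l))))) //.
  rewrite !Ex_cap minnn; congr (_ + _); apply: eq_big_nat => j /andP[_ jK].
  by rewrite (minn_idPl (ltnW jK)).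
by move=> j; rewrite -minnA minnn.
Qed.

End Conditional.

(** * Positivity of the limiting constant *)

Section Positivity.
Variables (R : realType) (mu : nat -> R) (q : nat) (C : R) (b : nat).
Hypothesis H : offspring mu q C.
Hypothesis b2 : (2 <= b)%N.
Local Notation dS := (dS mu).
Local Notation dX := (dX mu b).
Let sig0 : nat -> word := fun=> [::].

Definition chain_coll_prob N J m : R := Pr (iid (dX N) (J + m))
  (fun t => chain (take J (map fst t)) && coll sig0 [::] t).

Lemma Pr_chain_take N J M : Pr (iid (dS N) (J + M)) (fun S => chain (take J S)) =
  Pr (iid (dS N) J) chain.
Proof.
rewrite /Pr Ex_iidD; apply: eq_Ex_iid => e eJ.
rewrite -[RHS](Ex_cst (iid_law (dS_law H N) M)); apply: eq_Ex => u.
by rewrite take_size_cat.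
Qed.

(** Revealing [M'] older vertices creates a new collision of the head only if it is not formal in
    the recent window, since formal ones are already counted. [informal_collision] bounds this on
    the chain event, where the chain alone contributes [J] to the depth. *)
Lemma chain_coll_step N J M M' D : (0 < J)%N ->
  chain_coll_prob N J (M + M') <= chain_coll_prob N J M +
  Pr (iid (dS N) J) chain *
    (Pr (iid (dS N) M) (fun u => (J + kst u 0 < D)%N) +
     (M' + (J + M))%:R * b%:R^-1 ^+ D).
Proof.
move=> J0; have lawX n : is_law (iid (dX N) n) := iid_law (dX_law H b2 N) n.
have lawS n : is_law (iid (dS N) n) := iid_law (dS_law H N) n.
rewrite /chain_coll_prob /Pr addnA Ex_iidD Ex_swap.
rewrite -[leRHS](Ex_cst (lawX M')); apply: le_Ex_iid; first exact: dX_law H b2 N.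
move=> h hM'.
pose chi S := chain (take J S).
apply: (@le_trans _ _ (Ex (iid (dX N) (J + M)) (fun w => (chi (map fst w) && coll sig0 [::] w)%:R +
   [&& chi (map fst w), coll (stk dnW upW sig0 h) (visited dnW upW sig0 h) w & ~~ fcoll w]%:R))).
  apply: le_Ex_iid => [|w wJ]; first exact: dX_law H b2 N.
  have -> : take J (map fst (w ++ h)) = take J (map fst w).
    rewrite map_cat take_cat size_map wJ; case: ltnP => // JJ.
    have -> : (J - (J + M) = 0)%N by lia.
    by rewrite take0 cats0 take_oversize // size_map wJ.
  rewrite -/(chi _); case: (chi _) => /=; last by rewrite addr0.
  case: w wJ => [|x w] wJ; first by move: J0; rewrite -(leq_add2r M) -wJ.
  rewrite coll_cat; case: (coll (stk _ _ _ _) _ _) => /=; last by rewrite addr0.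
  rewrite -[_ \notin _]/(~~ fcoll (x :: w)).
  have := @fcoll_coll _ dnW upW sig0 x w upW_dnW.
  case: (fcoll (x :: w)) => [/(_ isT) ->|_]; first by rewrite addr0.
  by rewrite lerDr.
rewrite ExD lerD2l.
apply: (le_trans (informal_collision H b2 N _ _ _ D chi)).
rewrite mulrDr size_visited hM'; apply: lerD; last first.
  by rewrite mulrC /chi Pr_chain_take.
rewrite /Pr Ex_iidD -ExZr; apply: le_Ex_iid => [|e eJ]; first exact: dS_law H N.
rewrite -ExZ; apply: le_Ex => // u; rewrite /chi take_size_cat //.
case: (boolP (chain e)) => [ce|_]; last by rewrite mul0r.
by rewrite chain_khead ?eJ // mul1r.
Qed.

Lemma chain_prob N J : (0 < N)%N ->
  Pr (iid (dS N) J) chain = (2^-1 * (1 - mu 0%N)) ^+ J.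
Proof.
move=> N0; elim: J => [|J IH]; first by rewrite /Pr Ex_iid0 expr0.
rewrite exprS -IH /Pr Ex_iidS.
transitivity (Ex (dS N) (fun s => (((0 < s.1)%N && s.2)%:R : R)) * Ex (iid (dS N) J) (fun S => (chain S)%:R)).
  by rewrite -ExZr; apply: eq_Ex => s; rewrite -ExZ; apply: eq_Ex => S; rewrite /= -natrM mulnb.
congr (_ * _); rewrite Ex_dprod.
transitivity (Ex (cap mu N) (fun j => 2^-1 * (1 - (j == 0%N)%:R)) : R).
  by apply: eq_Ex => -[|j]; rewrite Ex_ddir /=; ring.
rewrite ExZ ExB Ex_cst; last exact: cap_law H N.
congr (_ * (_ - _)); rewrite Ex_cap big_ltn // big_nat_cond big1.
  by rewrite mulr1 (gtn_eqF N0) mulr0 !addr0.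
by move=> j /andP[/andP[+ _] _]; case: j => // j _; rewrite mulr0.
Qed.

(** Force the last [J] vertices to be a descending chain and reveal the past up to [M i] vertices
    for increasing [i]. Relative to the probability of the chain, the collisions cost [4 / 2 ^+ i0]
    at first and [K * (h i - h i.+1)] at scale [i], in total at most 1/2. *)
Lemma fresh_ge0_pos : mu 0%N < 1 -> exists2 c0 : R, 0 < c0 & forall m, c0 <= fresh mu b m m.
Proof.
move=> mu01; pose Q := (3 * q + 8)%N.
pose K : R := 2 * (1 + C) + (2 * Q)%:R + 4 * (2 ^ Q)%:R.
(* Chosen so that the decrements are [i.+1 / 2 ^+ i], which dominate the cost of scale [i] up to the
   factor [K] and telescope. *)
pose h (i : nat) : R := (2 * i + 4)%N%:R / 2 ^+ i.
have K0 : 0 <= K by have := mu_C H; rewrite /K; move=> C0; rewrite !addr_ge0 ?mulr_ge0 // addr_ge0.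
have hS i : h i - h i.+1 = i.+1%:R / 2 ^+ i.
  have e2 : 2 ^+ i != 0 :> R by rewrite expf_neq0.
  rewrite /h exprS; have -> : (2 * i.+1 + 4)%N%:R = (2 * i + 4)%N%:R + 2 :> R.
      by rewrite -natrD; congr (_%:R); lia.
    have -> : (2 * i + 4)%N%:R = 2 * i.+1%:R + 2 :> R.
      by rewrite -natrM -natrD; congr (_%:R); lia.
    by field; rewrite e2.
have h0 i : 0 <= h i by apply: divr_ge0 => //; apply: exprn_ge0.
have pow2 k : (k.+1%:R <= 2 ^+ k :> R) by rewrite -natrX ler_nat; apply: ltn_expl.
have [i0 i00 i0K] : exists2 i0, (0 < i0)%N & 4 / 2 ^+ i0 + K * h i0 <= 2^-1 :> R.
  have [j jK] : exists j : nat, 2 * (8 * K + 4) <= j%:R.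
    exists (Num.truncn (2 * (8 * K + 4))).+1; apply: ltW; apply: truncnS_gt.
  exists (2 * j.+1)%N => //.
  have e2 : 0 < 2 ^+ (2 * j.+1) :> R by apply: exprn_gt0.
  rewrite /h mulrA -mulrDl ler_pdivrMr // [2^-1 * _]mulrC ler_pdivlMr //.
  have -> : 2 ^+ (2 * j.+1) = 2 ^+ j.+1 * 2 ^+ j.+1 :> R by rewrite -exprD addnn mul2n.
  have -> : (2 * (2 * j.+1) + 4)%N%:R = 4 * j%:R + 8 :> R.
    by rewrite -natrM -natrD; congr (_%:R); lia.
  have := pow2 j.+1; move: (2 ^+ j.+1) => z; rewrite -addn2 natrD => zj.
  have jR : 0 <= j%:R :> R by [].
  have : (j%:R + 2) * (j%:R + 2) <= z * z by apply: ler_pM => //; lra.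
  nra.
(* The window length that [depth_small] asks for with [y = 2 ^ i]. At scale [i] the depth threshold
   is [2 i Q], so that [b] to the power minus this threshold beats the number of labels, of order
   [M i.+1]; [J] is the threshold at scale [i0]. *)
pose M i := (2 * 2 ^ (i * Q))%N.
pose J := (2 * (i0 * Q))%N.
have Q1 : (1 <= Q)%N by rewrite /Q; lia.
have J0 : (0 < J)%N by rewrite /J !muln_gt0 i00.
have leJ i : (i0 <= i)%N -> (J <= 2 * 2 ^ (i * Q))%N.
  move=> ii; rewrite leq_mul2l /=; apply: leq_trans (_ : i * Q <= _)%N.
    by rewrite leq_mul2r ii orbT.
  exact/ltnW/ltn_expl.
have Mmon i : (M i <= M i.+1)%N by rewrite leq_mul2l /= leq_exp2l // leq_mul2r leqnSn orbT.
have bpow D : b%:R^-1 ^+ D <= (2 ^+ D)^-1 :> R.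
  rewrite exprVn lef_pV2 ?posrE ?exprn_gt0 ?ltr0n //; last by case: b b2.
  by rewrite lerXn2r ?nnegrE // ler_nat.
have powQ i : (2 ^+ (i * Q))^-1 <= (2 ^+ i)^-1 :> R.
  by rewrite lef_pV2 ?posrE ?exprn_gt0 // ler_weXn2l ?ler1n // leq_pmulr.
have zz (a : R) k : a * 2 ^+ k * (2 ^+ (2 * k))^-1 = a * (2 ^+ k)^-1.
  have -> : 2 ^+ (2 * k) = 2 ^+ k * 2 ^+ k :> R by rewrite -exprD addnn mul2n.
  by field; rewrite expf_neq0.
have err i : (i0 <= i)%N ->
    (J + M i.+1)%:R * b%:R^-1 ^+ (2 * (i * Q)) <= 4 * (2 ^ Q)%:R / 2 ^+ i :> R.
  move=> ii; apply: (@le_trans _ _ ((4 * 2 ^ (i.+1 * Q))%:R * (2 ^+ (2 * (i * Q)))^-1)).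
    apply: ler_pM; rewrite ?bpow ?exprn_ge0 ?invr_ge0 //.
    rewrite ler_nat /M; have := leJ i.+1 (leqW ii); lia.
  have -> : (4 * 2 ^ (i.+1 * Q))%:R = 4 * (2 ^ Q)%:R * 2 ^+ (i * Q) :> R.
    by rewrite (mulSn i) expnD !natrM !natrX mulrA.
  by rewrite zz; apply: ler_wpM2l; [rewrite mulr_ge0|exact: powQ].
have rec n : forall N, (J + M (i0 + n) <= N)%N ->
   chain_coll_prob N J (M (i0 + n)%N) <=
   (2^-1 * (1 - mu 0%N)) ^+ J * (4 / 2 ^+ i0 + K * (h i0 - h (i0 + n)%N)).
  elim: n => [|n IH] N NM.
    rewrite addn0 subrr mulr0 addr0.
    have N0 : (0 < N)%N by apply: leq_trans NM; rewrite addn_gt0 J0.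
    (* At the first scale the window is the bare chain: it has no collision of its own and its depth
       is at least [J], so the depth term vanishes. *)
    apply: (le_trans (@chain_coll_step N J 0 (M i0) J J0)).
    rewrite {1}/chain_coll_prob [X in X + _ <= _](_ : _ = 0) ?add0r; last first.
      rewrite -[RHS](Ex0 (iid (dX N) (J + 0))); apply: eq_Ex_iid => t tJ.
      rewrite take_oversize ?size_map ?tJ ?addn0 //; case: (boolP (chain _)) => //= /chain_coll.
      by move/negbTE ->.
    rewrite chain_prob // ler_wpM2l //.
      by rewrite exprn_ge0 // mulr_ge0 // subr_ge0 ltW.
    rewrite [X in X + _ <= _](_ : _ = 0) ?add0r; last first.
      by rewrite /Pr Ex_iid0 /= addn0 ltnn.
    apply: (@le_trans _ _ ((4 * 2 ^ (i0 * Q))%:R * (2 ^+ (2 * (i0 * Q)))^-1)).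
      apply: ler_pM => //; rewrite ?bpow ?exprn_ge0 //.
      by rewrite ler_nat /M addn0; have := leJ i0 (leqnn _); lia.
    rewrite ?addr0 natrM (natrX _ 2 (i0 * Q)) zz; apply: ler_wpM2l => //; exact: powQ.
  have ii : (i0 <= i0 + n)%N by apply: leq_addr.
  rewrite !addnS in NM *; set i := (i0 + n)%N in IH ii NM *.
  have NM' : (J + M i <= N)%N by apply: leq_trans NM; rewrite leq_add2l.
  have N0 : (0 < N)%N by apply: leq_trans NM; rewrite addn_gt0 J0.
  rewrite -(subnKC (Mmon i)); apply: (le_trans (chain_coll_step N (M i) _ (2 * (i * Q)) J0)).
  apply: (@le_trans _ _ (_ + (2^-1 * (1 - mu 0%N)) ^+ J * (K * (h i - h i.+1)))).
    apply: lerD; first exact: IH NM'.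
    rewrite chain_prob // ler_wpM2l //; first by rewrite exprn_ge0 // mulr_ge0 // subr_ge0 ltW.
    have -> : (M i.+1 - M i + (J + M i) = J + M i.+1)%N by have := Mmon i; lia.
    apply: (@le_trans _ _ ((2 * (1 + C) + (2 * (i * Q))%:R) / (2 ^ i)%:R + 4 * (2 ^ Q)%:R / 2 ^+ i)).
      apply: lerD; last exact: err.
      apply: (le_trans _ (@depth_small R mu q C H N (2 ^ i) (2 * (i * Q)) (M i) _ _ _)).
      - apply: le_Pr; first exact: iid_law (dS_law H N) _.
        by move=> u; apply: leq_ltn_trans; rewrite leq_addl.
      - by rewrite expn_gt0.
      - rewrite -expnM; apply: leq_trans NM'; rewrite /M -expnS.
        apply: leq_trans (leq_addl _ _); rewrite leq_exp2l // /Q; nia.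
      - by rewrite -expnM.
    rewrite hS natrX -mulrDl mulrA ler_wpM2r ?invr_ge0 ?exprn_ge0 // /K.
    rewrite !natrM -!natr1; have := mu_C H.
    have iR : 0 <= i%:R :> R by []. have QR : 0 <= Q%:R :> R by [].
    have pR : 0 <= (2 ^ Q)%:R :> R by [].
    nra.
  by rewrite -mulrDr le_eqVlt; apply/orP; left; apply/eqP; congr (_ * _); ring.
exists ((2^-1 * (1 - mu 0%N)) ^+ J / 2).
  by rewrite divr_gt0 // exprn_gt0 // mulr_gt0 // subr_gt0.
move=> m; pose N := (J + M (i0 + m))%N.
have mN : (m <= N)%N.
  rewrite /N /M; apply: leq_trans (leq_addl _ _).
  apply: (@leq_trans ((i0 + m) * Q)); last by have := @ltn_expl 2 ((i0 + m) * Q) isT; lia.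
  by nia.
rewrite -(fresh_stable mu b (leqnn m) mN).
have mono k : (m <= k)%N -> fresh mu b N k <= fresh mu b N m.
  elim: k => [|k IH]; first by rewrite leqn0 => /eqP ->.
  rewrite leq_eqVlt => /orP[/eqP -> //|]; rewrite ltnS => /IH; apply: le_trans.
  exact: fresh_nonincr H b2 N k.
apply: le_trans (mono N mN).
have N0 : (0 < N)%N by rewrite addn_gt0 J0.
have := rec m N (leqnn N); rewrite /chain_coll_prob -/N => cc.
apply: (@le_trans _ _ (Pr (iid (dX N) N) (fun t => chain (take J (map fst t))) -
   Pr (iid (dX N) N) (fun t => chain (take J (map fst t)) && coll sig0 [::] t))).
  rewrite (Pr_dX_struct mu b2 N N (fun S => chain (take J S))).
  rewrite Pr_chain_take chain_prob //.
  have : 0 <= (2^-1 * (1 - mu 0%N)) ^+ J :> R by rewrite exprn_ge0 // mulr_ge0 // subr_ge0 ltW.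
  move: cc i0K (h0 (i0 + m)%N) K0; move: (Pr _ _) (_ ^+ J) (h (i0 + m)%N) (h i0) (4 / _).
  move=> p z h1 h2 f4 p1 f5 h10 K0 z0.
  have : K * h1 >= 0 by apply: mulr_ge0.
  nra.
rewrite -ExB; apply: le_Ex_iid => [|[|x t] tN]; first exact: dX_law H b2 N.
  by move: N0; rewrite -tN.
have := @fcoll_coll _ dnW upW sig0 x t upW_dnW.
case: (chain _) => /=; last by rewrite subrr.
rewrite -/(fcoll (x :: t)).
case: (fcoll _) => [/(_ isT) -> |_]; first by rewrite subrr.
by rewrite gerBl.
Qed.

End Positivity.

(** * Concentration *)

Section Concentration.
Variables (R : realType) (X : Type) (d : seq (R * X)).
Hypothesis dlaw : is_law d.

(** From [exp (- x) >= 1 - x], since [(1 - x) (1 + x + 2 x ^ 2) >= 1] for [x <= 1/2]. *)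
Lemma expR_le_quadratic (x : R) : `|x| <= 2^-1 -> expR x <= 1 + x + 2 * x ^+ 2.
Proof.
rewrite ler_norml => /andP[x1 x2].
have e0 := expR_gt0 (- x); have := expR_ge1Dx (- x).
rewrite expRN in e0 *; have ex := expR_gt0 x; move: (expR x) ex e0 => e ex e0 h.
have h2 : (1 - x) * e <= 1.
  by rewrite -ler_pdivlMr // div1r.
have : (1 - x) * e <= (1 - x) * (1 + x + 2 * x ^+ 2).
  apply: le_trans h2 _; nra.
by rewrite ler_pM2l //; lra.
Qed.

Variables (nw : seq X -> bool) (c delta : R) (M n : nat).
Hypothesis c01 : 0 <= c <= 1.
Hypothesis M0 : (0 < M)%N.
Hypothesis window : forall h, (M + size h <= n)%N ->
  `| Pr (iid d M) (fun w => nw (w ++ h)) - c | <= delta.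

Let g (t : seq X) : R := (nw t)%:R - c.

(** Peel off the newest block of [M] vertices: whatever the older ones are, its term has mean within
    [delta] of 0, so each block contributes at most one factor
    [exp (theta * delta + 2 * theta ^ 2)]. *)
Lemma chain_mgf (s theta : R) J r :
  `|s| = 1 -> 0 <= theta <= 2^-1 -> (J * M + r <= n)%N ->
  Ex (iid d (J * M + r)) (fun t => expR (theta * (s * \sum_(j < J) g (drop (j * M) t)))) <=
  expR ((theta * delta + 2 * theta ^+ 2) * J%:R).
Proof.
move=> s1 /andP[th0 th2]; elim: J => [|J IH] Jn.
  rewrite mulr0 expR0 add0n; apply: Ex_lec; first exact: iid_law.
  by move=> t; rewrite big_ord0 !mulr0 expR0.
rewrite mulSn -addnA Ex_iidD Ex_swap.
apply: (@le_trans _ _ (Ex (iid d (J * M + r)) (fun h =>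
  expR (theta * delta + 2 * theta ^+ 2) *
  expR (theta * (s * \sum_(j < J) g (drop (j * M) h)))))); last first.
  rewrite ExZ -[J.+1%:R]natr1 mulrDr mulr1 [leRHS]expRD [X in X <= _]mulrC; apply: ler_wpM2r; rewrite ?expR_ge0 //.
  by apply: IH; apply: leq_trans Jn; rewrite mulSn -addnA leq_addl.
apply: le_Ex_iid => // h hJ.
rewrite (@eq_Ex_iid _ _ d M _ (fun w => expR (theta * (s * g (w ++ h))) *
   expR (theta * (s * \sum_(j < J) g (drop (j * M) h))))); last first.
  move=> w wM; rewrite -expRD -mulrDr -mulrDr big_ord_recl /= mul0n drop0; congr (expR (_ * (_ * (_ + _)))).
  apply: eq_bigr => j _; rewrite /bump /= add1n mulSn; congr g.
  by rewrite drop_cat ltnNge -wM leq_addr /= addKn.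
rewrite ExZr ler_wpM2r ?expR_ge0 //.
apply: (@le_trans _ _ (1 + (theta * delta + 2 * theta ^+ 2))); last exact: expR_ge1Dx.
apply: (@le_trans _ _ (Ex (iid d M) (fun w => 1 + 2 * theta ^+ 2 + theta * s * (nw (w ++ h))%:R - theta * s * c))).
  apply: le_Ex; first exact: iid_law.
  move=> w; set y := theta * (s * g (w ++ h)).
  have gn : `|g (w ++ h)| <= 1.
    by case/andP: c01 => c0 c1; rewrite /g ler_norml; case: (nw _) => /=; apply/andP; split; lra.
  have yt : `|y| <= theta by rewrite /y !normrM s1 mul1r (ger0_norm th0) ler_piMr.
  apply: (le_trans (expR_le_quadratic (le_trans yt th2))).
  have y2 : y ^+ 2 <= theta ^+ 2.
    by rewrite -[y ^+ 2]ger0_norm ?sqr_ge0 // normrX lerXn2r ?nnegrE.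
  have -> : y = theta * s * (nw (w ++ h))%:R - theta * s * c by rewrite /y /g; ring.
  move: y2; rewrite {1}/y /g; lra.
rewrite ExB !ExD !Ex_cst; try exact: iid_law.
rewrite ExZ -/(Pr _ _).
have wn : (M + size h <= n)%N by rewrite hJ; apply: leq_trans Jn; rewrite mulSn -addnA.
have := window wn; set p := Pr _ _ => pc.
have : theta * (s * (p - c)) <= theta * delta.
  rewrite ler_wpM2l //; apply: le_trans (ler_norm _) _; by rewrite normrM s1 mul1r.
lra.
Qed.

Lemma chain_tail (s theta lam : R) J r :
  `|s| = 1 -> 0 <= theta <= 2^-1 -> (J * M + r <= n)%N ->
  Pr (iid d (J * M + r)) (fun t => lam <= s * \sum_(j < J) g (drop (j * M) t)) <=
  expR ((theta * delta + 2 * theta ^+ 2) * J%:R - theta * lam).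
Proof.
move=> s1 th Jn; have th0 : 0 <= theta by case/andP: th.
apply: (@le_trans _ _ (Pr (iid d (J * M + r)) (fun t =>
   expR (theta * lam) <= expR (theta * (s * \sum_(j < J) g (drop (j * M) t)))))).
  apply: le_Pr; first exact: iid_law.
  by move=> t lt; rewrite ler_expR ler_wpM2l.
apply: (le_trans (markov _ _ _)); [exact: iid_law|exact: expR_gt0|by move=> t; apply: expR_ge0|].
by rewrite expRB ler_wpM2r ?invr_ge0 ?expR_ge0 // chain_mgf.
Qed.

(* The terms of a residue class modulo [M] are handled by [chain_tail]; a partial
   sum is a sum of at most [M] such chains. *)
Lemma partial_sums_tail (eps : R) :
  0 < eps <= 1 -> delta <= eps / 8 -> 2 * M%:R <= eps * n%:R ->
  Pr (iid d n) (fun t => [exists k : 'I_n.+1,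
     eps * n%:R < `| \sum_(1 <= l < k.+1) g (drop (n - l) t) | ]) <=
  2 * n.+1%:R * expR (- (eps ^+ 2 / 64 * (n%:R / M%:R))).
Proof.
case/andP=> e0 e1 de nM.
have MR : 0 < M%:R :> R by rewrite ltr0n.
have nR : 0 <= n%:R :> R by [].
(* Half of [eps * n] pays for the fewer than [M] initial terms, the other half for [M] chain sums
   bounded by [lam]. *)
pose lam := eps / 2 * (n%:R / M%:R).
have lam0 : 0 <= lam by rewrite /lam !mulr_ge0 ?invr_ge0 ?ler0n // ltW.
(* Sum over the times [l], [l - M], [l - 2 M] and so on. Since [ch l - ch (l - M)] is the single
   term at time [l], a partial sum telescopes to its last [M] values of [ch]. *)
pose ch (l : nat) (t : seq X) := \sum_(j < l %/ M) g (drop (j * M) (drop (n - l) t)).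
have lawn := iid_law dlaw n.
apply: (@le_trans _ _ (Ex (iid d n) (fun t => \sum_(l < n.+1)
   ((lam <= 1 * ch l t)%R%:R + (lam <= -1 * ch l t)%R%:R)))).
  apply: le_Ex_iid => // t tn; case: existsP => [[k kE]|_]; last first.
    by apply: sumr_ge0 => l _; rewrite addr_ge0.
  case: (pselect (exists l : 'I_n.+1, lam <= `|ch l t|)) => [[l ll]|nol].
    rewrite (bigD1 l) //= ler_wpDr //; first by apply: sumr_ge0 => i _; rewrite addr_ge0.
    move: ll; rewrite mul1r mulN1r ler_normr => /orP[]-> /=; last by rewrite lerDr.
    by rewrite lerDl.
  have chl l : (l <= n)%N -> `|ch l t| <= lam.
    move=> ln; rewrite leNgt; apply/negP => ll; apply: nol.
    by exists (Ordinal (ln : (l < n.+1)%N)); apply: ltW.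
  have f1 l : `|g (drop (n - l) t)| <= 1.
    by case/andP: c01 => c0 c1; rewrite /g ler_norml; case: (nw _) => /=; apply/andP; split; lra.
  have chS l : (M <= l <= n)%N -> g (drop (n - l) t) = ch l t - ch (l - M)%N t.
    case/andP=> Ml ln; rewrite /ch.
    have -> : (l %/ M = ((l - M) %/ M).+1)%N by rewrite -{1}(subnK Ml) divnDr // divnn M0 addn1.
    rewrite big_ord_recl mul0n drop0 -addrA -[LHS]addr0; congr (_ + _).
    apply/esym/eqP; rewrite subr_eq0; apply/eqP.
    apply: eq_bigr => j _; rewrite !drop_drop; congr (g (drop _ _)).
    by rewrite lift0 mulSn; move: Ml ln; clear; lia.
  have ch0 l : (l < M)%N -> ch l t = 0 by move=> lM; rewrite /ch divn_small // big_ord0.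
  have kn : (k <= n)%N by rewrite -ltnS.
  suff : `| \sum_(1 <= l < k.+1) g (drop (n - l) t) | <= eps * n%:R by rewrite leNgt kE.
  have bigE : eps * n%:R = eps * n%:R / 2 + M%:R * lam by rewrite /lam; field; rewrite gt_eqF.
  have sumle (a b' : nat) (F : nat -> R) (B : R) : (forall l, (a <= l < b')%N -> `|F l| <= B) ->
      `| \sum_(a <= l < b') F l | <= (b' - a)%N%:R * B.
    move=> FB; apply: le_trans (ler_norm_sum _ _ _) _.
    by rewrite mulr_natl -sumr_const_nat; apply: ler_sum_nat.
  rewrite bigE; case: (leqP M k) => Mk; last first.
    apply: (@le_trans _ _ ((k.+1 - 1)%N%:R * 1)); first by apply: sumle.
    rewrite subn1 /=.
    have : k%:R <= M%:R :> R by rewrite ler_nat ltnW.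
    nra.
  rewrite (@big_cat_nat _ _ _ M) //=; last by rewrite leqW.
  apply: le_trans (ler_normD _ _) _; apply: lerD.
    apply: (le_trans (sumle _ _ _ 1 _)) => [//|].
    rewrite mulr1; apply: (@le_trans _ _ M%:R); first by rewrite ler_nat leq_subr.
    lra.
  have -> : \sum_(M <= l < k.+1) g (drop (n - l) t) = \sum_(k.+1 - M <= l < k.+1) ch l t.
    transitivity (\sum_(M <= l < k.+1) ch l t - \sum_(M <= l < k.+1) ch (l - M)%N t).
      rewrite -sumrB; apply: eq_big_nat => l /andP[Ml lk]; apply: chS; rewrite Ml.
      by apply: leq_trans kn.
    have e1' : \sum_(M <= l < k.+1) ch l t = \sum_(0 <= l < k.+1) ch l t.
      rewrite [RHS](@big_cat_nat _ _ _ M) //=; last by rewrite leqW.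
      rewrite (_ : \sum_(0 <= l < M) ch l t = 0) ?add0r //.
      by rewrite big_nat_cond big1 // => l /andP[/andP[_ /ch0]].
    have e2' : \sum_(M <= l < k.+1) ch (l - M)%N t = \sum_(0 <= l < k.+1 - M) ch l t.
      rewrite -{1}[M]add0n big_addn; apply: eq_big_nat => l _; by rewrite addnK.
    rewrite e1' e2' [X in X - _](@big_cat_nat _ _ _ (k.+1 - M)) //=; last exact: leq_subr.
    by rewrite addrAC subrr add0r.
  apply: (le_trans (sumle _ _ _ lam _)).
    by move=> l /andP[_ lk]; apply: chl; apply: leq_trans kn.
  by apply: ler_wpM2r => //; rewrite ler_nat leq_subLR addnC -leq_subLR.
rewrite Ex_sum.
apply: (@le_trans _ _ (\sum_(l < n.+1) 2 * expR (- (eps ^+ 2 / 64 * (n%:R / M%:R))))); last first.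
  by rewrite sumr_const card_ord -mulr_natr; lra.
apply: ler_sum => l _; have ln : (l <= n)%N by rewrite -ltnS.
have side s : `|s| = 1 -> Ex (iid d n) (fun t => (lam <= s * ch l t)%R%:R) <=
    expR (- (eps ^+ 2 / 64 * (n%:R / M%:R))).
  move=> s1; have nE : n = ((n - l) + (l %/ M * M + l %% M))%N by rewrite -divn_eq subnK.
  pose G (t : seq X) : R := (lam <= s * \sum_(j < l %/ M) g (drop (j * M) t))%R%:R.
  rewrite [X in iid d X]nE (Ex_iid_suffix dlaw (n - l) (l %/ M * M + l %% M) G).
  (* With [theta = eps / 16] the growth per block is at most [eps ^ 2 / 64], while [theta * lam] is
     [eps ^ 2 / 32] times [n / M]: half of the gain remains. *)
  apply: (le_trans (@chain_tail s (eps / 16) lam _ _ s1 _ _)).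
  - by lra.
  - by rewrite -divn_eq.
  rewrite ler_expR.
  have Jn : (l %/ M)%:R <= n%:R / M%:R :> R.
    by rewrite ler_pdivlMr // -natrM ler_nat (leq_trans (leq_trunc_div _ _)).
  rewrite /lam; move: (n%:R / M%:R) Jn => z Jn.
  have J0 : 0 <= (l %/ M)%:R :> R by [].
  have a1 : eps / 16 * delta + 2 * (eps / 16) ^+ 2 <= eps ^+ 2 / 64 by nra.
  have a2 : (eps / 16 * delta + 2 * (eps / 16) ^+ 2) * (l %/ M)%:R <= eps ^+ 2 / 64 * z.
    apply: (le_trans (ler_wpM2r J0 a1)); apply: ler_wpM2l => //.
    by rewrite divr_ge0 // sqr_ge0.
  nra.
have h1 := side 1; have hN := side (-1).
rewrite ExD; move: (h1 (normr1 _)) (hN (normrN1 _)).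
by move=> a1 a2; rewrite mulr2n mulrDl mul1r; apply: lerD.
Qed.

End Concentration.

(** * Sums of elements of an aperiodic set *)

Section Frobenius.
Variable P : nat -> Prop.
Hypothesis P_aperiodic : forall d : nat, d != 1%N -> ~ (forall k, P k -> (d %| k)%N).

Definition spanned (T : nat) : Prop :=
  exists ws : seq nat, sumn ws = T /\ (forall w, w \in ws -> P w).

Lemma spanned0 : spanned 0.
Proof. by exists [::]. Qed.

Lemma spanned_gen k : P k -> spanned k.
Proof. by move=> Pk; exists [:: k]; split => [|w]; rewrite /= ?addn0 // inE => /eqP ->. Qed.

Lemma spannedD x y : spanned x -> spanned y -> spanned (x + y).
Proof.
move=> [u [<- Pu]] [v [<- Pv]]; exists (u ++ v); split; first by rewrite sumn_cat.
by move=> w; rewrite mem_cat => /orP[/Pu|/Pv].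
Qed.

Lemma spannedM n x : spanned x -> spanned (n * x).
Proof.
move=> Sx; elim: n => [|n IH]; first exact: spanned0.
by rewrite mulSn; apply: spannedD.
Qed.

(** The least positive difference [d] of two spanned numbers divides every generator, because a
    nonzero remainder modulo [d] would be a smaller difference; hence [d = 1]. From spanned [y] and
    [y + 1], write [T = Q y + r] as [(Q - r) y + r (y + 1)], which is possible once [T >= y ^ 2]. *)
Lemma spanned_large : exists T0, forall T, (T0 <= T)%N -> spanned T.
Proof.
(* Aperiodicity at the modulus 0 provides a positive element. *)
have [k1 Pk1 k10] : exists2 k, P k & (0 < k)%N.
  apply: contrapT => no; apply: (P_aperiodic (d := 0)) => // k Pk; rewrite dvd0n.
  by case: k Pk => // k Pk; exfalso; apply: no; exists k.+1.
pose diff d := `[< (0 < d)%N /\ exists y, spanned (y + d) /\ spanned y >].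
have exd : exists d, diff d.
  by exists k1; apply/asboolP; split => //; exists 0%N; split; [exact: spanned_gen|exact: spanned0].
case: (ex_minnP exd) => d /asboolP[d0 [y [Sx Sy]]] dmin.
have d1 : d = 1%N.
  apply: contrapT => /eqP/P_aperiodic; apply => k Pk.
  have := divn_eq k d; set Q := (k %/ d)%N => kE.
  case: (posnP (k %% d)) => [r0|r0]; first by apply/eqP.
  have : diff (k %% d)%N.
    apply/asboolP; split => //; exists (Q * (y + d))%N; split; last exact: spannedM.
    have -> : (Q * (y + d) + k %% d = k + Q * y)%N by rewrite {2}kE; nia.
    by apply: spannedD; [exact: spanned_gen|exact: spannedM].
  by move/dmin; rewrite leqNgt ltn_mod d0.
rewrite {}d1 addn1 in Sx.
exists (y * y)%N => T yT.
case: (posnP y) => [y0|y0].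
  by rewrite -[T]muln1; apply: spannedM; rewrite y0 in Sx.
have := divn_eq T y; set Q := (T %/ y)%N; set r := (T %% y)%N => TE.
have ry : (r < y)%N by rewrite ltn_mod.
have yQ : (y <= Q)%N by rewrite leq_divRL.
have -> : T = ((Q - r) * y + r * y.+1)%N.
  rewrite TE mulnS mulnBl; have : (r * y <= Q * y)%N by rewrite leq_mul2r (ltnW (leq_trans ry yQ)) orbT.
  lia.
by apply: spannedD; apply: spannedM.
Qed.

End Frobenius.

(** * Subexponential lower bound for the probability of a given sum *)

Section LocalLowerBound.
Variables (R : realType) (mu : nat -> R) (q : nat) (C : R).
Hypothesis H : offspring mu q C.

Lemma cap_point N a : (a < N)%N -> Pr (cap mu N) (fun j => j == a) = mu a.
Proof.
move=> aN; rewrite /Pr Ex_cap gtn_eqF // mulr0 addr0 big_mkord (bigD1 (Ordinal aN)) //=.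
rewrite eqxx mulr1 big1 ?addr0 // => i ia; rewrite (_ : (_ == _) = false) ?mulr0 //.
by apply/negbTE; apply: contra ia => /eqP ia; apply/eqP/val_inj.
Qed.

Lemma Pr_word N ws : (forall w, w \in ws -> (w < N)%N) ->
  Pr (iid (cap mu N) (size ws)) (fun s => s == ws) = \prod_(w <- ws) mu w.
Proof.
elim: ws => [|w ws IH] wN; first by rewrite /Pr Ex_iid0 big_nil.
rewrite /Pr /= Ex_iidS big_cons -IH; last by move=> x xw; apply: wN; rewrite inE xw orbT.
rewrite -(cap_point (wN w (mem_head _ _))) /Pr -ExZr; apply: eq_Ex => x.
by rewrite -ExZ; apply: eq_Ex => s; rewrite eqseq_cons -natrM mulnb.
Qed.

Lemma Ex_iid_sumn N n :
  Ex (iid (cap mu N) n) (fun s => (sumn s)%:R) <= n%:R.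
Proof.
have law := cap_law H N.
elim: n => [|n IH]; first by rewrite Ex_iid0.
rewrite Ex_iidS -[n.+1%:R]natr1 addrC; apply: (@le_trans _ _ (Ex (cap mu N) (fun x => x%:R + n%:R))).
  apply: le_Ex => // x; under eq_Ex do rewrite /= natrD.
  by rewrite ExD Ex_cst ?lerD2l //; exact: iid_law.
by rewrite ExD Ex_cst // lerD2r; exact: mu_cap_mean H N.
Qed.

(** The absolute deviation is twice the deficit plus the signed deviation, and the latter has
    nonpositive mean; so [deficit_le] controls both sides. *)
Lemma sumn_deviation N k m (lam : R) : (0 < k)%N -> (k ^ q <= N)%N ->
  (k ^ (q + 2) <= m)%N -> 0 < lam ->
  Pr (iid (cap mu N) m) (fun s => lam <= `|(sumn s)%:R - m%:R|) <=
  2 * (1 + C) * (m%:R / k%:R) / lam.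
Proof.
move=> k0 kN km lam0; have law := iid_law (cap_law H N) m.
apply: (le_trans (markov law lam0 _)) => [s|]; first exact: normr_ge0.
rewrite ler_wpM2r ?invr_ge0 ?(ltW lam0) //.
apply: (@le_trans _ _ (Ex (iid (cap mu N) m) (fun s =>
   2 * (m - sumn s)%N%:R + ((sumn s)%:R - m%:R)))).
  apply: le_Ex => // s; case: (leqP (sumn s) m) => sm.
    rewrite natrB //; have : (sumn s)%:R <= m%:R :> R by rewrite ler_nat.
    by move=> h; rewrite ler0_norm; lra.
  have -> : (m - sumn s = 0)%N by apply/eqP; rewrite subn_eq0 ltnW.
  by rewrite mulr0 add0r ger0_norm // subr_ge0 ler_nat ltnW.
rewrite ExD ExZ ExB Ex_cst //.
have := deficit_le H k0 kN km; have := Ex_iid_sumn N m; lra.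
Qed.

Hypothesis mu00 : 0 < mu 0%N.
Hypothesis mu_aperiodic : aperiodic mu.
Variable k0 : nat.
Hypothesis k02 : (2 <= k0)%N.
Hypothesis muk0 : 0 < mu k0.

Lemma mu_le1 j : mu j <= 1.
Proof.
apply: le_trans (mu_mass H j.+1); rewrite big_nat_recr //= lerDr.
by apply: sumr_ge0 => i _; apply: mu_ge0 H i.
Qed.

(** A single word suffices: copies of [k0], a fixed word correcting the residue modulo [k0], and
    zeros. Since [k0 >= 2], the copies take at most [T / 2 <= 5 r / 8] places, which leaves room for
    the correction. *)
Lemma exact_sum_lower : exists c1 p : R, exists r0 : nat,
  [/\ 0 < c1, 0 < p <= 1 & forall N r T, (r0 <= r)%N -> (r0 <= T)%N ->
    (4 * T <= 5 * r)%N -> (T < N)%N ->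
    c1 * p ^+ r <= Pr (iid (cap mu N) r) (fun s => (sumn s == T)%N)].
Proof.
have [T0 span] := spanned_large mu_aperiodic.
have [f fP] : exists f : nat -> seq nat, forall T, (T0 <= T)%N ->
    sumn (f T) = T /\ (forall w, w \in f T -> mu w != 0).
  have /choice[f fP] : forall T, exists ws : seq nat, (T0 <= T)%N ->
      sumn ws = T /\ (forall w, w \in ws -> mu w != 0).
    move=> T; case: (leqP T0 T) => [/span[ws wsP]|TT]; first by exists ws.
    by exists [::].
  by exists f.
pose W T := \prod_(w <- f T) mu w.
have W01 T : (T0 <= T)%N -> 0 < W T <= 1.
  move=> /fP[_ fT]; rewrite /W; elim: (f T) fT => [|w s IH] fT; first by rewrite big_nil ltr01 lexx.
  rewrite big_cons; have /IH/andP[s0 s1] : forall w0, w0 \in s -> mu w0 != 0.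
    by move=> w0 ws; apply: fT; rewrite inE ws orbT.
  have w0 : 0 < mu w by rewrite lt_def (mu_ge0 H) fT ?mem_head.
  by rewrite mulr_gt0 //= mulr_ile1 ?(ltW w0) ?(ltW s0) ?mu_le1.
pose p := Num.min (mu 0%N) (mu k0).
have p0 : 0 < p by rewrite lt_min mu00.
have pk : p <= mu k0 by rewrite ge_min lexx orbT.
have p00 : p <= mu 0%N by rewrite ge_min lexx.
have p1 : p <= 1 by rewrite ge_min mu_le1.
pose Lm := (\sum_(i < k0) size (f (T0 + i)))%N.
exists (\prod_(i < k0) W (T0 + i)%N), p, (T0 + 3 * Lm)%N; split; [|by rewrite p0|].
  by apply: prodr_gt0 => i _; case/andP: (W01 _ (leq_addr i T0)).
move=> N r T r0r r0T Tr TN.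
have T0T : (T0 <= T)%N by apply: leq_trans r0T; apply: leq_addr.
have k0_gt0 : (0 < k0)%N by apply: ltnW.
pose i := ((T - T0) %% k0)%N; pose a := ((T - T0) %/ k0)%N.
have ik : (i < k0)%N by rewrite ltn_mod.
have TE : T = (a * k0 + (T0 + i))%N by have := divn_eq (T - T0) k0; rewrite -/a -/i; lia.
have [fs fm] := fP _ (leq_addr i T0).
have fL : (size (f (T0 + i)) <= Lm)%N by rewrite /Lm (bigD1 (Ordinal ik)) //= leq_addr.
have a2 : (2 * a <= T)%N by rewrite TE; nia.
pose z := (r - a - size (f (T0 + i)))%N.
have rE : (r = a + (size (f (T0 + i)) + z))%N by rewrite /z; lia.
pose ws := nseq a k0 ++ (f (T0 + i)%N ++ nseq z 0%N).
have ws_size : size ws = r by rewrite !size_cat !size_nseq -rE.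
have ws_sum : sumn ws = T by rewrite !sumn_cat !sumn_nseq fs mul0n addn0 mulnC -TE.
have ws_lt w : w \in ws -> (w < N)%N.
  move=> ww; apply: leq_ltn_trans TN; rewrite -ws_sum.
  by rewrite sumnE (perm_big _ (perm_to_rem ww)) big_cons leq_addr.
apply: (@le_trans _ _ (Pr (iid (cap mu N) r) (fun s => s == ws))); last first.
  apply: le_Pr; first exact: iid_law (cap_law H N) _.
  by move=> s /eqP ->; rewrite ws_sum.
rewrite -[in leRHS]ws_size Pr_word // /ws !big_cat /= !big_nseq !iter_mulr_1.
rewrite rE !exprD [X in X <= _](_ : _ = p ^+ a * ((\prod_(i0 < k0) W (T0 + i0)%N) * (p ^+ size (f (T0 + i)%N)) * p ^+ z)); last by ring.
have pge0 k : 0 <= p ^+ k by rewrite exprn_ge0 // ltW.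
have Wi := W01 _ (leq_addr i T0).
apply: ler_pM => //; first by rewrite !mulr_ge0 // prodr_ge0 // => j _; case/andP: (W01 _ (leq_addr j T0)) => /ltW.
  by apply: lerXn2r; rewrite ?nnegrE ?(ltW p0) ?(ltW muk0).
apply: ler_pM => //; first by rewrite mulr_ge0 // prodr_ge0 // => j _; case/andP: (W01 _ (leq_addr j T0)) => /ltW.
  rewrite -[leRHS]mulr1; apply: ler_pM => //.
  - by rewrite prodr_ge0 // => j _; case/andP: (W01 _ (leq_addr j T0)) => /ltW.
  - rewrite (bigD1 (Ordinal ik)) //= -/(W _) ler_piMr ?(ltW (proj1 (andP Wi))) //.
    suff /andP[] : 0 <= \prod_(j < k0 | j != Ordinal ik) W (T0 + j)%N <= 1 by [].
    apply: (big_ind (fun x => 0 <= x <= 1)); first by rewrite ler01 lexx.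
      by move=> x y /andP[x0 x1] /andP[y0 y1]; rewrite mulr_ge0 //= mulr_ile1.
    by move=> j _; case/andP: (W01 _ (leq_addr j T0)) => /ltW -> ->.
  - by rewrite exprn_ile1 // ltW.
by apply: lerXn2r; rewrite ?nnegrE ?(ltW p0) ?(ltW mu00).
Qed.

(** With probability at least 1/2 the first [n - r] terms have a sum within [r / 4] of their number;
    the last [r] terms then repair the difference exactly, at the price [p ^+ r]. *)
Lemma sum_point_lower : exists c1 p L : R, exists r0 : nat,
  [/\ 0 < c1, 0 < p <= 1 & forall N n k r, (0 < k)%N -> (n <= N)%N -> (r0 <= r)%N ->
    (2 * r <= n)%N -> (2 * k ^ (q + 2) <= n)%N -> L * (n%:R / k%:R) <= r%:R ->
    c1 * p ^+ r <= Pr (iid (cap mu N) n) (fun s => (sumn s + 1 == n)%N)].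
Proof.
have [c1 [p [r0 [c10 p01 low]]]] := exact_sum_lower.
(* The factor 16 makes the bound of [sumn_deviation] at [lam = r / 4] at most 1/2; [2 * r0 + 4]
   keeps the missing sum, at least [3 r / 4 - 1], above [r0]. *)
exists (c1 / 2), p, (16 * (1 + C)), (2 * r0 + 4)%N; split => //; first by rewrite divr_gt0.
move=> N n k r k_gt0 nN r0r rn kn Lr.
have r_gt0 : (0 < r)%N by lia.
pose m := (n - r)%N.
have nE : n = (m + r)%N by rewrite /m; lia.
have km : (k ^ (q + 2) <= m)%N by rewrite /m; lia.
have kN : (k ^ q <= N)%N.
  by apply: leq_trans nN; apply: leq_trans kn; rewrite expnD; have : (0 < k ^ 2)%N; rewrite ?expn_gt0 ?k_gt0 //; nia.
have law n' := iid_law (cap_law H N) n'.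
have rR : 0 < r%:R :> R by rewrite ltr0n.
have r4 : 0 < r%:R / 4 :> R by apply: divr_gt0.
have dev := sumn_deviation k_gt0 kN km r4.
have half : Pr (iid (cap mu N) m) (fun s => (r%:R / 4 : R) <= `|(sumn s)%:R - m%:R|) <= 2^-1 :> R.
  apply: (le_trans dev); rewrite ler_pdivrMr //.
  have : m%:R / k%:R <= n%:R / k%:R :> R by rewrite ler_wpM2r ?invr_ge0 // ler_nat leq_subr.
  have := mu_C H; move: (m%:R / k%:R) (n%:R / k%:R) Lr => u v; nra.
have pp : 0 <= c1 * p ^+ r by rewrite mulr_ge0 ?exprn_ge0 ?(ltW c10) //; case/andP: p01 => /ltW.
rewrite [in leRHS]nE /Pr Ex_iidD.
apply: (@le_trans _ _ (c1 * p ^+ r * (1 - Pr (iid (cap mu N) m) (fun s => (r%:R / 4 : R) <= `|(sumn s)%:R - m%:R|)))).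
  rewrite mulrAC; apply: ler_wpM2l => //; lra.
rewrite -PrC // -ExZ; apply: le_Ex_iid => [|s sm]; first exact: cap_law H N.
case: (leP (r%:R / 4 : R) `|(sumn s)%:R - m%:R|) => [_|sr] /=; first by rewrite mulr0; apply: Ex_ge0.
rewrite mulr1.
have [s1 s2] : (4 * sumn s <= 4 * m + r /\ 4 * m <= 4 * sumn s + r)%N.
  move: sr; rewrite ltr_norml => /andP[sa sb].
  by split; rewrite -(ler_nat R) natrD !natrM; lra.
have [g1 g2 g3 g4] : [/\ (r0 <= n - 1 - sumn s)%N, (4 * (n - 1 - sumn s) <= 5 * r)%N,
    (n - 1 - sumn s < N)%N & (sumn s + (n - 1 - sumn s) + 1 = m + r)%N].
  by move: s1 s2 r0r rn nN r_gt0; rewrite /m; move: (sumn s); clear; split; lia.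
apply: (le_trans (low N r (n - 1 - sumn s)%N _ g1 g2 g3)); first by move: r0r; clear; lia.
apply: le_Ex => [|u]; first exact: law.
by case: eqP => // uE; rewrite sumn_cat uE g4 eqxx.
Qed.

End LocalLowerBound.

(** * Depth-first exploration of plane trees *)

(* [fingraph] also defines [dfs] *)
Local Notation dfs := Defs.dfs.

Definition kids (v : word) (m : nat) : seq word := [seq rcons v i | i <- iota 1 m].

Lemma mem_kids u i v m : (rcons u i \in kids v m) = (u == v) && (1 <= i <= m)%N.
Proof.
apply/mapP/andP => [[j]|[/eqP -> im]]; last by exists i => //; rewrite mem_iota; lia.
by rewrite mem_iota => jm /rcons_inj[-> ->]; split => //; lia.
Qed.

Lemma kids_uniq v m : uniq (kids v m).
Proof. by rewrite map_inj_uniq ?iota_uniq // => i j /rcons_inj[]. Qed.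

(* Addresses, in depth-first order, of the vertices whose numbers of children are
   listed in [s], starting from the pending vertices [st]. *)
Fixpoint preorder (st : seq word) (s : seq nat) : seq word :=
  match s, st with
  | a :: s', v :: st' => v :: preorder (kids v a ++ st') s'
  | _, _ => [::]
  end.

Fixpoint pending (st : seq word) (s : seq nat) : seq word :=
  match s, st with
  | a :: s', v :: st' => pending (kids v a ++ st') s'
  | _, _ => st
  end.

(** Invariant of the exploration: [prs] pairs explored vertices with their numbers of children and
    [st] is the stack of pending ones; together they are the root and the children announced so far,
    without repetition. *)
Definition explored_inv (prs : seq (word * nat)) (st : seq word) : Prop :=
  [/\ uniq (unzip1 prs ++ st), [::] \in unzip1 prs ++ st &
    forall u i, rcons u i \in unzip1 prs ++ st <->
      exists2 m, (u, m) \in prs & (1 <= i <= m)%N].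

Lemma explored_inv_step prs v st a :
  explored_inv prs (v :: st) -> explored_inv (rcons prs (v, a)) (kids v a ++ st).
Proof.
move=> [un rt ch]; have vn : v \notin unzip1 prs.
  by move: un; rewrite cat_uniq => /and3P[_ /= + _]; rewrite negb_or => /andP[].
have emE : unzip1 (rcons prs (v, a)) = rcons (unzip1 prs) v by rewrite /unzip1 map_rcons.
have memE w : (w \in unzip1 (rcons prs (v, a)) ++ (kids v a ++ st)) =
    (w \in unzip1 prs ++ (v :: st)) || (w \in kids v a).
  rewrite emE !mem_cat mem_rcons !inE.
  by case: (w == v); case: (w \in kids v a); case: (w \in unzip1 prs); rewrite /= ?orbT ?orbF.
have knew i : rcons v i \notin unzip1 prs ++ v :: st.
  apply/negP => /ch[m vm _]; move/negP: vn; apply; exact: (map_f fst vm).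
split.
- rewrite emE cat_rcons (@perm_uniq _ _ (kids v a ++ (unzip1 prs ++ v :: st))); last first.
    by apply/permP => p; rewrite !(count_cat, count_cat) /= !count_cat; lia.
  rewrite cat_uniq kids_uniq un andbT /= -all_predC; apply/allP => w wn /=.
  apply/negP => /mapP[i _ wE].
  by move: wn; rewrite wE (negbTE (knew i)).
- by rewrite memE rt.
- move=> u i; rewrite memE mem_kids; split.
    case/orP => [/ch[m um im]|/andP[/eqP -> im]]; last by exists a => //; rewrite mem_rcons mem_head.
    by exists m => //; rewrite mem_rcons inE um orbT.
  case=> m; rewrite mem_rcons inE => /orP[/eqP[-> ->] ->|um im]; first by rewrite eqxx orbT.
  by apply/orP; left; apply/ch; exists m.
Qed.

Lemma explored_inv_preorder prs st s : explored_inv prs st ->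
  explored_inv (prs ++ zip (preorder st s) s) (pending st s).
Proof.
elim: s prs st => [|a s IH] prs [|v st] //= inv; rewrite ?cats0 //.
by rewrite -cat_rcons; apply/IH/explored_inv_step.
Qed.

Lemma explored_inv0 : explored_inv [::] [:: [::]].
Proof.
split => // u i; rewrite /= inE; split => [/eqP/(congr1 size)|[m]] //.
by rewrite size_rcons.
Qed.

Lemma hit_pending st s : hit s (size st) ->
  size (preorder st s) = size s /\ pending st s = [::].
Proof.
elim: s st => [|a s IH] [|v st] //=.
rewrite -[X in hit s X](_ : size (kids v a ++ st) = _) => [/IH[-> ->] //|].
by rewrite size_cat size_map size_iota addnC.
Qed.

(** [preorder] with the numbers of children read off the vertices instead of a list. *)
Fixpoint tw (c : word -> nat) (fuel : nat) (st : seq word) : seq word :=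
  match fuel, st with
  | f.+1, v :: st' => v :: tw c f (kids v (c v) ++ st')
  | _, _ => [::]
  end.

Lemma tw_preorder c f st : tw c f st = preorder st (map c (tw c f st)).
Proof. by elim: f st => [|f IH] [|v st] //=; rewrite -IH. Qed.

Lemma preorder_tw c f st s : hit s (size st) -> (size s <= f)%N ->
  map c (preorder st s) = s -> preorder st s = tw c f st.
Proof.
elim: s f st => [|a s IH] f [|v st] //=; first by case: f.
case: f => // f hs sf [cv cs]; rewrite /= cv; congr cons; apply: IH => //.
by rewrite size_cat size_map size_iota addnC.
Qed.

Lemma tw_hit c f st : (size (tw c f st) < f)%N ->
  hit (map c (tw c f st)) (size st) /\ pending st (map c (tw c f st)) = [::].
Proof.
elim: f st => [|f IH] [|v st] //=.
rewrite ltnS => /IH[h ->]; split => //.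
by move: h; rewrite size_cat size_map size_iota addnC.
Qed.

Definition ancs (u : word) : seq word := [seq take j u | j <- rev (iota 0 (size u).+1)].

Lemma ancs_rcons u i : ancs (rcons u i) = rcons u i :: ancs u.
Proof.
rewrite /ancs size_rcons.
have -> : iota 0 (size u).+2 = rcons (iota 0 (size u).+1) (size u).+1.
  by rewrite -cats1 -[(size u).+2]addn1 iotaD.
rewrite rev_rcons map_cons; congr cons.
  by rewrite -(size_rcons u i) take_size.
apply/eq_in_map => j; rewrite mem_rev mem_iota ltnS => /= ju.
by rewrite -cats1 takel_cat.
Qed.

Lemma ancs_suffix u l1 a l2 : ancs u = l1 ++ a :: l2 -> a :: l2 = ancs a.
Proof.
elim/last_ind: u l1 => [|u i IH] [|b l1] //=.
- by case=> <- <-.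
- by case=> _; case: l1.
- by rewrite ancs_rcons => -[<- <-]; rewrite ancs_rcons.
- by rewrite ancs_rcons => -[_ /IH].
Qed.

Section PlaneTree.
Variable t : {fset word}.
Hypothesis tP : is_plane_tree t.
Local Notation c := (nchildren t).

Lemma child_word (u v : word) :
  (size v == (size u).+1) && (take (size u) v == u) = (v == rcons u (last 0%N v)).
Proof.
case/lastP: v => [|v i]; first by case: u.
rewrite size_rcons eqSS last_rcons eqseq_rcons eqxx andbT.
case: (eqVneq (size v) (size u)) => [vu|vu] /=.
  by rewrite -vu -cats1 take_size_cat.
by apply/esym; apply: contraNF vu => /eqP ->.
Qed.

(** The birth ranks of the children of [u] are positive and closed under decrease, hence an initial
    interval, whose length is their number. *)
Lemma child_in u i : (rcons u i \in t) = (1 <= i <= c u)%N.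
Proof.
have [_ [pos [par sib]]] := tP.
pose K := [seq last 0%N v | v <- t & (size v == (size u).+1) && (take (size u) v == u)].
have KE j : (j \in K) = (rcons u j \in t).
  apply/mapP/idP => [[v]|ut].
    by rewrite mem_filter child_word => /andP[/eqP vE vt] ->; rewrite -vE.
  by exists (rcons u j); rewrite ?last_rcons // mem_filter child_word last_rcons eqxx.
have Ku : uniq K.
  rewrite map_inj_in_uniq ?filter_uniq ?fset_uniq // => v w.
  rewrite !mem_filter !child_word => /andP[/eqP -> _] /andP[/eqP -> _].
  by rewrite !last_rcons => ->.
have Ks : size K = c u by rewrite size_map size_filter.
have Kpos j : j \in K -> (0 < j)%N.
  by rewrite KE => /pos; rewrite all_rcons => /andP[].
have Kdown j k : j \in K -> (1 <= k <= j)%N -> k \in K.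
  by rewrite !KE; apply: sib.
rewrite -KE -Ks; apply/idP/andP => [iK|[i0 iK]].
  split; first exact: Kpos.
  rewrite -[leqLHS](size_iota 1); apply: uniq_leq_size; first exact: iota_uniq.
  by move=> k; rewrite mem_iota => ki; apply: Kdown iK _; lia.
apply: contraT => iN.
have : (size K <= size (iota 1 i.-1))%N.
  apply: uniq_leq_size => // k kK; rewrite mem_iota add1n prednK // (Kpos _ kK) /= ltnNge.
  by apply/negP => ik; move/negP: iN; apply; apply: Kdown kK _; rewrite i0.
by rewrite size_iota; lia.
Qed.

Lemma nchildren_le u : (c u <= #|` t|)%N.
Proof. by rewrite /nchildren count_size. Qed.

Let inv_of em st := explored_inv [seq (u, c u) | u <- em] st.

Lemma unzip1_graph em : unzip1 [seq (u, c u) | u <- em] = em.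
Proof. by rewrite /unzip1 -map_comp map_id_in. Qed.

Lemma inv_child em st u i : inv_of em st ->
  (rcons u i \in em ++ st) = (u \in em) && (1 <= i <= c u)%N.
Proof.
case=> _ _ ch; have := ch u i; rewrite unzip1_graph => chu.
apply/idP/andP => [/chu[m /mapP[w we [-> ->]] im]|[ue im]] //.
by apply/chu; exists (c u) => //; apply/mapP; exists u.
Qed.

Lemma inv_sub em st : inv_of em st -> {subset em ++ st <= t}.
Proof.
move=> inv w; case/lastP: w => [|u i]; first by have [rt _] := tP.
by rewrite (inv_child _ _ inv) child_in => /andP[].
Qed.

Lemma ohead_flatten_take1 (l : seq (seq word)) :
  ohead (flatten [seq take 1 x | x <- l]) = ohead (flatten l).
Proof. by elim: l => //= -[|a x] l IH //=. Qed.

Lemma flatten_head (f : word -> seq word) l v st : flatten [seq f a | a <- l] = v :: st ->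
  exists l1 a l2, [/\ l = l1 ++ a :: l2, v \in f a & flatten [seq f a | a <- a :: l2] = v :: st].
Proof.
elim: l => //= a l IH; case E: (f a) => [|w r] /=.
  by move/IH => [l1 [a' [l2 [-> va fl]]]]; exists (a :: l1), a', l2.
by case=> <- stE; exists [::], a, l; rewrite E mem_head; split; rewrite //= stE.
Qed.

Lemma unexplored_rcons em v a :
  unexplored_children t (rcons em v) a = [seq w <- unexplored_children t em a | w != v].
Proof.
rewrite /unexplored_children filter_map -filter_predI; congr map.
apply: eq_in_filter => i _ /=; rewrite mem_rcons inE negb_or.
by case: (_ != _) => //=; rewrite andbF.
Qed.

Lemma unexplored_new em st v : inv_of em st -> v \notin em -> v != [::] \/ em = [::] ->
  unexplored_children t (rcons em v) v = kids v (c v).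
Proof.
move=> inv vn _; rewrite /unexplored_children /kids; congr map.
rewrite (@eq_in_filter _ _ (fun i => i <= c v)%N); last first.
  move=> i; rewrite mem_iota => /andP[i1 _]; rewrite child_in i1 /= mem_rcons inE negb_or.
  have -> : rcons v i != v by apply/eqP => /(congr1 size); rewrite size_rcons; lia.
  suff -> : rcons v i \notin em by rewrite !andbT.
  apply/negP => vi; have : rcons v i \in em ++ st by rewrite mem_cat vi.
  by rewrite (inv_child _ _ inv) (negbTE vn).
have mn := nchildren_le v.
rewrite -[#|` t|](subnKC mn) iotaD filter_cat.
rewrite (_ : [seq i <- iota (1 + c v) _ | _] = [::]) ?cats0; last first.
  apply/eqP; rewrite -[_ == _]negbK -has_filter; apply/hasPn => i; rewrite mem_iota; lia.
by apply/all_filterP/allP => i; rewrite mem_iota; lia.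
Qed.

(** The stack is the concatenation of the unexplored children along the ancestral line, nearest
    ancestor first, so its head is the vertex chosen by the exploration. Ancestors nearer than the
    parent of that head have no unexplored child left, which keeps the description valid after the
    step. *)
Lemma dfs_aux_tw f em u st : inv_of em st ->
  st = flatten [seq unexplored_children t em a | a <- ancs u] ->
  dfs_aux t f em u = em ++ tw c f st.
Proof.
elim: f em u st => [|f IH] em u st inv stE; first by rewrite /= cats0.
rewrite /= /dfs_next -/(ancs u).
rewrite (map_comp (take 1) (unexplored_children t em)) ohead_flatten_take1 -stE.
case: st stE inv => [|v st] stE inv; first by rewrite cats0.
rewrite -[in LHS]/(ohead (v :: st)) /= -cat_rcons.
have [l1 [a [l2 [uE va flE]]]] := flatten_head (esym stE).
have aE := ancs_suffix uE.
have [i vE] : exists i, v = rcons a i by case/mapP: va => i _ ->; exists i.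
have [un _ _] := inv; rewrite unzip1_graph in un.
have vn : v \notin em.
  by move: un; rewrite cat_uniq => /and3P[_ /= + _]; rewrite negb_or => /andP[].
apply: IH.
  by rewrite /inv_of map_rcons; apply: explored_inv_step.
have ancE : ancs v = v :: a :: l2 by rewrite vE ancs_rcons -aE.
rewrite ancE map_cons /= (unexplored_new inv) //; last first.
  by left; rewrite vE; case: (a).
congr (_ ++ _).
have -> : unexplored_children t (rcons em v) a ++
    flatten [seq unexplored_children t (rcons em v) a0 | a0 <- l2] =
    [seq w <- v :: st | w != v].
  rewrite -flE /= filter_cat unexplored_rcons filter_flatten -map_comp; congr (_ ++ flatten _).
  by apply: eq_map => x /=; rewrite unexplored_rcons.
rewrite /= eqxx /=; apply/esym/all_filterP/allP => w ws.
move: un; rewrite cat_uniq => /and3P[_ _ /= /andP[vs _]].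
by apply: contraNneq vs => <-.
Qed.

(** [dfs] starts with the root already explored; this is the extra unit of fuel. *)
Lemma dfs_tw : dfs t = tw c (#|` t|).+1 [:: [::]].
Proof.
rewrite /dfs; have inv0 : inv_of [::] [:: [::]] by exact: explored_inv0.
rewrite (@dfs_aux_tw _ _ _ (kids [::] (c [::]))) /=.
- by rewrite cats0.
- by have := explored_inv_step (c [::]) inv0; rewrite cats0.
- rewrite cats0; have := @unexplored_new [::] [:: [::]] [::] inv0 isT (or_intror erefl).
  by [].
Qed.

(** The fuel exceeds the number of distinct vertices that can be reached, so the traversal ends with
    an empty stack. The visited set then contains the root and all children of its members, hence
    the whole tree. *)
Lemma dfs_facts : [/\ perm_eq (dfs t) t, hit (map c (dfs t)) 1 &
  preorder [:: [::]] (map c (dfs t)) = dfs t].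
Proof.
set E := dfs t; have EE : E = tw c (#|` t|).+1 [:: [::]] := dfs_tw.
have pE : preorder [:: [::]] (map c E) = E by rewrite EE -tw_preorder.
have inv := explored_inv_preorder (map c E) explored_inv0; rewrite cat0s pE in inv.
have zE : zip E (map c E) = [seq (u, c u) | u <- E] by elim: (E) => //= x s ->.
rewrite zE in inv.
have Esub := inv_sub inv.
have [un rt _] := inv; rewrite unzip1_graph in un rt.
have Eu : uniq E by move: un; rewrite cat_uniq => /andP[].
have Es : (size E <= #|` t|)%N.
  by apply: uniq_leq_size => // w wE; apply: Esub; rewrite mem_cat wE.
have [hE pend] : hit (map c E) 1 /\ pending [:: [::]] (map c E) = [::].
  by rewrite EE; apply: (@tw_hit c (#|` t|).+1 [:: [::]]); rewrite -EE ltnS.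
rewrite pend cats0 in inv un rt Esub *.
split => //; apply: uniq_perm => // [|w]; first exact: fset_uniq.
apply/idP/idP => [/Esub //|].
have [_ [_ [par _]]] := tP.
elim/last_ind: w => [|u i IH] ut //.
have := inv_child u i inv; rewrite cats0 => ->.
by rewrite IH ?(par _ _ ut) //= -child_in.
Qed.

End PlaneTree.

Lemma hit_tree s : hit s 1 -> exists t : {fset word},
  [/\ is_plane_tree t, #|` t| = size s & map (nchildren t) (dfs t) = s].
Proof.
move=> hs; set E := preorder [:: [::]] s.
have [Es pend] := @hit_pending [:: [::]] s hs; rewrite -/E in Es.
have := explored_inv_preorder s explored_inv0; rewrite cat0s -/E pend => -[].
have zE : unzip1 (zip E s) = E by rewrite unzip1_zip // Es.
rewrite zE cats0 => un rt ch.
pose t := [fset w in E]%fset.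
have tE w : (w \in t) = (w \in E) by rewrite inE.
have chN u i : rcons u i \in E -> u \in E /\ (1 <= i)%N.
  move/ch => [m um /andP[i1 _]]; split => //.
  by rewrite -zE; apply: (map_f fst um).
have tP : is_plane_tree t.
  split; first by rewrite tE.
  split; first by elim/last_ind => [|u i IH] //; rewrite all_rcons !tE => /chN[uE ->] /=; apply: IH; rewrite tE.
  split; first by move=> u i; rewrite !tE => /chN[].
  move=> u i j; rewrite !tE => /ch[m um im] ji; apply/ch; exists m => //; lia.
exists t; split => //; first by rewrite -Es card_fseq undup_id.
have cE : map (nchildren t) E = s.
  apply: (@eq_from_nth _ 0%N); first by rewrite size_map.
  move=> k; rewrite size_map => kE; rewrite (nth_map [::]) //.
  set u := nth [::] E k; set m := nth 0%N s k.
  have um : (u, m) \in zip E s.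
    by rewrite -(nth_zip [::] 0%N) // mem_nth // size_zip -Es minnn.
  have um' m' : (u, m') \in zip E s -> m' = m.
    move/(nthP ([::], 0%N)) => [k']; rewrite size_zip -Es minnn => k'E.
    rewrite nth_zip // => -[uu <-]; congr nth; apply/eqP.
    by rewrite -(nth_uniq [::] k'E kE un) uu.
  have H i : (1 <= i <= nchildren t u)%N = (1 <= i <= m)%N.
    rewrite -(child_in tP) tE; apply/idP/idP => [/ch[m' /um' ->] //|im].
    by apply/ch; exists m.
  move: (H m) (H (nchildren t u)); move: (nchildren t u) (m) => n' m'; lia.
rewrite (dfs_tw tP) -(@preorder_tw (nchildren t) _ _ s) //.
by rewrite card_fseq undup_id // Es.
Qed.

Lemma hit_sumn s j : hit s j -> (sumn s + j = size s)%N.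
Proof.
elim: s j => [|a s IH] j /=; first by move/eqP.
by case/andP => j0 /IH; lia.
Qed.

(** * From labelled trees to i.i.d. vertices *)

Section EsumSeq.
Variables (R : realType) (T : choiceType) (S : set T) (f : T -> R).

Lemma esum_le_seq (B : R) :
  (forall r : seq T, uniq r -> (forall x, x \in r -> S x) -> \sum_(x <- r) f x <= B) ->
  (\esum_(x in S) (f x)%:E <= B%:E)%E.
Proof.
move=> H; apply: ge_ereal_sup => /= _ [F [finF FS] <-].
rewrite fsbig_finite //= sumEFin lee_fin; apply: H; first exact: fset_uniq.
by move=> x; rewrite in_fset_set // inE => /FS.
Qed.

Lemma esum_ge_seq (B : R) (r : seq T) : uniq r -> (forall x, x \in r -> S x) ->
  B <= \sum_(x <- r) f x -> (B%:E <= \esum_(x in S) (f x)%:E)%E.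
Proof.
move=> ur rS Br; apply: esum_ge; exists [set` r].
  by split; [exact: finite_seq | move=> x /= /rS].
by rewrite -fsbig_seq // sumEFin lee_fin.
Qed.

End EsumSeq.

Lemma sum_eq_le1 (R : realType) (I V : eqType) (r : seq I) (g : I -> V) (a : V) :
  uniq r -> {in r &, injective g} -> \sum_(i <- r) (a == g i)%:R <= 1 :> R.
Proof.
elim: r => [|i r IH] /=; first by rewrite big_nil ler01.
case/andP=> ir ur inj; rewrite big_cons; case: eqP => [aE|_]; last first.
  by rewrite add0r; apply: IH => // x y xr yr; apply: inj; rewrite inE ?xr ?yr orbT.
rewrite big_seq big1 ?addr0 // => j jr; case: eqP => // aj.
by move: ir; rewrite (inj i j _ _ _) ?jr ?inE ?eqxx ?jr ?orbT // -aE.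
Qed.

(* Labels in depth-first order, from the reversed list of the non-root vertices. *)
Definition label_seq (t : seq vtx) : seq word :=
  rev (visited dnW upW (fun=> [::]) t ++ [:: [::]]).

(** Forward version of [visited] with an explicit stack of parent labels. The index 0 given to
    [mstep] is a dummy, as [upW] ignores it. *)
Fixpoint frun (st : seq word) (s : seq vtx) : seq word :=
  if s is x :: s' then
    let y := mstep dnW upW 0 x (head [::] st) in
    y :: frun (nseq x.1.1 y ++ behead st) s'
  else [::].

Lemma visited_frun st s :
  visited dnW upW (fun d => nth [::] st d) (rev s) = rev (frun st s).
Proof.
elim: s st => [|x s IH] st //=.
rewrite rev_cons -cats1 visited_cat /= rev_cons -cats1; rewrite /lbl /= nth0; congr (_ ++ _).
rewrite -IH; congr (visited _ _ _ _); apply/funext => d.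
rewrite nth_cat size_nseq nth_nseq; case: ltnP => // xd.
by rewrite nth_behead.
Qed.

Lemma label_seq_frun k s : label_seq (rev s) = [::] :: frun (nseq k [::]) s.
Proof.
rewrite /label_seq (_ : (fun=> [::]) = (fun d => nth [::] (nseq k ([::] : word)) d)).
  by rewrite visited_frun cats1 rev_rcons revK.
by apply/funext => d; rewrite nth_nseq if_same.
Qed.

Fixpoint fw (R : realType) (b : nat) (st : seq word) (xi : seq nat) (ls : seq word) : R :=
  match xi, ls with
  | a :: xi', l :: ls' => pker b (head [::] st) l * fw R b (nseq a l ++ behead st) xi' ls'
  | _, _ => 1
  end.

Section Transfer.
Variables (R : realType) (mu : nat -> R) (q : nat) (C : R) (b : nat).
Hypothesis H : offspring mu q C.
Hypothesis b2 : (2 <= b)%N.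

Let dz := dprod (ddir R) (letters R b).
Let dzlaw : is_law dz := dprod_law (ddir_law R) (letters_law R b2).

Definition mkv (a : nat) (z : bool * nat) : vtx := ((a, z.1), z.2).
Definition mkvs (xi : seq nat) (z : seq (bool * nat)) : seq vtx :=
  [seq mkv p.1 p.2 | p <- zip xi z].

Lemma Ex_dX_split N m f : Ex (iid (dX mu b N) m) f =
  Ex (iid (cap mu N) m) (fun xi => Ex (iid dz m) (fun z => f (mkvs xi z))).
Proof.
rewrite -(Ex_iid_pair (cap mu N) dz m (fun s => f [seq mkv p.1 p.2 | p <- s])).
symmetry; apply: (@Ex_iid_map _ _ _ (fun p => mkv p.1 p.2)) => h.
by rewrite !Ex_dprod; apply: eq_Ex => a; rewrite Ex_dprod.
Qed.

Lemma letters_ge j : (1 <= j <= b)%N -> b%:R^-1 <= Pr (letters R b) (fun i => i == j).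
Proof.
move=> jb; rewrite /Pr Ex_letters -[leLHS]mulr1 ler_wpM2l ?invr_ge0 //.
have ji : j \in iota 1 b by rewrite mem_iota; lia.
by rewrite (perm_big _ (perm_to_rem ji)) big_cons eqxx lerDl sumr_ge0.
Qed.

Lemma pker_ge0 x y : 0 <= pker b x y :> R.
Proof.
by rewrite /pker; do ?case: ifP => _; rewrite ?invr_ge0 ?ler0n // mulr_ge0.
Qed.

(** At the root of W_b both directions append the letter, so the two halves add up to [1 / b];
    elsewhere each direction reproduces one case of the kernel. *)
Lemma pker_le a x l :
  pker b x l <= Ex dz (fun z => (mstep dnW upW 0 (mkv a z) x == l)%:R) :> R.
Proof.
have lettersP := letters_law R b2.
have E0 P : 0 <= Ex (letters R b) (fun i => (P i)%:R) by apply: Ex_ge0.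
rewrite /dz Ex_dprod Ex_ddir /mstep /mkv /=.
have half0 : 0 <= 2^-1 :> R by rewrite invr_ge0.
have nonneg : 0 <= 2^-1 * Ex (letters R b) (fun y => (dnW x y == l)%:R) +
    2^-1 * Ex (letters R b) (fun y => (upW 0 y x == l)%:R) :> R.
  by rewrite addr_ge0 // mulr_ge0.
rewrite /pker; case: eqP => [xE|/eqP x0].
  rewrite xE in nonneg *; case: ifP => // /andP[]; case: l nonneg => [|j [|j' l]] // _ _.
  rewrite /inW /= andbT => jb.
  rewrite (@eq_Ex _ _ _ (fun y => (dnW [::] y == [:: j])%:R) (fun y => (y == j)%:R)); last first.
    by move=> y; rewrite /dnW /= eqseq_cons andbT.
  have := letters_ge jb; rewrite /Pr; lra.
case: eqP => [lE|_].
  rewrite (@eq_Ex _ _ _ (fun y => (upW 0 y x == l)%:R) (fun=> 1)); last first.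
    by move=> y; rewrite /upW; case: (x) x0 lE => // c w _ ->; rewrite eqxx.
  by rewrite Ex_cst // mulr1 lerDr mulr_ge0.
case: ifP => // /andP[/andP[/eqP ls /eqP lx] lW].
have [j lE] : exists j, l = rcons x j.
  case/lastP: l ls lx {lW nonneg} => [|l j] //; rewrite size_rcons => -[ls].
  by rewrite -cats1 -ls take_size_cat // => <-; exists j; rewrite cats1.
move: lW; rewrite lE -cats1 drop_size_cat // /inW /= andbT => jb.
rewrite (@eq_Ex _ _ _ (fun y => (dnW x y == x ++ [:: j])%:R) (fun y => (y == j)%:R)); last first.
  by move=> y; rewrite /dnW -cats1 eqseq_cat // eqxx eqseq_cons andbT.
rewrite invfM; apply: ler_wpDr; first by rewrite mulr_ge0.
by apply: ler_wpM2l => //; apply: letters_ge.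
Qed.

Lemma fw_le st xi ls : size ls = size xi ->
  fw R b st xi ls <= Pr (iid dz (size xi)) (fun z => frun st (mkvs xi z) == ls).
Proof.
elim: xi st ls => [|a xi IH] st [|l ls] //=; first by rewrite /Pr Ex_iid0.
case=> sl; rewrite /Pr Ex_iidS.
apply: (@le_trans _ _ (pker b (head [::] st) l *
   Pr (iid dz (size xi)) (fun z => frun (nseq a l ++ behead st) (mkvs xi z) == ls))).
  by rewrite ler_wpM2l ?pker_ge0 // IH.
apply: (@le_trans _ _ (Ex dz (fun z => (mstep dnW upW 0 (mkv a z) (head [::] st) == l)%:R *
   Pr (iid dz (size xi)) (fun z => frun (nseq a l ++ behead st) (mkvs xi z) == ls)))).
  rewrite ExZr ler_wpM2r ?pker_le //; exact: Pr_ge0 (iid_law dzlaw _) _.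
apply: le_Ex => // z; rewrite -ExZ; apply: le_Ex => [|zs]; first exact: iid_law.
rewrite /mkvs /= eqseq_cons -natrM mulnb.
by case: eqP => [->|].
Qed.

Section OneTree.
Variable t : {fset word}.
Hypothesis tP : is_plane_tree t.
Let phi := map (nchildren t) (dfs t).

Lemma fw_prod (lb : word -> word) st s : hit s (size st) ->
  fw R b (map (lb \o wparent) st) s (map lb (preorder st s)) =
  \prod_(v <- preorder st s) pker b (lb (wparent v)) (lb v).
Proof.
elim: s st => [|a s IH] [|v st] //=; rewrite ?big_nil //.
move=> hs; rewrite big_cons /=; congr (_ * _).
rewrite -IH; last by rewrite size_cat size_map size_iota addnC.
congr (fw _ _ _ _ _); rewrite map_cat; congr (_ ++ _).
rewrite /kids -map_comp.
rewrite (@eq_map _ _ _ (fun=> lb v)); last by move=> i /=; rewrite wparent_rcons.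
by elim: {hs} a 1%N => //= a IHa k; rewrite -IHa.
Qed.

Lemma dfs_root : exists2 E, dfs t = [::] :: E & [::] \notin E.
Proof.
have [pE _ _] := dfs_facts tP.
have uE : uniq (dfs t) by rewrite (perm_uniq pE) fset_uniq.
have := dfs_tw tP; case: (dfs t) uE => [|v E] //= /andP[vE _] [vN _].
by exists E; rewrite -vN.
Qed.

Lemma gw_weight_phi : gw_weight mu t = \prod_(a <- phi) mu a.
Proof. by have [pE _ _] := dfs_facts tP; rewrite /gw_weight /phi big_map (perm_big _ pE). Qed.

Lemma size_phi : size phi = #|` t|.
Proof. by have [pE _ _] := dfs_facts tP; rewrite size_map (perm_size pE). Qed.

(** The label of the root is deterministic, so its vertex is left out; its children are represented
    by an initial stack of root labels. *)
Lemma brw_weight_le y m : #|` t| = m.+1 -> lab y [::] = [::] ->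
  brw_weight b t y <= Pr (iid dz m)
    (fun z => label_seq (rev (mkvs (behead phi) z)) == map (lab y) (dfs t)) :> R.
Proof.
move=> tm y0; have [pE hE preE] := dfs_facts tP.
have [E EE rE] := dfs_root.
rewrite /brw_weight -(perm_big _ pE) EE big_cons eqxx /=.
rewrite big_seq_cond (@eq_bigl _ _ _ _ _ _ (mem E)) -?big_seq; last first.
  by move=> v /=; case: (boolP (v \in E)) => //= vE; apply: contraNneq rE => <-.
have phiE : phi = nchildren t [::] :: map (nchildren t) E by rewrite /phi EE.
rewrite phiE /=.
move: hE preE; rewrite -/phi phiE EE /= add0n cats0 => hE [preE].
have sk : hit (map (nchildren t) E) (size (kids [::] (nchildren t [::]))).
  by rewrite size_map size_iota.
have := fw_prod (lab y) sk; rewrite preE => <-.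
have smE : size (map (nchildren t) E) = m.
  by have := size_phi; rewrite phiE tm => -[].
rewrite -{1}smE; set k := nchildren t [::] in sk *.
have -> : map (lab y \o wparent) (kids [::] k) = nseq k [::].
  rewrite /kids -map_comp (@eq_map _ _ _ (fun=> [::])); last first.
    by move=> i; exact: y0.
  by elim: {sk} k 1%N => //= a IHa j; rewrite IHa.
apply: (le_trans (fw_le _ _)); first by rewrite !size_map.
apply: le_Pr => [|z /eqP zE]; first exact: iid_law.
by rewrite (label_seq_frun k) zE y0.
Qed.

End OneTree.

Lemma phi_inj t t' : is_plane_tree t -> is_plane_tree t' ->
  map (nchildren t) (dfs t) = map (nchildren t') (dfs t') -> t = t'.
Proof.
move=> tP tP' pp.
have [pE _ e] := dfs_facts tP; have [pE' _ e'] := dfs_facts tP'.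
apply/fsetP => v; rewrite -(perm_mem pE) -(perm_mem pE').
by rewrite -e -e' pp.
Qed.

Lemma labelling_inj t y y' : is_plane_tree t -> is_labelling t y -> is_labelling t y' ->
  map (lab y) (dfs t) = map (lab y') (dfs t) -> y = y'.
Proof.
move=> tP [dy _] [dy' _] yy; have [pE _ _] := dfs_facts tP.
apply/fmapP => v; case: (boolP (v \in t)) => vt; last first.
  have n1 : v \notin domf y by rewrite dy.
  have n2 : v \notin domf y' by rewrite dy'.
  by rewrite (not_fnd n1) (not_fnd n2).
have vE : v \in dfs t by rewrite (perm_mem pE).
have : lab y v = lab y' v by move/eq_in_map: yy => /(_ _ vE).
rewrite /lab; have v1 : v \in domf y by rewrite dy.
have v2 : v \in domf y' by rewrite dy'.
by rewrite (in_fnd v1) (in_fnd v2) /= => ->.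
Qed.

Definition size_law m : R := Pr (iid (cap mu m.+1) m.+1) (hit^~ 1%N).

Lemma gw_weight_word t m : is_plane_tree t -> #|` t| = m.+1 ->
  gw_weight mu t = Pr (iid (cap mu m.+1) m.+1) (fun s => s == map (nchildren t) (dfs t)).
Proof.
move=> tP tm; have [_ hE _] := dfs_facts tP.
have sE := size_phi tP; rewrite tm in sE.
rewrite gw_weight_phi // -(@Pr_word _ mu m.+1) ?sE // => w ww.
have := hit_sumn hE; rewrite sE addn1 => -[].
by rewrite sumnE (perm_big _ (perm_to_rem ww)) big_cons /= => <-; rewrite ltnS leq_addr.
Qed.

Lemma gw_weight_ge0 t : 0 <= gw_weight mu t.
Proof. by apply: prodr_ge0 => v _; apply: mu_ge0 H _. Qed.

(** Distinct trees have distinct offspring sequences, so their weights are the probabilities of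
    disjoint events. *)
Lemma sum_trees_le m (G : seq nat -> R) (r : seq {fset word}) : (forall s, 0 <= G s) ->
  uniq r -> (forall t, t \in r -> is_plane_tree t /\ #|` t| = m.+1) ->
  \sum_(t <- r) gw_weight mu t * G (map (nchildren t) (dfs t)) <=
  Ex (iid (cap mu m.+1) m.+1) G.
Proof.
move=> G0 ur rP.
rewrite big_seq (eq_bigr (fun t => Ex (iid (cap mu m.+1) m.+1)
   (fun s => (s == map (nchildren t) (dfs t))%:R * G s))); last first.
  move=> t /rP[tP tm]; rewrite (gw_weight_word tP tm) /Pr -ExZr; apply: eq_Ex => s.
  by case: eqP => [->|]; rewrite ?mul0r.
rewrite -big_seq -Ex_sum; apply: le_Ex => [|s]; first exact: iid_law (cap_law H _) _.
rewrite -mulr_suml ler_piMl //; apply: sum_eq_le1 => // t t' /rP[tP _] /rP[tP' _].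
exact: phi_inj.
Qed.

Lemma size_prob_ge m : exists2 p : R, size_prob mu m.+1 = p%:E & size_law m <= p.
Proof.
have le1 : (size_prob mu m.+1 <= 1%:E)%E.
  apply: esum_le_seq => r ur rP.
  have := @sum_trees_le m (fun=> 1) r (fun=> ler01) ur rP.
  by under eq_bigr do rewrite mulr1; rewrite Ex_cst //; exact: iid_law (cap_law H _) _.
have ge : ((size_law m)%:E <= size_prob mu m.+1)%E.
  pose L := undup [seq p.2 | p <- iid (cap mu m.+1) m.+1 & hit p.2 1 && (size p.2 == m.+1)].
  have /choice[psi psiP] : forall s, exists t : {fset word}, hit s 1 ->
      [/\ is_plane_tree t, #|` t| = size s & map (nchildren t) (dfs t) = s].
    move=> s; case: (boolP (hit s 1)) => [/hit_tree[t tP]|_]; first by exists t.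
    by exists fset0.
  have LP s : s \in L -> hit s 1 /\ size s = m.+1.
    by rewrite mem_undup => /mapP[p]; rewrite mem_filter => /andP[/andP[hp /eqP sp] _] ->.
  apply: (@esum_ge_seq _ _ _ _ _ (map psi L)).
  - rewrite map_inj_in_uniq ?undup_uniq // => s s' /LP[hs _] /LP[hs' _] ss.
    by have [_ _ <-] := psiP _ hs; have [_ _ <-] := psiP _ hs'; rewrite ss.
  - move=> t /mapP[s /LP[hs ss] ->]; have [tP ts _] := psiP _ hs.
    by split => //=; rewrite ts.
  rewrite big_map big_seq (eq_bigr (fun s' => Ex (iid (cap mu m.+1) m.+1) (fun s => (s == s')%:R))); last first.
    move=> s /LP[hs ss]; have [tP ts sE] := psiP _ hs.
    by rewrite (@gw_weight_word _ m) ?ts // sE.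
  rewrite -big_seq -Ex_sum /size_law /Pr.
  rewrite (@eq_Ex_iid _ _ _ _ _ (fun s => (hit s 1 && (size s == m.+1))%:R)); last first.
    by move=> s ->; rewrite eqxx andbT.
  have [/allP pos _] := iid_law (cap_law H m.+1) m.+1.
  rewrite /Ex big_seq [leRHS]big_seq; apply: ler_sum => p pd; apply: ler_wpM2l; first exact: pos.
  case: (boolP (_ && _)) => [hp|_]; last by apply: sumr_ge0.
  have pL : p.2 \in L by rewrite mem_undup; apply: map_f; rewrite mem_filter hp.
  by rewrite (perm_big _ (perm_to_rem pL)) big_cons eqxx lerDl sumr_ge0.
have ge0 : (0 <= size_prob mu m.+1)%E.
  by apply: esum_ge0 => t _; rewrite lee_fin gw_weight_ge0.
have fin : size_prob mu m.+1 \is a fin_num.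
  by rewrite ge0_fin_numE //; apply: (le_lt_trans le1); rewrite ltry.
exists (fine (size_prob mu m.+1)); first by rewrite fineK.
by rewrite -lee_fin fineK.
Qed.

(** Trees, and labellings of a given tree, are recovered from the i.i.d. data, so the sums run over
    disjoint events. All initial stack entries carry the root label, so the number of children of
    the root does not influence [label_seq]; it is averaged out, leaving [m] vertices. *)
Lemma joint_prob_le m (E : {fset word} -> {fmap word -> word} -> Prop) (Bad : seq word -> bool) :
  (forall t y, is_plane_tree t -> #|` t| = m.+1 -> is_labelling t y -> E t y ->
     Bad (map (lab y) (dfs t))) ->
  (joint_prob mu b m.+1 E <=
   (Pr (iid (dX mu b m.+1) m) (fun t => Bad (label_seq t)))%:E)%E.
Proof.
move=> EBad.
have law := cap_law H m.+1.
pose G (s : seq nat) : R := Pr (iid dz m) (fun z => Bad (label_seq (rev (mkvs (behead s) z)))).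
have G0 s : 0 <= G s by apply: Pr_ge0; exact: iid_law.
have -> : Pr (iid (dX mu b m.+1) m) (fun t => Bad (label_seq t)) =
    Ex (iid (cap mu m.+1) m.+1) G.
  rewrite Ex_iidS -[LHS](Ex_cst law); apply: eq_Ex => a; rewrite /Pr.
  rewrite -(Ex_iid_rev _ m (fun t => (Bad (label_seq t))%:R)).
  by rewrite Ex_dX_split.
apply: (@le_trans _ _ (\esum_(t in [set t : {fset word} | is_plane_tree t /\ #|` t| = m.+1])
   (gw_weight mu t * G (map (nchildren t) (dfs t)))%:E)%E); last first.
  apply: esum_le_seq => r ur rP; exact: sum_trees_le.
apply: le_esum => t [tP tm].
apply: esum_le_seq => r ur rP.
rewrite -mulr_sumr ler_wpM2l ?gw_weight_ge0 //.
apply: (@le_trans _ _ (\sum_(y <- r) Pr (iid dz m)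
    (fun z => label_seq (rev (mkvs (behead (map (nchildren t) (dfs t))) z)) == map (lab y) (dfs t)))).
  rewrite big_seq [leRHS]big_seq; apply: ler_sum => y /rP[[_ y0] _].
  exact: brw_weight_le.
rewrite /Pr -Ex_sum; apply: le_Ex => [|z]; first exact: iid_law.
set a := label_seq _; have inj : {in r &, injective (fun y => map (lab y) (dfs t))}.
  by move=> y y' /rP[yl _] /rP[yl' _]; apply: labelling_inj.
case: (boolP (Bad a)) => [_|nB]; first exact: sum_eq_le1.
rewrite big_seq big1 // => y /rP[yl yE]; case: eqP => // aE.
by move: nB; rewrite aE (EBad _ _ tP tm yl yE).
Qed.

Lemma size_law_sum m : m.+1%:R * size_law m =
  Pr (iid (cap mu m.+1) m.+1) (fun s => (sumn s + 1 == m.+1)%N).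
Proof. by rewrite /size_law kemperman mul1r. Qed.

Lemma cond_prob_le m E (Bad : seq word -> bool) : 0 < size_law m ->
  (forall t y, is_plane_tree t -> #|` t| = m.+1 -> is_labelling t y -> E t y ->
     Bad (map (lab y) (dfs t))) ->
  0 <= cond_prob mu b m.+1 E <=
  Pr (iid (dX mu b m.+1) m) (fun t => Bad (label_seq t)) / size_law m.
Proof.
move=> sl EBad; have [p pE lp] := size_prob_ge m.
have p0 : 0 < p := lt_le_trans sl lp.
rewrite /cond_prob pE /=.
have jle := joint_prob_le EBad.
have j0 : (0 <= joint_prob mu b m.+1 E)%E.
  apply: esum_ge0 => t _; apply: esum_ge0 => y _; rewrite lee_fin.
  by rewrite mulr_ge0 ?gw_weight_ge0 // prodr_ge0 // => v _; apply: pker_ge0.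
have f0 : 0 <= fine (joint_prob mu b m.+1 E) by apply: fine_ge0.
have fle : fine (joint_prob mu b m.+1 E) <= Pr (iid (dX mu b m.+1) m) (fun t => Bad (label_seq t)).
  by rewrite -lee_fin fineK // ge0_fin_numE //; apply: (le_lt_trans jle); rewrite ltry.
rewrite divr_ge0 ?(ltW p0) //=.
apply: ler_pM => //; first by rewrite invr_ge0 ltW.
by rewrite lef_pV2 ?posrE.
Qed.

End Transfer.

(** A finite tree has a leaf, which contributes a factor [mu 0]. *)
Lemma size_prob0 (R : realType) (mu : nat -> R) n : mu 0%N = 0 -> size_prob mu n = 0%E.
Proof.
move=> mu0; apply: esum1 => t [tP tn]; congr (_%:E).
have [pE hE _] := dfs_facts tP.
rewrite gw_weight_phi //.
suff h0 : 0%N \in map (nchildren t) (dfs t).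
  by rewrite (perm_big _ (perm_to_rem h0)) big_cons /= mu0 mul0r.
apply: contraT => h0; have := hit_sumn hE.
suff : forall s : seq nat, 0%N \notin s -> (size s <= sumn s)%N by move=> /(_ _ h0); lia.
by elim=> //= a s IH; rewrite inE negb_or => /andP[a0 /IH]; lia.
Qed.

(** * The range as a sum of novelty indicators *)

Local Notation sig0 := (fun=> [::] : word).

Definition isnew (t : seq vtx) : bool := ~~ coll (fun=> [::]) [:: [::]] t.

Lemma isnew_cat x t h :
  isnew ((x :: t) ++ h) =
  ~~ coll (stk dnW upW (fun=> [::]) h) ([::] :: visited dnW upW (fun=> [::]) h) (x :: t).
Proof.
rewrite /isnew /= visited_cat !inE !mem_cat /lbl stk_cat; congr (~~ (_ || _)).
by rewrite orbC.
Qed.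

Lemma range_visited (R : realType) (u : seq vtx) :
  (size (undup (visited dnW upW (fun=> [::]) u ++ [:: [::]])))%:R =
  1 + \sum_(1 <= l < (size u).+1) (isnew (drop (size u - l) u))%:R :> R.
Proof.
elim: u => [|x u IH]; first by rewrite /= big_geq // addr0.
rewrite big_nat_recr //= subnn drop0 addrA.
rewrite (_ : \sum_(1 <= l < (size u).+1) _ =
   \sum_(1 <= l < (size u).+1) (isnew (drop (size u - l) u))%:R); last first.
  by apply: eq_big_nat => l /andP[_ lu]; rewrite subSn.
rewrite -IH.
have -> : isnew (x :: u) = (lbl dnW upW (fun=> [::]) x u \notin visited dnW upW (fun=> [::]) u ++ [:: [::]]).
  by rewrite /isnew /coll !mem_cat orbC.
by case: (_ \in _); rewrite /= ?addr0 ?natr1.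
Qed.

Lemma drop_visited k u : drop k (visited dnW upW (fun=> [::]) u) =
  visited dnW upW (fun=> [::]) (drop k u).
Proof. by elim: u k => [|x u IH] [|k] //=. Qed.

Lemma range_prefix (R : realType) (c : R) (t : seq vtx) l : (l <= size t)%N ->
  (size (undup (take l.+1 (label_seq t))))%:R - c * l.+1%:R =
  (1 - c) + \sum_(1 <= i < l.+1) ((isnew (drop (size t - i) t))%:R - c).
Proof.
move=> lt; rewrite /label_seq take_rev size_cat size_visited addn1 subSS.
rewrite drop_cat size_visited.
have -> : (if (size t - l < size t)%N then
     drop (size t - l) (visited dnW upW (fun=> [::]) t) ++ [:: [::]]
     else drop (size t - l - size t) [:: [::]]) =
    visited dnW upW (fun=> [::]) (drop (size t - l) t) ++ [:: [::]].
  case: ltnP => [|tl]; first by rewrite drop_visited.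
  have -> : l = 0%N by lia.
  by rewrite subn0 subnn drop_size.
have -> (s : seq word) : size (undup (rev s)) = size (undup s).
  by apply/perm_size/perm_undup => w; rewrite mem_rev.
rewrite range_visited size_drop subKn // sumrB sumr_const_nat subn1 /=.
rewrite (_ : \sum_(1 <= i < l.+1) (isnew (drop (l - i) (drop (size t - l) t)))%:R =
   \sum_(1 <= i < l.+1) (isnew (drop (size t - i) t))%:R :> R); last first.
  apply: eq_big_nat => i /andP[_ il]; rewrite drop_drop; congr (isnew (drop _ _))%:R; lia.
by rewrite -[l.+1%:R]natr1 -mulr_natr; ring.
Qed.

Lemma root_between P m : (0 < P)%N -> exists y, (y ^ P <= m < y.+1 ^ P)%N.
Proof.
move=> P0; elim: m => [|m [y /andP[y1 y2]]]; first by exists 0%N; rewrite exp0n // exp1n.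
case: (ltnP m.+1 (y.+1 ^ P)) => ym; first by exists y; rewrite (leqW y1).
exists y.+1; rewrite ym /=; apply: (leq_ltn_trans y2); by rewrite ltn_exp2r.
Qed.

Lemma sqr_le_pow2 j : (j * j <= 4 * 2 ^ j)%N.
Proof.
elim: j => // j IH; case: (ltnP j 3) => j3; first by case: j j3 {IH} => [|[|[|j]]].
by rewrite expnS; nia.
Qed.

Section Core.
Variables (R : realType) (mu : nat -> R) (q : nat) (C : R) (b : nat).
Hypothesis H : offspring mu q C.
Hypothesis b2 : (2 <= b)%N.

(** By [fresh_stable] the caps are compatible, so the diagonal sequence is nonincreasing;
    [fresh_ge0_pos] keeps it away from 0. *)
Lemma fresh_limit : mu 0%N < 1 -> exists c : R, [/\ 0 < c, c <= 1 &
  (fun m => fresh mu b m m) @ \oo --> c].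
Proof.
move=> mu01; have [c0 c00 fc] := fresh_ge0_pos H b2 mu01.
have ni : nonincreasing_seq (fun m => fresh mu b m m).
  apply/nonincreasing_seqP => m; rewrite -(fresh_stable mu b (leqnn m) (leqnSn m)).
  exact: fresh_nonincr H b2 _ _.
have cv : cvgn (fun m => fresh mu b m m).
  by apply: nonincreasing_is_cvgn => //; exists c0 => _ [m _ <-].
exists (limn (fun m => fresh mu b m m)); split => //.
- by apply: (lt_le_trans c00); apply: limr_ge => //; near=> m.
- apply: limr_le => //; near=> m; apply: Pr_le1; exact: iid_law (dX_law H b2 _) _.
Unshelve. all: by end_near.
Qed.

Variable c : R.
Hypothesis c01 : 0 <= c <= 1.

(** Beyond the distance from [fresh] to [c], depth at most [D] costs [(2 (1 + C) + D + 1) / y], and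
    matching one of at most [n + 1] labels through [D] letters costs at most
    [(n + 1) / 2 ^ D <= 1 / y]. *)
Lemma window_estimate N n M y D h : (0 < y)%N -> (y ^ (3 * q) <= N)%N ->
  M = (2 * y ^ (3 * q + 8)).+1 -> (M <= N)%N -> (n.+1 * y <= 2 ^ D)%N -> (M + size h <= n)%N ->
  `| Pr (iid (dX mu b N) M) (fun w => isnew (w ++ h)) - c | <=
  `| fresh mu b M M - c | + (2 * (1 + C) + D%:R + 2) / y%:R.
Proof.
move=> y0 yN ME MN nD hn.
have yR : 0 < y%:R :> R by rewrite ltr0n.
have MP : (0 < M)%N by rewrite ME.
rewrite -[Pr _ _](@subrK _ (fresh mu b N M)) -addrA.
apply: le_trans (ler_normD _ _) _; rewrite [X in X <= _]addrC.
rewrite (fresh_stable mu b (leqnn M) MN) lerD2l.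
have -> : Pr (iid (dX mu b N) M) (fun w => isnew (w ++ h)) =
   Pr (iid (dX mu b N) M) (fun w => ~~ coll (stk dnW upW (fun=> [::]) h)
       ([::] :: visited dnW upW (fun=> [::]) h) w).
  apply: eq_Ex_iid => -[wM|x w _]; first by rewrite -wM in MP.
  by rewrite isnew_cat.
rewrite -(fresh_stable mu b (leqnn M) MN).
set A := _ :: _; have AE : size A = (size h).+1 by rewrite /= size_visited.
rewrite {1 2}ME; apply: (le_trans (fresh_cond H b2 N _ _ A D)).
rewrite (_ : (2 * (1 + C) + D%:R + 2) / y%:R = (2 * (1 + C) + D.+1%:R) / y%:R + y%:R^-1); last first.
  by rewrite -[D.+1%:R]natr1; field; rewrite gt_eqF.
apply: lerD; first exact: (depth_small H).
rewrite AE -ME exprVn ler_pdivrMr ?exprn_gt0 ?ltr0n //; last by apply: leq_trans b2.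
rewrite mulrC ler_pdivlMr //.
apply: (@le_trans _ _ (2 ^ D)%:R).
  by rewrite -natrM ler_nat; apply: leq_trans nD; rewrite leq_mul2r addSn addnC; apply/orP; right; lia.
rewrite -natrX ler_nat; case: (posnP D) => [->|D0]; first by rewrite !expn0.
by rewrite leq_exp2r.
Qed.

End Core.

Lemma eventually_nat_ge (R : realType) (x : R) : exists Y : nat, forall y, (Y <= y)%N -> x <= y%:R.
Proof.
exists (Num.truncn x).+1 => y xy; apply: le_trans (_ : (Num.truncn x).+1%:R <= _).
  by apply: ltW; apply: truncnS_gt.
by rewrite ler_nat.
Qed.

Lemma expRN_le (R : realType) (x : R) : 0 < x -> expR (- x) <= (5 / x) ^+ 5.
Proof.
move=> x0; rewrite expRN -[leRHS]invrK lef_pV2 ?posrE ?expR_gt0 ?invr_gt0 ?exprn_gt0 ?divr_gt0 //.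
rewrite -exprVn invf_div (_ : expR x = expR (x / 5) ^+ 5); last first.
  by rewrite -expRM_natl; congr expR; field.
apply: lerXn2r; rewrite ?nnegrE ?expR_ge0 ?divr_ge0 ?ltW //.
by apply: lt_le_trans (expR_ge1Dx _); rewrite ltrDr.
Qed.

Definition bad_prefix (R : realType) (n : nat) (eps c : R) (ls : seq word) : bool :=
  [exists k : 'I_n.+1, (1 <= k)%N &&
     (eps < n%:R^-1 * `| (size (undup (take k ls)))%:R - c * k%:R |)].

Lemma rate_exp_bounds q Q :
  [/\ (Q + 2 <= (Q + 1) * (q + 2) + 1)%N, (Q + 1 <= (Q + 1) * (q + 2) + 1)%N &
     (Q * 2 <= (Q + 1) * (q + 2) + 1)%N].
Proof. by split; nia. Qed.

(** * Choice of the exponents and rate of convergence *)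

Section Rate.
Variables (R : realType) (mu : nat -> R) (q : nat) (C : R) (b : nat).
Hypothesis H : offspring mu q C.
Hypothesis b2 : (2 <= b)%N.
Hypothesis mu00 : 0 < mu 0%N.
Hypothesis mu_aperiodic : aperiodic mu.
Variable k0 : nat.
Hypothesis k02 : (2 <= k0)%N.
Hypothesis muk0 : 0 < mu k0.
Variable c : R.
Hypothesis c01 : 0 <= c <= 1.
Hypothesis freshc : (fun m => fresh mu b m m) @ \oo --> c.

Let Q := (3 * q + 8)%N.
(** [sum_point_lower] is used with [k = y ^ (Q + 1)]; this exponent gives [2 k ^ (q + 2) <= y ^ P]
    for [y >= 2]. *)
Definition rate_exp := ((Q + 1) * (q + 2) + 1)%N.
Local Notation P := rate_exp.

Lemma bad_prefix_sum m eps e (t : seq vtx) : size t = m -> 0 < e -> 2 * e <= eps ->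
  1 <= e * m%:R -> bad_prefix m.+1 eps c (label_seq t) ->
  [exists k : 'I_m.+1,
     e * m%:R < `| \sum_(1 <= l < k.+1) ((isnew (drop (m - l) t))%:R - c) | ].
Proof.
move=> tm e0 ee em /existsP[[[|l] lm] //= big].
move: big; rewrite range_prefix ?tm // mulrC ltr_pdivlMr ?ltr0n // => big.
apply/existsP; exists (Ordinal (lm : (l < m.+1)%N)) => /=.
have := ler_normD (1 - c) (\sum_(1 <= i < l.+1) ((isnew (drop (m - i) t))%:R - c)).
have -> : `|1 - c| = 1 - c by rewrite ger0_norm // subr_ge0; case/andP: c01.
move=> tri; have := lt_le_trans big tri.
rewrite -[m.+1%:R]natr1; case/andP: c01 => c0 _; have mR : 0 <= m%:R :> R by [].
move: `|_| => s; nra.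
Qed.

(** [j] is about the binary logarithm of [y]; the crude bound [j ^ 2 <= 16 y] is enough to make the
    depth [j (P + 1)] negligible compared with [y]. *)
Lemma depth_window (y m : nat) : (y ^ P <= m < y.+1 ^ P)%N -> (0 < y)%N ->
  exists j, (m.+1 * y <= 2 ^ (j * (P + 1)))%N /\ (j * j <= 16 * y)%N.
Proof.
case/andP=> _ my y0; exists (trunc_log 2 y.+1).+1; split.
  apply: (@leq_trans (y.+1 ^ (P + 1))); first by rewrite expnD expn1 leq_mul.
  by rewrite expnM leq_exp2r ?addn1 // ltnW // trunc_log_ltn.
apply: leq_trans (sqr_le_pow2 _) _; rewrite expnS.
have := @trunc_logP 2 y.+1 isT isT; lia.
Qed.

Lemma bad_probability eps : 0 < eps -> exists a : R, exists Y : nat, 0 < a /\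
  forall y m, (Y <= y)%N -> (y ^ P <= m < y.+1 ^ P)%N ->
  Pr (iid (dX mu b m.+1) m) (fun t => bad_prefix m.+1 eps c (label_seq t)) <=
  2 * m.+1%:R * expR (- (a * (m%:R / (y ^ Q)%:R))).
Proof.
move=> eps0; pose e := Num.min eps 1 / 2.
have min0 : 0 < Num.min eps 1 by rewrite lt_min eps0 ltr01.
have e0 : 0 < e by rewrite divr_gt0.
have e1 : e <= 1.
  have : Num.min eps 1 <= 1 by rewrite ge_min lexx orbT.
  by rewrite /e; lra.
have ee : 2 * e <= eps.
  have -> : 2 * e = Num.min eps 1 by rewrite /e; field.
  by rewrite ge_min lexx.
(* The 64 of [partial_sums_tail] times the 3 of [M <= 3 y ^ Q]. *)
exists (e ^+ 2 / 192).
have [m0 fm0] : exists m0, forall m, (m0 <= m)%N -> `|fresh mu b m m - c| <= e / 16.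
  have e16 : 0 < e / 16 by rewrite divr_gt0.
  have /cvgrPdist_le/(_ _ e16)[m0 _ mP] := freshc.
  by exists m0 => m mm; rewrite distrC; apply: mP.
pose B1 := (2 * (1 + C) + 2) * 32 / e.
pose e' := e / (32 * (P + 1)%:R).
have e'0 : 0 < e' by rewrite divr_gt0 // mulr_gt0 // ltr0n addn1.
have [Y1 Y1P] := eventually_nat_ge B1.
have [Y2 Y2P] := eventually_nat_ge (16 / e' ^+ 2).
have [Y3 Y3P] := eventually_nat_ge (6 / e).
exists (m0 + Y1 + Y2 + Y3 + 2)%N; split; first by rewrite divr_gt0 // exprn_gt0.
move=> y m Yy ym; have y0 : (0 < y)%N by move: Yy; clear; lia.
have y2 : (2 <= y)%N by move: Yy; clear; lia.
have yR : 0 < y%:R :> R by rewrite ltr0n.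
have /andP[ym1 ym2] := ym.
have [j [jD jy]] := depth_window ym y0.
have [PQ _ _] := rate_exp_bounds q Q; rewrite -/P in PQ.
have yQP : (y ^ (Q + 2) <= m)%N by apply: leq_trans ym1; rewrite leq_exp2l.
have yQ0 : (0 < y ^ Q)%N by rewrite expn_gt0 y0.
pose M := (2 * y ^ Q).+1.
have M3 : (M <= 3 * y ^ Q)%N by rewrite /M; move: yQ0; move: (y ^ Q)%N; clear; lia.
have y4 : (4 <= y ^ 2)%N by rewrite -[4%N]/(2 ^ 2)%N leq_exp2r.
have Mm : (M <= m)%N.
  apply: leq_trans yQP; rewrite expnD; apply: leq_trans M3 _.
  by rewrite mulnC leq_mul2l (ltnW y4) orbT.
have mR : 6 / e * (y ^ Q)%:R <= m%:R.
  apply: (@le_trans _ _ (y%:R * (y ^ Q)%:R)).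
    by apply: ler_wpM2r => //; apply: Y3P; move: Yy; clear; lia.
  rewrite -natrM ler_nat; apply: leq_trans yQP; rewrite expnD mulnC leq_mul2l.
  by rewrite -{2}[y]expn1 leq_exp2l // orbT.
have m0R : 1 <= e * m%:R.
  have : 6 / e * 1 <= m%:R.
    apply: le_trans mR; apply: ler_wpM2l; first by rewrite divr_ge0 // ltW.
    by rewrite ler1n.
  by rewrite mulr1 ler_pdivrMr // mulrC; lra.
pose delta := `|fresh mu b M M - c| + (2 * (1 + C) + (j * (P + 1))%:R + 2) / y%:R.
have window h : (M + size h <= m)%N ->
    `| Pr (iid (dX mu b m.+1) M) (fun w => isnew (w ++ h)) - c | <= delta.
  apply: (@window_estimate R mu q C b H b2 c c01 m.+1 m M y (j * (P + 1)) h y0) => //.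
  - apply: leq_trans (leqnSn m); apply: leq_trans yQP.
    by rewrite leq_exp2l // /Q; clear; lia.
  - exact: leqW.
have dle : delta <= e / 8.
  have f1 : `|fresh mu b M M - c| <= e / 16.
    apply: fm0; apply: (@leq_trans y); first by move: Yy; clear; lia.
    apply: (@leq_trans (y ^ Q)); last by rewrite /M; move: (y ^ Q)%N; clear; lia.
    by rewrite -{1}[y]expn1 leq_exp2l // /Q; clear; lia.
  have jR : j%:R <= e' * y%:R.
    have ey0 : 0 <= e' * y%:R by rewrite mulr_ge0 ?(ltW e'0) ?(ltW yR).
    suff : j%:R ^+ 2 <= (e' * y%:R) ^+ 2 by rewrite ler_sqr ?nnegrE.
    apply: (@le_trans _ _ (16 * y%:R)); first by rewrite expr2 -!natrM ler_nat.
    have Yy2 : (Y2 <= y)%N by move: Yy; clear; lia.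
    have := Y2P y Yy2; rewrite ler_pdivrMr ?exprn_gt0 // => Y2y.
    rewrite exprMn [y%:R ^+ 2]expr2 mulrA; apply: ler_wpM2r; first exact: ltW.
    by rewrite mulrC.
  have f2 : (2 * (1 + C) + 2) / y%:R <= e / 32.
    rewrite ler_pdivrMr //.
    have := Y1P y; rewrite /B1 ler_pdivrMr // => Y1y.
    have Yy1 : (Y1 <= y)%N by move: Yy; clear; lia.
    have := Y1y Yy1; lra.
  have f3 : (j * (P + 1))%:R / y%:R <= e / 32.
    rewrite ler_pdivrMr // natrM.
    have -> : e / 32 * y%:R = e' * y%:R * (P + 1)%:R.
      have : 0 < (P + 1)%:R :> R by rewrite ltr0n addn1.
      by rewrite /e'; move: (P + 1)%:R => u u0; field; rewrite gt_eqF.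
    exact: ler_wpM2r.
  have -> : delta = `|fresh mu b M M - c| + ((2 * (1 + C) + 2) / y%:R + (j * (P + 1))%:R / y%:R).
    by rewrite /delta; field; rewrite gt_eqF.
  lra.
have twoM : 2 * M%:R <= e * m%:R.
  have : M%:R <= 3 * (y ^ Q)%:R :> R by rewrite -natrM ler_nat.
  move: mR; rewrite mulrAC ler_pdivrMr //; lra.
have main := partial_sums_tail (dX_law H b2 m.+1) c01 (isT : (0 < M)%N) window (introT andP (conj e0 e1)) dle twoM.
apply: le_trans (le_trans _ main) _.
  apply: le_Pr_iid => [|t tm]; first exact: dX_law H b2 _.
  by apply: bad_prefix_sum.
apply: ler_wpM2l; first by rewrite mulr_ge0.
rewrite ler_expR lerN2.
have MR : 0 < M%:R :> R by rewrite ltr0n.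
have yQR : 0 < (y ^ Q)%:R :> R by rewrite ltr0n.
have -> : e ^+ 2 / 192 * (m%:R / (y ^ Q)%:R) = e ^+ 2 / 64 * (m%:R / (3 * (y ^ Q)%:R)).
  by field; rewrite gt_eqF.
apply: ler_wpM2l; first by rewrite divr_ge0 // sqr_ge0.
apply: ler_wpM2l => //; rewrite lef_pV2 ?posrE ?mulr_gt0 //.
by rewrite -natrM ler_nat.
Qed.

(** Put [z = m / y ^ Q]. Bad events cost [exp (- a z)], and for large [y] dividing by [size_law]
    costs at most a constant times [exp (a z / 2)], up to polynomial factors of order
    [m ^ 2 <= z ^ 4]. The fifth power in [expRN_le] absorbs these and leaves [1 / z <= 1 / y]. *)
Lemma cond_prob_rate eps : 0 < eps -> exists K : R, exists Y : nat,
  forall y m E, (Y <= y)%N -> (y ^ P <= m < y.+1 ^ P)%N ->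
  (forall t y', is_plane_tree t -> #|` t| = m.+1 -> is_labelling t y' -> E t y' ->
     bad_prefix m.+1 eps c (map (lab y') (Defs.dfs t))) ->
  0 <= cond_prob mu b m.+1 E <= K / y%:R.
Proof.
move=> eps0; have [a [Y0 [a0 bad]]] := bad_probability eps0.
have [c1 [p [L [r0 [c10 /andP[p0 p1] low]]]]] := sum_point_lower H mu00 mu_aperiodic k02 muk0.
pose la := - ln p.
have la0 : 0 <= la by rewrite /la oppr_ge0 ln_le0.
have pE : p = expR (- la) by rewrite /la opprK lnK.
have [Y1 Y1P] := eventually_nat_ge (4 * `|L|).
have [Y2 Y2P] := eventually_nat_ge (4 * la * `|L| / a).
exists (8 / c1 * expR (la * (1 + r0%:R)) * (10 / a) ^+ 5).
exists (Y0 + Y1 + Y2 + 4 * r0 + 4)%N => y m E Yy ymP EB.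
have y0 : (0 < y)%N by move: Yy; clear; lia.
have y2 : (2 <= y)%N by move: Yy; clear; lia.
have yR : 0 < y%:R :> R by rewrite ltr0n.
have /andP[ym1 ym2] := ymP.
have [_ PQ1 PQ2] := rate_exp_bounds q Q; rewrite -/P in PQ1 PQ2.
have Ln : 0 <= `|L| by exact: normr_ge0.
pose k := (y ^ (Q + 1))%N.
have k_gt0 : (0 < k)%N by rewrite expn_gt0 y0.
have kR : 0 < k%:R :> R by rewrite ltr0n.
have yk : (y <= k)%N by rewrite /k expnD expn1 leq_pmull // expn_gt0 y0.
have kn : (2 * k ^ (q + 2) <= m.+1)%N.
  apply: leqW; apply: leq_trans ym1; rewrite /P /rate_exp [((Q + 1) * (q + 2) + 1)%N]addn1 expnS.
  by rewrite -expnM leq_mul2r y2 orbT.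
have km : (k <= m)%N.
  by apply: leq_trans ym1; rewrite leq_exp2l.
have m1 : (1 <= m)%N by apply: leq_trans km.
have ylem : (y <= m)%N by apply: leq_trans km.
pose r := ((Num.truncn (`|L| * (m.+1%:R / k%:R))).+1 + r0)%N.
have x0 : 0 <= `|L| * (m.+1%:R / k%:R) by rewrite mulr_ge0 // divr_ge0.
have rlo : L * (m.+1%:R / k%:R) <= r%:R.
  apply: (@le_trans _ _ (`|L| * (m.+1%:R / k%:R))).
    by rewrite ler_wpM2r ?divr_ge0 // ler_norm.
  apply: ltW; apply: (lt_le_trans (truncnS_gt _)).
  by rewrite ler_nat leq_addr.
have rhi : r%:R <= `|L| * (m.+1%:R / k%:R) + 1 + r0%:R.
  rewrite /r natrD lerD2r -natr1 lerD2r.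
  by rewrite truncn_le.
have L4 : `|L| * (m.+1%:R / k%:R) <= m.+1%:R / 4.
  have : 4 * `|L| <= k%:R.
    by apply: le_trans (Y1P y _) _; [move: Yy; clear; lia | rewrite ler_nat].
  rewrite mulrA ler_pdivrMr // => kL.
  have : 0 <= m.+1%:R :> R by [].
  nra.
have rn : (2 * r <= m.+1)%N.
  rewrite -(ler_nat R) natrM.
  have : (4 * r0 + 4)%:R <= m.+1%:R :> R by rewrite ler_nat; move: Yy ylem; clear; lia.
  rewrite natrD natrM; lra.
have prl := low m.+1 m.+1 k r k_gt0 (leqnn _) (leq_addl _ _) rn kn rlo.
rewrite -size_law_sum in prl.
have mR : 0 < m.+1%:R :> R by rewrite ltr0n.
have lowpos : 0 < c1 * p ^+ r by rewrite mulr_gt0 // exprn_gt0.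
have sl : 0 < size_law mu m.
  by rewrite -(@pmulr_rgt0 _ m.+1%:R) // (lt_le_trans lowpos).
have /andP[-> cp] := cond_prob_le H b2 sl EB; rewrite /=.
apply: (le_trans cp).
have YY : (Y0 <= y)%N by move: Yy; clear; lia.
have badm := bad y m YY ymP; set pb := Pr _ _ in badm *.
have yQ0 : (0 < y ^ Q)%N by rewrite expn_gt0 y0.
have yQR : 0 < (y ^ Q)%:R :> R by rewrite ltr0n.
pose z := m%:R / (y ^ Q)%:R : R.
have zy : y%:R <= z.
  rewrite /z ler_pdivlMr // -natrM ler_nat -expnS; apply: leq_trans km.
  by rewrite /k addn1.
have z0 : 0 < z by apply: lt_le_trans zy.
have mz : m%:R <= z ^+ 2.
  rewrite /z expr_div_n ler_pdivlMr ?exprn_gt0 // [m%:R ^+ 2]expr2 ler_wpM2l //.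
  by rewrite -natrX ler_nat -expnM; apply: leq_trans ym1; rewrite leq_exp2l.
have mz1 : m.+1%:R <= 2 * z ^+ 2.
  have : 1 <= m%:R :> R by rewrite ler1n.
  by rewrite -natr1; lra.
have rz : la * r%:R <= la * (1 + r0%:R) + a / 2 * z.
  have mk : m.+1%:R / k%:R <= 2 * (z / y%:R).
    have -> : 2 * (z / y%:R) = (2 * m)%:R / k%:R.
      by rewrite /z /k expnD expn1 !natrM; field; rewrite !gt_eqF.
    by rewrite ler_wpM2r ?invr_ge0 // ler_nat mul2n -addnn -addn1 leq_add2l.
  have laL : la * `|L| * (2 * (z / y%:R)) <= a / 2 * z.
    have Yy2 : (Y2 <= y)%N by move: Yy; clear; lia.
    have := Y2P y Yy2; rewrite ler_pdivrMr // => Y2y.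
    have -> : la * `|L| * (2 * (z / y%:R)) = (4 * la * `|L|) / y%:R * (z / 2) by field; rewrite gt_eqF.
    have -> : a / 2 * z = a * (z / 2) by field.
    apply: ler_wpM2r; first by rewrite divr_ge0 ?(ltW z0).
    by rewrite ler_pdivrMr // [a * _]mulrC.
  have t1 := ler_wpM2l la0 rhi.
  have t2 := ler_wpM2l (mulr_ge0 la0 Ln) mk.
  lra.
have isl : (size_law mu m)^-1 <= m.+1%:R / c1 * expR (la * r%:R).
  have : c1 * p ^+ r / m.+1%:R <= size_law mu m by rewrite ler_pdivrMr // [size_law mu m * _]mulrC.
  have e1 : p ^+ r = expR (- (la * r%:R)) by rewrite pE -expRM_natl mulrN [la * _]mulrC.
  move=> h; have h0 : 0 < c1 * p ^+ r / m.+1%:R by rewrite divr_gt0.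
  have := h; rewrite -lef_pV2 ?posrE // => /le_trans; apply.
  rewrite invf_div invfM e1 expRN invrK.
  by rewrite le_eqVlt; apply/orP; left; apply/eqP; field; rewrite gt_eqF.
apply: (le_trans (ler_pM (Pr_ge0 _ _) _ badm isl)).
- exact: iid_law (dX_law H b2 _) _.
- by rewrite invr_ge0 ltW.
have exple : expR (- (a * z)) * expR (la * r%:R) <= expR (la * (1 + r0%:R)) * (5 / (a / 2 * z)) ^+ 5.
  apply: (@le_trans _ _ (expR (la * (1 + r0%:R)) * expR (- (a / 2 * z)))).
    rewrite -!expRD ler_expR; lra.
  rewrite ler_wpM2l ?expR_ge0 // expRN_le // mulr_gt0 // divr_gt0 //.
rewrite -/z; set X := expR (- _) in exple *; set X' := expR (la * r%:R) in exple *.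
set X'' := expR _ in exple *.
have -> : 2 * m.+1%:R * X * (m.+1%:R / c1 * X') = 2 / c1 * (m.+1%:R * m.+1%:R) * (X * X').
  by field; rewrite gt_eqF.
apply: (@le_trans _ _ (2 / c1 * ((2 * z ^+ 2) * (2 * z ^+ 2)) * (X'' * (5 / (a / 2 * z)) ^+ 5))).
  apply: ler_pM => //.
  - by rewrite !mulr_ge0 // invr_ge0 ltW.
  - by rewrite mulr_ge0 // expR_ge0.
  apply: ler_wpM2l; first by rewrite mulr_ge0 // invr_ge0 ltW.
  by apply: ler_pM.
have -> : 2 / c1 * ((2 * z ^+ 2) * (2 * z ^+ 2)) * (X'' * (5 / (a / 2 * z)) ^+ 5) =
    8 / c1 * X'' * (10 / a) ^+ 5 * z^-1.
  by field; rewrite !gt_eqF.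
apply: ler_wpM2l; last by rewrite lef_pV2 ?posrE.
apply: mulr_ge0; last by apply: exprn_ge0; rewrite divr_ge0 // ltW.
by apply: mulr_ge0; rewrite ?expR_ge0 // divr_ge0 // ltW.
Qed.

End Rate.

(** * Consequences of mean one and of a finite variance *)

Section FirstMoment.
Variables (R : realType) (mu : nat -> R).
Hypothesis prob : is_prob_nat mu.
Hypothesis mean1 : series (fun k => k%:R * mu k) @ \oo --> (1 : R).

Let mu0 k : 0 <= mu k. Proof. by case: prob => p _; apply: p. Qed.

Lemma nneg_partial_sum_le (u : nat -> R) l N : (forall k, 0 <= u k) ->
  series u @ \oo --> l -> \sum_(0 <= j < N) u j <= l.
Proof.
move=> u0 ul.
have nd : nondecreasing_seq (series u).
  apply/nondecreasing_seqP => n; rewrite /series /= big_nat_recr //= lerDl //.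
have cu : cvgn (series u) by apply/cvg_ex; exists l.
have <- : lim (series u @ \oo) = l by apply/cvg_lim.
exact: nondecreasing_cvgn_le nd cu N.
Qed.

Lemma limit_le_partial (u : nat -> R) l a N : series u @ \oo --> l ->
  (forall M, (N <= M)%N -> \sum_(0 <= j < M) u j <= a) -> l <= a.
Proof.
move=> ul H.
have cu : cvgn (series u) by apply/cvg_ex; exists l.
have <- : lim (series u @ \oo) = l by apply/cvg_lim.
apply: limr_le => //; exists N => // M /= NM; exact: H.
Qed.

Lemma prob_mass_le1 N : \sum_(0 <= j < N) mu j <= 1.
Proof. by apply: nneg_partial_sum_le => //; case: prob. Qed.

Lemma mean_partial_le1 N : \sum_(0 <= j < N) mu j * j%:R <= 1.
Proof.
under eq_bigr do rewrite [mu _ * _]mulrC.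
by apply: nneg_partial_sum_le => // k; rewrite mulr_ge0.
Qed.

Lemma cap_mean_le1 N : Ex (cap mu N) (fun j => j%:R) <= 1.
Proof.
rewrite Ex_cap.
have [N0|N0] := posnP N; first by rewrite N0 mulr0 addr0 big_geq.
have NR : 0 < N%:R :> R by rewrite ltr0n.
set c := \sum_(_ <= _ < _) _; set a := \sum_(_ <= _ < _) _.
have : 1 <= a + (1 - c) / N%:R.
  apply: (limit_le_partial (N := N) (proj2 prob)) => M NM.
  rewrite (big_cat_nat (leq0n N) NM) /= -/a lerD2l ler_pdivlMr // mulr_suml.
  rewrite lerBrDl; apply: le_trans (mean_partial_le1 M).
  rewrite (big_cat_nat (leq0n N) NM) /= lerD2l.
  by apply: ler_sum_nat => j /andP[Nj _]; rewrite ler_wpM2l // ler_nat.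
by rewrite -lerBlDl ler_pdivlMr // lerBrDl.
Qed.

Lemma offspring_of_tail q (C : R) : 0 <= C ->
  (forall k M, (0 < k)%N -> \sum_(k ^ q <= j < M) mu j * j%:R <= C / k%:R) ->
  offspring mu q C.
Proof.
move=> C0 tl; split=> //; [exact: prob_mass_le1|exact: cap_mean_le1|] => k k0.
rewrite lerBlDr; apply: (limit_le_partial (N := (k ^ q)%N) mean1) => M NM.
under eq_bigr do rewrite [_%:R * _]mulrC.
by rewrite (big_cat_nat (leq0n _) NM) /= lerD2l tl.
Qed.

(** For [j >= k] one has [j <= j ^ 2 / k], so [q = 1] works with the second moment as constant. *)
Lemma offspring_of_variance : cvgn (series (fun k => (k ^ 2)%:R * mu k)) ->
  exists q (C : R), offspring mu q C.
Proof.
move=> cv; set u := fun k => _ in cv.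
have u0 k : 0 <= u k by rewrite mulr_ge0.
exists 1%N, (lim (series u @ \oo)).
have b N : \sum_(0 <= j < N) u j <= lim (series u @ \oo) by apply: nneg_partial_sum_le.
apply: offspring_of_tail => [|k M k0]; first by apply: le_trans (b 0); rewrite big_geq.
have kR : 0 < k%:R :> R by rewrite ltr0n.
rewrite expn1 ler_pdivlMr //.
have [Mk|kM] := leqP M k; first by rewrite big_geq // mul0r; apply: le_trans (b 0); rewrite big_geq.
apply: le_trans (b M); rewrite (big_cat_nat (leq0n k) (ltnW kM)) /= mulr_suml.
apply: ler_wpDl; first by rewrite sumr_ge0.
apply: ler_sum_nat => j /andP[kj _]; rewrite /u -mulrA [_ * mu j]mulrC ler_wpM2l //.
by rewrite -natrM ler_nat -mulnn leq_mul.
Qed.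

Lemma mean_one_mu0_lt1 : mu 0 < 1.
Proof.
rewrite ltNge; apply/negP => m0.
suff : (1 : R) <= 0 by lra.
apply: (limit_le_partial (N := 0) mean1) => M _.
rewrite big1_seq // => j /andP[_]; rewrite mem_index_iota => /andP[_ jM].
have [->|j0] := posnP j; first by rewrite mul0r.
have := prob_mass_le1 M; rewrite (bigD1_seq 0%N) /= ?iota_uniq ?mem_index_iota //; last by lia.
rewrite big_mkcond (bigD1_seq j) /= ?iota_uniq ?mem_index_iota //.
rewrite -lt0n j0 => h.
have s : 0 <= \sum_(0 <= i < M | i != j) (if i != 0 then mu i else 0).
  by rewrite sumr_ge0 // => i _; case: ifP.
have mj := mu0 j.
have -> : mu j = 0 by apply/eqP; rewrite eq_le mj; move: h s m0 mj; lra.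
by rewrite mulr0.
Qed.

Lemma mean_one_atom_ge2 : 0 < mu 0 -> exists2 k, (2 <= k)%N & 0 < mu k.
Proof.
move=> m0; case: (pselect (exists2 k, (2 <= k)%N & 0 < mu k)) => // no; exfalso.
suff : (1 : R) <= 1 - mu 0 by move: m0; lra.
apply: (limit_le_partial (N := 2) mean1) => M M2.
rewrite (big_cat_nat (leq0n 2) M2) /= [X in _ + X]big_nat_cond [X in _ + X]big1 ?addr0.
  by have := prob_mass_le1 2; rewrite !big_nat_recr //= !big_geq // mul0r mul1r; lra.
move=> j /andP[/andP[j2 _] _]; have [mj|mj] := ltP 0 (mu j); first by case: no; exists j.
by have -> : mu j = 0 by [apply/eqP; rewrite eq_le mj mu0]; rewrite mulr0.
Qed.

End FirstMoment.

(** * Domains of attraction *)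

Section ConvolutionPowers.
Variables (R : realType) (mu : nat -> R).

Lemma convpow_Pr N n k : (k < N)%N ->
  convpow mu n k = Pr (iid (cap mu N) n) (fun s => sumn s == k).
Proof.
elim: n k => [|n IH] k kN; first by rewrite /Pr Ex_iid0 /= eq_sym; case: eqP.
rewrite /Pr Ex_iidS Ex_cap [X in _ * X](_ : _ = 0) ?mulr0 ?addr0; last first.
  rewrite -[RHS](Ex0 (iid (cap mu N) n)); apply: eq_Ex => s /=.
  by case: eqP => // e; move: kN; rewrite -e; lia.
rewrite (big_cat_nat (leq0n k.+1) kN) /= [X in _ + X]big_nat_cond [X in _ + X]big1 ?addr0; last first.
  move=> j /andP[/andP[kj _] _]; rewrite [X in _ * X](_ : _ = 0) ?mulr0 //.
  rewrite -[RHS](Ex0 (iid (cap mu N) n)); apply: eq_Ex => s /=.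
  by case: eqP => // e; move: kj; rewrite -e; lia.
rewrite -(big_mkord xpredT (fun j => convpow mu n j * mu (k - j)%N)) big_nat_rev /=.
apply: eq_big_nat => j /andP[_ jk]; rewrite add0n subSS subKn; last by lia.
rewrite mulrC IH; last by lia.
by congr (_ * _); apply: eq_Ex => s; congr (nat_of_bool _)%:R; lia.
Qed.

Lemma convpow_cdf_Pr N n x : x < N%:R ->
  convpow_cdf mu n x = Pr (iid (cap mu N) n) (fun s => (sumn s)%:R <= x).
Proof.
move=> xN; rewrite /convpow_cdf.
have tN : (0 < N)%N -> (Num.truncn x < N)%N.
  by case: N xN => // N xN _; rewrite ltnS truncn_le_nat.
rewrite (eq_bigr (fun k : 'I__ => Ex (iid (cap mu N) n) (fun s => (sumn s == k)%:R))); last first.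
  move=> k kx; apply: convpow_Pr.
  have k1 : (k <= Num.truncn x)%N by rewrite -ltnS.
  by apply: leq_ltn_trans k1 (tN _); rewrite -(ltr_nat R) (le_lt_trans _ xN) // (le_trans _ kx).
rewrite -Ex_sum; apply: eq_Ex => s.
have [sx|xs] := leP ((sumn s)%:R : R) x; last first.
  by rewrite big1 // => k kx; case: eqP => // e; move: xs; rewrite e ltNge kx.
have st : (sumn s < (Num.truncn x).+1)%N by rewrite ltnS truncn_ge_nat // (le_trans _ sx).
rewrite (bigD1 (Ordinal st)) //= eqxx big1 ?addr0 // => k /andP[_ ke].
by case: eqP => // e; case/eqP: ke; apply/val_inj.
Qed.

End ConvolutionPowers.

Section Strips.
Variable R : realType.

(* Riemann sums for the distribution function at [y] of the sum of two
   independent variables with distribution function [Phi], along the grid [v]. *)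
Definition lower_sum (Phi : R -> R) (v : nat -> R) m y :=
  \sum_(i < m) (Phi (v i.+1) - Phi (v i)) * Phi (y - v i.+1).
Definition upper_sum (Phi : R -> R) (v : nat -> R) m y :=
  \sum_(i < m) (Phi (v i.+1) - Phi (v i)) * Phi (y - v i).

(* [K u u'] stands for P(u < Z <= u', Z + Z' <= y) and [T] for P(Z + Z' <= y). *)
Lemma strip_bounds (Phi : R -> R) (T y : R) (K : R -> R -> R) (v : nat -> R) m :
  (forall i, v i <= v i.+1) ->
  (forall u u' u'', u <= u' -> u' <= u'' -> K u u'' = K u u' + K u' u'') ->
  (forall u u', u <= u' ->
     (Phi u' - Phi u) * Phi (y - u') <= K u u' <= (Phi u' - Phi u) * Phi (y - u)) ->
  (forall u u', u <= u' -> K u u' <= T <= K u u' + Phi u + 1 - Phi u') ->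
  lower_sum Phi v m y <= T <= upper_sum Phi v m y + Phi (v 0%N) + 1 - Phi (v m).
Proof.
move=> vS KD Kb TK.
have v0 k : v 0%N <= v k by elim: k => // k IH; apply: le_trans (vS k).
have : lower_sum Phi v m y <= K (v 0%N) (v m) <= upper_sum Phi v m y.
  elim: m => [|m /andP[l u]].
    rewrite /lower_sum /upper_sum !big_ord0.
    by have := KD (v 0%N) (v 0%N) (v 0%N) (lexx _) (lexx _); lra.
  rewrite (KD _ _ _ (v0 m) (vS m)) /lower_sum /upper_sum !big_ord_recr /=.
  by have /andP[a b] := Kb _ _ (vS m); rewrite !lerD.
by have /andP[a b] := TK _ _ (v0 m); lra.
Qed.

Lemma finite_law_strip_bounds (X : Type) (d : seq (R * X)) (f : X -> R) y v m
    (Phi := fun z => Pr d (fun x => f x <= z)) (T := Ex d (fun x => Phi (y - f x))) :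
  is_law d -> (forall i, v i <= v i.+1) ->
  lower_sum Phi v m y <= T <= upper_sum Phi v m y + Phi (v 0%N) + 1 - Phi (v m).
Proof.
move=> dl vS.
have Phi1 z : 0 <= Phi z <= 1 by rewrite Pr_ge0 // Pr_le1.
have Phim z z' : z <= z' -> Phi z <= Phi z'.
  by move=> zz; apply: le_Pr => // x h; apply: le_trans h zz.
have PhiB u u' : u <= u' -> Phi u' - Phi u = Pr d (fun x => u < f x <= u').
  move=> uu; rewrite /Phi /Pr -ExB; apply: eq_Ex => x; rewrite ltNge.
  by case: (leP (f x) u) => h; rewrite ?(le_trans h uu) ?subrr ?subr0.
apply: (@strip_bounds Phi T y (fun u u' => Ex d (fun x => (u < f x <= u')%R%:R * Phi (y - f x))) v m) => //.
- move=> u u' u'' h h'; rewrite -ExD; apply: eq_Ex => x; rewrite -mulrDl; congr (_ * _).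
  rewrite !(ltNge _ (f x)); case: (leP (f x) u') => a; case: (leP (f x) u) => b /=; rewrite ?addr0 ?add0r //.
  + by rewrite (le_trans a h').
  + by move: (lt_le_trans a (le_trans b h)); rewrite ltxx.
- move=> u u' uu; rewrite PhiB // /Pr -!ExZr.
  apply/andP; split; apply: le_Ex => // x;
  case: (boolP (u < f x <= u')) => [/andP[/ltW a b]|_]; rewrite ?mul0r // !mul1r;
  apply: Phim; lra.
- move=> u u' uu.
  have -> : Ex d (fun x => (u < f x <= u')%R%:R * Phi (y - f x)) + Phi u + 1 - Phi u' =
      Ex d (fun x => (u < f x <= u')%R%:R * Phi (y - f x) + (f x <= u)%R%:R + 1 - (f x <= u')%R%:R).
    by rewrite ExB !ExD (Ex_cst dl).
  apply/andP; split; apply: le_Ex => // x; have /andP[a b] := Phi1 (y - f x).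
    by case: (_ && _); rewrite ?mul1r ?mul0r.
  rewrite ltNge; case: (leP (f x) u) => h; case: (leP (f x) u') => h' /=; rewrite ?mul1r ?mul0r; lra.
Qed.

End Strips.

Section LargestSummand.
Variables (R : realType) (d : seq (R * nat)).
Hypotheses (dlaw : is_law d) (mean : Ex d (fun j => j%:R) <= 1).

Lemma Pr_iid_all_take (X : Type) (e : seq (R * X)) (P : X -> bool) m r : is_law e ->
  Pr (iid e (m + r)) (fun s => all P (take m s)) = Pr e P ^+ m.
Proof.
move=> el; rewrite /Pr Ex_iidD.
transitivity (Ex (iid e m) (fun s => (all P s)%:R)).
  apply: eq_Ex_iid => s ss; rewrite -[RHS](Ex_cst (iid_law el r)).
  by apply: eq_Ex => t; rewrite take_size_cat.
elim: m => [|m IH]; first by rewrite Ex_iid0.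
rewrite Ex_iidS exprS -IH -ExZr; apply: eq_Ex => x; rewrite -ExZ; apply: eq_Ex => s /=.
by case: (P x); rewrite ?mul1r ?mul0r.
Qed.

Lemma Pr_large_summand K (x : R) n i : (i < n.+1)%N ->
  Pr (iid d n.+1) (fun s => (K < nth 0%N s i)%N && ((sumn s)%:R - (nth 0%N s i)%:R <= x)%R)
  = Pr d (fun j => (K < j)%N) * Pr (iid d n) (fun s => (sumn s)%:R <= x).
Proof.
move=> i_n; have nE : (n.+1 = (n.+1 - i) + i)%N by rewrite subnK // ltnW.
pose F (s : seq nat) : R := ((K < head 0%N s)%N && ((sumn s)%:R - (head 0%N s)%:R <= x)%R)%:R.
transitivity (Ex (iid d n.+1) F).
  rewrite {2}nE -Ex_iid_rot addnC -nE; apply: eq_Ex_iid => s ss; rewrite /F.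
  have -> : sumn (rot i s) = sumn s by rewrite !sumnE; apply: perm_big; rewrite perm_rot.
  by rewrite -nth0 /rot nth_cat size_drop ss subn_gt0 i_n nth_drop addn0.
rewrite Ex_iidS /Pr -ExZr; apply: eq_Ex => j; rewrite -ExZ; apply: eq_Ex => s /=.
by rewrite /F /= natrD addrC addrA addNr add0r; case: (K < j)%N; rewrite ?mul1r ?mul0r.
Qed.

(* If n P(xi > K) > 1, one of about 1 / P(xi > K) summands exceeds K with
   probability at least 1/2; the remaining sum is then atypically small unless
   the whole sum is atypically large. *)
Lemma largest_summand_tail n K (lo hi : R) : hi - K%:R <= lo - 2 ->
  Pr (iid d n) (fun s => hi < (sumn s)%:R) <= 11^-1 ->
  Pr (iid d n) (fun s => (sumn s)%:R <= lo) <= 11^-1 ->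
  n%:R * Pr d (fun j => (K < j)%N) <= 1.
Proof.
move=> Klh up dn; set p := Pr d _; rewrite leNgt; apply/negP => np.
have n0 : (0 < n)%N by case: n np {up dn} => //; rewrite mul0r ltNge ler01.
have nR : 0 < n%:R :> R by rewrite ltr0n.
have p1 : p <= 1 by apply: Pr_le1.
have p0 : 0 < p by rewrite -(pmulr_rgt0 _ nR); lra.
have pV : 0 <= p^-1 by rewrite invr_ge0 ltW.
(* So that [1 < m p <= 2]: one of [m] summands exceeds [K] with probability at least 1/2, as
   [(1 - p) ^ m <= 1 / (1 + m p)]. *)
pose m := (Num.truncn p^-1).+1.
have mp : 1 < m%:R * p by rewrite -ltr_pdivrMr // mul1r truncnS_gt.
have mp2 : m%:R * p <= 2.
  have : (Num.truncn p^-1)%:R * p <= 1 by rewrite -ler_pdivlMr // mul1r truncn_le.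
  by rewrite /m -[_.+1%:R]natr1 mulrDl mul1r; lra.
have mn : (m <= n)%N by rewrite /m truncn_lt_nat // -[p^-1]mul1r ltr_pdivrMr.
have law n' := iid_law dlaw n'.
have A : 2^-1 <= Pr (iid d n) (fun s => has (fun j => K < j)%N (take m s)).
  have -> : Pr (iid d n) (fun s => has (fun j => K < j)%N (take m s)) = 1 - (1 - p) ^+ m.
    rewrite -PrC // -(Pr_iid_all_take _ m (n - m)) // subnKC // -PrC //.
    by apply: eq_Ex => s; rewrite (all_predC (fun j => K < j)%N) negbK.
  have q0 : 0 <= 1 - p by lra.
  have b : (1 - p) ^+ m * (1 + m%:R * p) <= 1.
    elim: (m) => [|k IH]; first by rewrite expr0 mul0r addr0 mulr1.
    apply: le_trans IH; rewrite exprSr -mulrA; apply: ler_wpM2l; first exact: exprn_ge0.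
    by rewrite -[k.+1%:R]natr1; have k0 : 0 <= k%:R :> R by []; nra.
  have e0 : 0 <= (1 - p) ^+ m by apply: exprn_ge0.
  nra.
case: n n0 {np nR} mn up dn A => // n _ mn up dn A.
(* One more summand is below 2 with probability at least 1/2, the mean being at most 1, so
   [Q <= 2 / 11]. The contradiction is [1/2 <= 1/11 + 2 * (2/11) = 5/11]. *)
pose Q := Pr (iid d n) (fun s => (sumn s)%:R <= lo - 2).
have Q0 : 0 <= Q by apply: Pr_ge0.
have Q2 : Q <= 2 * 11^-1.
  suff : 2^-1 * Q <= Pr (iid d n.+1) (fun s => (sumn s)%:R <= lo) by lra.
  have h : 2^-1 <= Pr d (fun j => ~~ (2 <= j%:R :> R)).
    rewrite PrC //.
    rewrite lerBrDr -lerBrDl (_ : 1 - 2^-1 = 2^-1); last by lra.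
    apply: le_trans (markov dlaw (ltr0Sn R 1) (fun j => ler0n R j)) _.
    by rewrite ler_pdivrMr // mulVf.
  apply: le_trans (ler_wpM2r Q0 h) _.
  rewrite /Pr -ExZr Ex_iidS; apply: le_Ex => // j; rewrite -ExZ; apply: le_Ex => // s /=.
  case: (leP 2 (j%:R : R)) => j2 /=; first by rewrite mul0r.
  rewrite mul1r; case: (leP _ (lo - 2)) => // sl.
  by rewrite (_ : (_ <= lo) = true) // natrD; lra.
have : Pr (iid d n.+1) (fun s => has (fun j => K < j)%N (take m s)) <=
    Pr (iid d n.+1) (fun s => hi < (sumn s)%:R) + m%:R * (p * Q).
  have -> : m%:R * (p * Q) = \sum_(i < m) Pr (iid d n.+1) (fun s =>
      (K < nth 0%N s i)%N && ((sumn s)%:R - (nth 0%N s i)%:R <= lo - 2)%R).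
    rewrite (eq_bigr (fun=> p * Q)) ?sumr_const ?card_ord ?mulr_natl // => i _.
    by rewrite Pr_large_summand // (leq_trans (ltn_ord i)).
  rewrite -Ex_sum -ExD; apply: le_Ex_iid => // s ss.
  case: hasP => [[j js Kj]|_]; last by rewrite addr_ge0 // sumr_ge0.
  have [sh|sh] := ltP hi; first by rewrite lerDl sumr_ge0.
  have ti : (index j (take m s) < m)%N.
    by have := js; rewrite -index_mem size_take_min => /leq_trans; apply; apply: geq_minl.
  rewrite add0r (bigD1 (Ordinal ti)) //= -(nth_take 0%N ti) nth_index // Kj /=.
  have KR : (K%:R <= j%:R :> R) by rewrite ler_nat ltnW.
  rewrite (_ : (_ <= lo - 2) = true); last by lra.
  by rewrite lerDl sumr_ge0.
have : m%:R * (p * Q) <= 2 * (2 * 11^-1).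
  by rewrite mulrA; apply: ler_pM => //; apply: mulr_ge0 => //; rewrite ltW.
lra.
Qed.

End LargestSummand.

(** * Distribution functions and the sum of two independent copies *)

Section RealLaw.
Variables (R : realType) (nu : probability R R).
Let F := cdfR nu.

Lemma cdfR_nondecreasing x y : x <= y -> F x <= F y.
Proof.
by move=> xy; rewrite /F /cdfR fine_le ?fin_num_measure// le_measure ?inE//; exact: subitvPr.
Qed.

Lemma cdfR_ge0 x : 0 <= F x. Proof. exact: fine_ge0. Qed.

Lemma cdfR_le1 x : F x <= 1.
Proof. by rewrite -lee_fin fineK ?probability_le1 // fin_num_measure. Qed.

Lemma cdfR_pinfty e : 0 < e -> exists A, forall x, A <= x -> 1 - e < F x.
Proof.
move=> e0.
have cv : (fun n : nat => F n%:R) @ \oo --> (1 : R).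
  have : (nu \o (fun n : nat => `]-oo, n%:R]%classic)) @ \oo --> nu (\bigcup_n `]-oo, (n%:R : R)]%classic).
    apply: nondecreasing_cvg_mu => //; first exact: bigcup_measurable.
    move=> m n mn; apply/subsetPset; apply: subset_itvl => /=. by rewrite bnd_simp ler_nat.
  rewrite (_ : \bigcup_n _ = setT); last first.
    apply/seteqP; split=> // x _; exists (Num.truncn x).+1 => //=.
    by rewrite in_itv /= ltW // truncnS_gt.
  rewrite probability_setT => /fine_cvgP[_]; exact.
move/cvgrPdist_lt : cv => /(_ _ e0)[N _ h]; exists N%:R => x Nx.
apply: lt_le_trans (cdfR_nondecreasing Nx).
by have := h N (leqnn N); rewrite ltr_norml => /andP[_]; lra.
Qed.

Lemma cdfR_ninfty e : 0 < e -> exists A, forall x, x <= - A -> F x < e.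
Proof.
move=> e0.
have cv : (fun n : nat => F (- n%:R)) @ \oo --> (0 : R).
  have : (nu \o (fun n : nat => `]-oo, - n%:R]%classic)) @ \oo --> nu (\bigcap_n `]-oo, - (n%:R : R)]%classic).
    apply: nonincreasing_cvg_mu => //.
    - by rewrite ltey_eq fin_num_measure.
    - by apply: bigcap_measurableType.
    - move=> m n mn; apply/subsetPset; apply: subset_itvl => /=. by rewrite bnd_simp lerN2 ler_nat.
  rewrite (_ : \bigcap_n _ = set0); last first.
    apply/seteqP; split=> // x /(_ (Num.truncn (- x)).+1 I) /=.
    by rewrite in_itv /= lerNr leNgt truncnS_gt.
  rewrite measure0 => /fine_cvgP[_]; exact.
move/cvgrPdist_lt : cv => /(_ _ e0)[N _ h]; exists N%:R => x Nx.
apply: le_lt_trans (cdfR_nondecreasing Nx) _.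
by have := h N (leqnn N); rewrite sub0r normrN ltr_norml => /andP[].
Qed.

Let P A := fine (product_measure1 nu nu A).

Lemma product_fin (A : set (R * R)) : measurable A -> product_measure1 nu nu A \is a fin_num.
Proof.
move=> mA; rewrite ge0_fin_numE //; apply: (@le_lt_trans _ _ 1%E); last exact: ltry.
apply: (@le_trans _ _ (product_measure1 nu nu setT)); first by rewrite le_measure ?inE.
rewrite -setXTT product_measure1E //. have nT : nu setT = 1%E by exact: probability_setT.
by rewrite [X in (X * X)%E]nT mule1.
Qed.

Lemma product_mono (A B : set (R * R)) : measurable A -> measurable B -> A `<=` B -> P A <= P B.
Proof.
by move=> mA mB AB; apply: fine_le; rewrite ?product_fin // le_measure ?inE.
Qed.

Lemma product_setU (A B : set (R * R)) : measurable A -> measurable B ->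
  A `&` B = set0 -> P (A `|` B) = P A + P B.
Proof. by move=> mA mB AB; rewrite /P measureU // fineD // product_fin. Qed.

Lemma product_setU_le (A B : set (R * R)) : measurable A -> measurable B -> P (A `|` B) <= P A + P B.
Proof.
move=> mA mB; rewrite /P -fineD ?product_fin //; apply: fine_le.
- by apply: product_fin; apply: measurableU.
- by rewrite fin_numD !product_fin.
- exact: measureU2.
Qed.

Lemma product_setX (A B : set R) : measurable A -> measurable B ->
  P (A `*` B) = fine (nu A) * fine (nu B).
Proof. by move=> mA mB; rewrite /P product_measure1E // fineM // fin_num_measure. Qed.

Lemma fine_itv_oc u u' : u <= u' -> fine (nu `]u, u']%classic) = F u' - F u.
Proof.
move=> uu; rewrite /F /cdfR.
have -> : `]-oo, u']%classic = `]-oo, u]%classic `|` `]u, u']%classic.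
  by rewrite -itv_bndbnd_setU.
rewrite measureU ?fineD ?fin_num_measure //; first by ring.
apply/seteqP; split => // x [] /=; rewrite !in_itv /= => a /andP[b _].
by move: (lt_le_trans b a); rewrite ltxx.
Qed.

Lemma fine_itv_gt u : fine (nu `]u, +oo[%classic) = 1 - F u.
Proof.
have -> : `]u, +oo[%classic = ~` `]-oo, u]%classic by rewrite setCitvl.
rewrite probability_setC // fineB ?fin_num_measure //.
Qed.

Lemma measurable_sum_le (y : R) : measurable [set p : R * R | p.1 + p.2 <= y].
Proof.
have : measurable_fun setT (fun p : R * R => p.1 + p.2) by apply: measurable_realfun.measurable_funD.
move=> /(_ measurableT `]-oo, y]%classic (measurable_itv _)); rewrite setTI.
by rewrite (_ : _ @^-1` _ = [set p : R * R | p.1 + p.2 <= y]).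
Qed.

Lemma product_law_strip_bounds y v m : (forall i, v i <= v i.+1) ->
  lower_sum F v m y <= P [set p : R * R | p.1 + p.2 <= y]
  <= upper_sum F v m y + F (v 0%N) + 1 - F (v m).
Proof.
move=> vS; set S := [set p | _].
have mS : measurable S by apply: measurable_sum_le.
pose H u u' : set (R * R) := (`]u, u']%classic `*` setT) `&` S.
have mH u u' : measurable (H u u') by apply: measurableI => //; apply: measurableX.
apply: (@strip_bounds R F _ y (fun u u' => P (H u u'))) => //.
- move=> u u' u'' h h'; rewrite -product_setU //; last first.
    apply/seteqP; split => // p [] [[/= a _] _] [[/= b _] _].
    by move: a b; rewrite !in_itv /= => /andP[_ a] /andP[b _]; move: (lt_le_trans b a); rewrite ltxx.
  congr P; apply/seteqP; split=> -[p1 p2]; rewrite /H /= !in_itv /=.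
    move=> [[/andP[a b] _] c]; have [d|d] := leP p1 u'.
      by left; split=> //; split=> //; rewrite a.
    by right; split=> //; split=> //; rewrite b.
  move=> [] [[/andP[a b] _] c]; split=> //; split=> //; apply/andP; split=> //; lra.
- move=> u u' uu; rewrite -fine_itv_oc // /F /cdfR -!product_setX //.
  apply/andP; split; apply: product_mono => //; try exact: measurableX.
    move=> [p1 p2] [/= ]; rewrite !in_itv /= => /andP[a b] c; split; rewrite /S /= ?in_itv /= ?a ?b //.
    lra.
  move=> [p1 p2] [[/= a _]]; rewrite /S /= => c; split => //=; move: a c; rewrite !in_itv /= => /andP[a b] c.
  lra.
- move=> u u' uu; apply/andP; split; first by apply: product_mono => // p [].
  have e1 : F u = P (`]-oo, u]%classic `*` setT) by rewrite product_setX // probability_setT mulr1.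
  have e2 : 1 - F u' = P (`]u', +oo[%classic `*` setT).
    by rewrite product_setX // probability_setT mulr1 fine_itv_gt.
  rewrite -addrA e2 {1}e1.
  have m1 : measurable (`]-oo, u]%classic `*` [set: R]) by apply: measurableX.
  have m2 : measurable (`]u', +oo[%classic `*` [set: R]) by apply: measurableX.
  apply: le_trans (lerD (product_setU_le (mH _ _) m1) (lexx _)).
  apply: le_trans (product_setU_le (measurableU _ _ (mH _ _) m1) m2).
  apply: product_mono => //; first by do 2?[apply: measurableU => //].
  move=> [p1 p2] Sp; have [a|a] := leP p1 u; first by left; right; split => //=; rewrite in_itv.
  have [b|b] := leP p1 u'; last by right; split => //=; rewrite in_itv /= b.
  by left; left; split=> //; split => //=; rewrite in_itv /= a b.
Qed.

End RealLaw.

(** * Continuity points of monotone functions *)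

Section MonotoneFunctions.
Variable R : realType.
Implicit Types (f : R -> R) (x : R).

(** Continuity of a monotone function, in a form that passes from a sum to its terms. *)
Definition small_jump f x := forall e, 0 < e -> exists2 h, 0 < h & f (x + h) - f (x - h) < e.

Lemma small_jump_continuous f x : {homo f : u v / u <= v} -> small_jump f x ->
  {for x, continuous f}.
Proof.
move=> fm jx; apply/cvgrPdist_lt => e e0; have [h h0 fh] := jx e e0.
near=> z.
have : `|x - z| < h by near: z; apply/nbhs_ballP; exists h.
rewrite ltr_norml => /andP[a b].
have c : f (x - h) <= f z <= f (x + h) by rewrite !fm //; lra.
have d : f (x - h) <= f x <= f (x + h) by rewrite !fm //; lra.
by rewrite ltr_norml; apply/andP; split; lra.
Unshelve. all: end_near. Qed.

(** The discontinuities are countable, hence null, whereas the interval has positive Lebesgue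
    measure. *)
Lemma exists_small_jump f a b : {homo f : u v / u <= v} -> a < b ->
  exists2 x, a < x < b & small_jump f x.
Proof.
move=> fm ab.
have ndf : {in `[a, b] &, nondecreasing_fun f} by move=> u v _ _ /fm.
have [x [xab nd]] : exists x, (x \in `]a, b[) /\ ~ discontinuity f x.
  have := discontinuity_countable ndf => /countable_lebesgue_measure0 m0.
  apply: contrapT => no; have : lebesgue_measure `]a, b[%classic = 0%E :> \bar R.
    rewrite -[RHS]m0; congr lebesgue_measure; apply/seteqP; split=> x /= xab //.
      by split=> //; apply: contrapT => nd; apply: no; exists x.
    by case: xab.
  rewrite lebesgue_measure_itv /= lte_fin ab => /eqP; rewrite -EFinB eqe subr_eq0 => /eqP ba.
  by move: ab; rewrite ba ltxx.
rewrite in_itv /= in xab; exists x => // e e0.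
have cl : cvg (f z @[z --> x^'-]).
  apply: nondecreasing_at_left_is_cvgr; near=> z; first by move=> u v _ _ /fm.
  by exists (f x) => _ [u /= + <-]; rewrite in_itv /= => /andP[_ /ltW /fm].
have cr : cvg (f z @[z --> x^'+]).
  apply: nondecreasing_at_right_is_cvgr; near=> z; first by move=> u v _ _ /fm.
  by exists (f x) => _ [u /= + <-]; rewrite in_itv /= => /andP[/ltW /fm].
have lr : lim (f z @[z --> x^'-]) = lim (f z @[z --> x^'+]).
  by apply: contrapT => /eqP ne; apply: nd.
have e2 : 0 < e / 2 by rewrite divr_gt0.
set l := lim _ in lr.
have [u ux fu] : exists2 u, u < x & l - f u < e / 2.
  near x^'- => u; exists u; first by near: u; exact: nbhs_left_lt.
  suff : `|l - f u| < e / 2 by rewrite ltr_norml => /andP[].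
  by near: u; move/cvgrPdist_lt : cl; apply.
have [v xv fv] : exists2 v, x < v & f v - l < e / 2.
  near x^'+ => v; exists v; first by near: v; exact: nbhs_right_gt.
  suff : `|l - f v| < e / 2 by rewrite ltr_norml => /andP[]; lra.
  by near: v; rewrite lr; move/cvgrPdist_lt : cr; apply.
exists (Num.min (x - u) (v - x)); first by rewrite lt_min !subr_gt0 ux.
have fu' : f u <= f (x - Num.min (x - u) (v - x)).
  by apply: fm; rewrite lerBrDr -lerBrDl ge_min lexx.
have fv' : f (x + Num.min (x - u) (v - x)) <= f v.
  by apply: fm; rewrite -lerBrDl ge_min lexx orbT.
lra.
Unshelve. all: end_near. Qed.

Lemma small_jump_sum n (g : 'I_n -> R -> R) x : (forall i, {homo g i : u v / u <= v}) ->
  small_jump (fun u => \sum_i g i u) x -> forall i, small_jump (g i) x.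
Proof.
move=> gm jx i e e0; have [h h0 gh] := jx e e0; exists h => //; apply: le_lt_trans gh.
rewrite -sumrB (bigD1 i) //= lerDl sumr_ge0 // => j _.
by rewrite subr_ge0 gm //; lra.
Qed.

(** After negating the reflected ones, all these functions are nondecreasing in the starting point,
    so one point without jump of their sum serves them all. *)
Lemma continuity_grid f y dl m a b : {homo f : u v / u <= v} -> a < b ->
  exists2 v0, a < v0 < b & forall i, (i <= m)%N ->
    {for v0 + dl * i%:R, continuous f} /\ {for y - (v0 + dl * i%:R), continuous f}.
Proof.
move=> fm ab.
pose g1 (i : 'I_m.+1) u := f (u + dl * i%:R).
pose g2 (i : 'I_m.+1) u := - f (y - (u + dl * i%:R)).
have m1 i : {homo g1 i : u v / u <= v} by move=> u v uv; apply: fm; lra.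
have m2 i : {homo g2 i : u v / u <= v} by move=> u v uv; rewrite lerN2; apply: fm; lra.
have m12 i : {homo (fun u => g1 i u + g2 i u) : u v / u <= v}.
  by move=> u v uv; apply: lerD; [apply: m1|apply: m2].
have [|v0 v0ab jv] := @exists_small_jump (fun u => \sum_i (g1 i u + g2 i u)) a b _ ab.
  by move=> u v uv; apply: ler_sum => i _; apply: m12.
exists v0 => // i im.
have J := small_jump_sum m12 jv (Ordinal (im : (i < m.+1)%N)).
split; apply: small_jump_continuous => // e e0; have [h h0 jh] := J e e0; exists h => //;
  apply: le_lt_trans jh; rewrite /g1 /g2 /=.
  have := m2 (Ordinal (im : (i < m.+1)%N)) (v0 - h) (v0 + h); rewrite /g2 /=.
  have -> : v0 + dl * i%:R + h = v0 + h + dl * i%:R by ring.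
  have -> : v0 + dl * i%:R - h = v0 - h + dl * i%:R by ring.
  by move=> /(_ ltac:(lra)); lra.
have := m1 (Ordinal (im : (i < m.+1)%N)) (v0 - h) (v0 + h); rewrite /g1 /=.
have -> : y - (v0 + dl * i%:R) + h = y - (v0 - h + dl * i%:R) by ring.
have -> : y - (v0 + dl * i%:R) - h = y - (v0 + h + dl * i%:R) by ring.
by move=> /(_ ltac:(lra)); lra.
Qed.

End MonotoneFunctions.

Lemma prob_cap_law (R : realType) (mu : nat -> R) N : is_prob_nat mu -> is_law (cap mu N).
Proof.
move=> prob; split; last by rewrite Ex_cap !mulr1; under eq_bigr do rewrite mulr1; rewrite subrKC.
rewrite /cap all_rcons /= subr_ge0 (prob_mass_le1 prob) all_map /=.
by apply/allP => j _ /=; case: prob.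
Qed.

(** * Limit of the doubled normalised sums *)

Section NormalizedSums.
Variables (R : realType) (mu : nat -> R).
Hypothesis prob : is_prob_nat mu.

Lemma convpow_cdf_mono n : {homo convpow_cdf mu n : x y / x <= y}.
Proof.
move=> x y xy; pose N := (Num.truncn y).+1.
have yN : y < N%:R by apply: truncnS_gt.
rewrite !(convpow_cdf_Pr mu (N := N)) //; last exact: le_lt_trans yN.
apply: le_Pr => [|s sx]; last exact: le_trans xy.
exact/iid_law/prob_cap_law.
Qed.

Lemma convpow_cdf_strip_bounds n a b y v m : 0 < a -> (forall i, v i <= v i.+1) ->
  let Phi z := convpow_cdf mu n (b + a * z) in
  is_true (lower_sum Phi v m y <= convpow_cdf mu (n + n) (b + b + a * y)
  <= upper_sum Phi v m y + Phi (v 0%N) + 1 - Phi (v m)).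
Proof.
move=> a0 vS Phi.
(* Dominates every threshold below, so that one cap [N] computes all the distribution functions
   involved. *)
pose X := `|b + b + a * y| + \sum_(i < m.+1) (`|b + a * v i| + `|b + a * (y - v i)|).
pose N := (Num.truncn X).+1.
have XN : X < N%:R by apply: truncnS_gt.
have Xi i : (i <= m)%N -> b + a * v i < N%:R /\ b + a * (y - v i) < N%:R.
  move=> im; have h : `|b + a * v i| + `|b + a * (y - v i)| <= X.
    rewrite /X (bigD1 (Ordinal (im : (i < m.+1)%N))) //= addrCA lerDl.
    by apply: addr_ge0 => //; apply: sumr_ge0 => j _; apply: addr_ge0.
  have := ler_norm (b + a * v i); have := ler_norm (b + a * (y - v i)).
  have := normr_ge0 (b + a * v i); have := normr_ge0 (b + a * (y - v i)).
  by split; lra.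
have XT : b + b + a * y < N%:R.
  apply: le_lt_trans XN; apply: le_trans (ler_norm _) _.
  by rewrite lerDl; apply: sumr_ge0 => i _; apply: addr_ge0.
have law := iid_law (prob_cap_law N prob) n.
pose f (s : seq nat) : R := ((sumn s)%:R - b) / a.
have PhiE z : b + a * z < N%:R -> Phi z = Pr (iid (cap mu N) n) (fun s => f s <= z).
  move=> h; rewrite /Phi (convpow_cdf_Pr mu n h); apply: eq_Ex => s; congr (nat_of_bool _)%:R.
  by rewrite /f ler_pdivrMr // lerBlDl [a * z]mulrC.
have := finite_law_strip_bounds f y m law vS.
have -> : Ex (iid (cap mu N) n) (fun x => Pr (iid (cap mu N) n) (fun x0 => f x0 <= y - f x)) =
    convpow_cdf mu (n + n) (b + b + a * y).
  rewrite (convpow_cdf_Pr mu _ XT) /Pr Ex_iidD; apply: eq_Ex => s; apply: eq_Ex => t.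
  congr (nat_of_bool _)%:R; rewrite /f sumn_cat natrD lerBrDr -mulrDl ler_pdivrMr //.
  by rewrite [y * a]mulrC; apply/idP/idP; lra.
rewrite -!PhiE ?(Xi _ _).1 //.
have -> : lower_sum (fun z => Pr (iid (cap mu N) n) (fun s => f s <= z)) v m y = lower_sum Phi v m y.
  by apply: eq_bigr => i _; rewrite !PhiE ?(Xi _ _).1 ?(Xi _ _).2 // ltnW.
have -> // : upper_sum (fun z => Pr (iid (cap mu N) n) (fun s => f s <= z)) v m y = upper_sum Phi v m y.
by apply: eq_bigr => i _; rewrite !PhiE ?(Xi _ _).1 ?(Xi _ _).2 // ltnW.
Qed.

Variables (nu : probability R R) (an bn : nat -> R).
Hypothesis an0 : forall n, 0 < an n.
Hypothesis conv : forall x : R, {for x, continuous (cdfR nu)} ->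
  (fun n => convpow_cdf mu n (bn n + an n * x)) @ \oo --> cdfR nu x.

Local Notation F := (cdfR nu).
Let P y := fine (product_measure1 nu nu [set p : R * R | p.1 + p.2 <= y]).
Let Fn n z := convpow_cdf mu n (bn n + an n * z).

(** On a grid of step [dl] the lower sum at [y] is the upper sum at [y - dl], and the upper sum at
    [y] is the lower sum at [y + dl]: the discretisation error becomes a shift of [y]. Finitely many
    continuity points then suffice to pass to the limit. *)
Lemma doubled_sum_limit y dl eta : 0 < dl -> 0 < eta ->
  \forall n \near \oo,
    P (y - dl) - eta <= convpow_cdf mu (n + n) (bn n + bn n + an n * y) <= P (y + dl) + eta.
Proof.
move=> dl0 eta0; pose e := eta / 8; have e0 : 0 < e by rewrite divr_gt0.
have [A1 hA1] := cdfR_pinfty nu e0; have [A2 hA2] := cdfR_ninfty nu e0.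
have Fm := cdfR_nondecreasing nu.
have ab : - A2 - 1 < - A2 by lra.
pose m := (Num.truncn ((A1 - (- A2 - 1)) / dl)).+1.
have [w0 /andP[w0l w0r] cw] := continuity_grid y dl m Fm ab.
pose v i := w0 + dl * i%:R.
have v0 : F (v 0%N) < e by apply: hA2; rewrite /v mulr0 addr0 ltW.
have vm : 1 - e < F (v m).
  apply: hA1; rewrite /v.
  have : (A1 - (- A2 - 1)) / dl < m%:R by apply: truncnS_gt.
  by rewrite ltr_pdivrMr // [m%:R * _]mulrC; lra.
have vS i : v i <= v i.+1 by rewrite /v lerD2l ler_pM2l // ler_nat.
have cv i : (i <= m)%N -> (Fn^~ (v i)) @ \oo --> F (v i) by move=> im; apply/conv/(cw i im).1.
have cyv i : (i <= m)%N -> (Fn^~ (y - v i)) @ \oo --> F (y - v i).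
  by move=> im; apply/conv/(cw i im).2.
have cl : (fun n => lower_sum (Fn n) v m y) @ \oo --> lower_sum F v m y.
  apply: cvg_big => [|i _]; first exact: add_continuous.
  apply: cvgM; last exact: cyv.
  by apply: cvgB; apply: cv => //; exact: ltnW.
have cu : (fun n => upper_sum (Fn n) v m y) @ \oo --> upper_sum F v m y.
  apply: cvg_big => [|i _]; first exact: add_continuous.
  apply: cvgM; last by apply: cyv; exact: ltnW.
  by apply: cvgB; apply: cv => //; exact: ltnW.
have lE : lower_sum F v m y = upper_sum F v m (y - dl).
  apply: eq_bigr => i _; congr (_ * F _); rewrite /v -[(i.+1)%:R]natr1; ring.
have uE : upper_sum F v m y = lower_sum F v m (y + dl).
  apply: eq_bigr => i _; congr (_ * F _); rewrite /v -[(i.+1)%:R]natr1; ring.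
have /andP[_ hl] := product_law_strip_bounds nu (y - dl) m vS.
have /andP[hu _] := product_law_strip_bounds nu (y + dl) m vS.
have c0 := cv 0%N (leq0n _); have cm := cv m (leqnn _).
near=> n.
have := convpow_cdf_strip_bounds n (bn n) y m (an0 n) vS => /= /andP[tl tu].
have h1 : `|lower_sum F v m y - lower_sum (Fn n) v m y| < e.
  by near: n; move/cvgrPdist_lt: cl; apply.
have h2 : `|upper_sum F v m y - upper_sum (Fn n) v m y| < e.
  by near: n; move/cvgrPdist_lt: cu; apply.
have h3 : `|F (v 0%N) - Fn n (v 0%N)| < e.
  by near: n; move/cvgrPdist_lt: c0; apply.
have h4 : `|F (v m) - Fn n (v m)| < e.
  by near: n; move/cvgrPdist_lt: cm; apply.
move: h1 h2 h3 h4; rewrite !ltr_norml => /andP[_ h1] /andP[h2 _] /andP[h3 _] /andP[_ h4].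
have F0 := cdfR_ge0 nu (v 0%N); have F1 := cdfR_le1 nu (v m).
have -> : eta = 8 * e by rewrite /e; field.
have {}tl : lower_sum (Fn n) v m y <= convpow_cdf mu (n + n) (bn n + bn n + an n * y) := tl.
have {}tu : convpow_cdf mu (n + n) (bn n + bn n + an n * y) <=
  upper_sum (Fn n) v m y + Fn n (v 0%N) + 1 - Fn n (v m) := tu.
have {}hl : P (y - dl) <= upper_sum F v m (y - dl) + F (v 0%N) + 1 - F (v m) := hl.
have {}hu : lower_sum F v m (y + dl) <= P (y + dl) := hu.
by apply/andP; split; lra.
Unshelve. all: end_near. Qed.

End NormalizedSums.

Section IncreasePoints.
Variables (R : realType) (nu : probability R R).
Local Notation F := (cdfR nu).

Lemma quantile_exists th : 0 < th < 1 ->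
  exists p, forall e, 0 < e -> F (p - e) <= th < F (p + e).
Proof.
move=> /andP[th0 th1]; pose E := [set x | th < F x].
have th1' : 0 < 1 - th by lra.
have [A hA] := cdfR_pinfty nu th1'.
have [B hB] := cdfR_ninfty nu th0.
have iE : has_inf E.
  split; first by exists A; have := hA _ (lexx _); rewrite /E /=; lra.
  exists (- B) => x; rewrite /E /= => xE; rewrite leNgt; apply/negP => /ltW /hB; lra.
exists (inf E) => e e0; apply/andP; split.
  rewrite leNgt; apply/negP => h; have := ge_inf iE.2 h; lra.
have [x xE xe] := inf_adherent e0 iE.
by apply: lt_le_trans xE _; apply: cdfR_nondecreasing; apply: ltW.
Qed.

(** Quantiles are points of increase. If they all coincided with the median [q], the distribution
    function would jump from 0 to 1 at [q] and [nu] would be a point mass. *)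
Lemma increase_points : (forall x, (nu [set x] < 1)%E) ->
  exists p1 p2, p2 < p1 /\ forall e, 0 < e -> F (p1 - e) < F (p1 + e) /\ F (p2 - e) < F (p2 + e).
Proof.
move=> nd.
have [q hq] := quantile_exists (ltac:(lra) : 0 < 2^-1 < 1).
case: (pselect (exists th p, [/\ 0 < th < 1, p != q &
    forall e, 0 < e -> F (p - e) <= th < F (p + e)])) => [[th [p [_ pq hp]]]|no].
  have ip e : 0 < e -> F (p - e) < F (p + e) by move=> /hp /andP[/le_lt_trans]; apply.
  have iq e : 0 < e -> F (q - e) < F (q + e) by move=> /hq /andP[/le_lt_trans]; apply.
  have [lt|lt|eq] := ltgtP p q; last by rewrite eq eqxx in pq.
    by exists q, p; split=> // e e0; split; [apply: iq|apply: ip].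
  by exists p, q; split=> // e e0; split; [apply: ip|apply: iq].
have all th e : 0 < th < 1 -> 0 < e -> F (q - e) <= th < F (q + e).
  move=> th01 e0; have [p hp] := quantile_exists th01.
  have [<-|pq] := eqVneq p q; first exact: hp.
  by case: no; exists th, p.
have lo e : 0 < e -> F (q - e) = 0.
  move=> e0; apply/eqP; rewrite eq_le cdfR_ge0 andbT leNgt; apply/negP => h.
  have f1 := cdfR_le1 nu (q - e).
  by have /andP[] := all (F (q - e) / 2) e ltac:(lra) e0; lra.
have hi e : 0 < e -> F (q + e) = 1.
  move=> e0; apply/eqP; rewrite eq_le cdfR_le1 /= leNgt; apply/negP => h.
  have f1 := cdfR_ge0 nu (q + e).
  by have /andP[] := all ((F (q + e) + 1) / 2) e ltac:(lra) e0; lra.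
exfalso; have := nd q; suff -> : nu [set q] = 1%E by rewrite ltxx.
pose J (n : nat) : set R := `]q - n.+1%:R^-1, q + n.+1%:R^-1]%classic.
have nuJ n : nu (J n) = 1%E.
  have n0 : 0 < n.+1%:R^-1 :> R by rewrite invr_gt0.
  have -> : nu (J n) = (fine (nu (J n)))%:E by rewrite fineK ?fin_num_measure //; exact: measurable_itv.
  congr (_%:E).
  rewrite fine_itv_oc ?(hi _ n0) ?(lo _ n0) ?subr0 //.
  by move: (_^-1) n0 => z; lra.
have JE : \bigcap_n J n = [set q].
  apply/seteqP; split=> [x xJ|x -> n _]; last first.
    by have n0 : 0 < n.+1%:R^-1 :> R by [rewrite invr_gt0]; rewrite /J /= in_itv /=; move: (_^-1) n0 => z z0; apply/andP; split; lra.
  have h e : 0 < e -> q - e < x <= q + e.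
    move=> e0; have := xJ (Num.truncn e^-1) I.
    rewrite /J /= in_itv /= => /andP[a b].
    have : (Num.truncn e^-1).+1%:R^-1 < e.
      by rewrite -[ltRHS]invrK ltf_pV2 ?posrE ?invr_gt0 // truncnS_gt.
    by move: (_%:R^-1) a b => z a b c; apply/andP; split; lra.
  apply/eqP; rewrite eq_le; apply/andP; split; rewrite leNgt; apply/negP => c.
    by have /andP[] := h ((x - q) / 2) ltac:(lra); lra.
  by have /andP[] := h ((q - x) / 2) ltac:(lra); lra.
have cv : (nu \o J) @ \oo --> nu (\bigcap_n J n).
  apply: nonincreasing_cvg_mu => //.
  - by have := ltry (1 : R); rewrite -(nuJ 0%N).
  - by move=> n; apply: measurable_itv.
  - by apply: bigcap_measurableType => n _; apply: measurable_itv.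
  - move=> m n mn; apply/subsetPset => x; rewrite /J /= !in_itv /= => /andP[a b].
    have : n.+1%:R^-1 <= m.+1%:R^-1 :> R by rewrite lef_pV2 ?posrE // ler_nat.
    by move: (n.+1%:R^-1) (m.+1%:R^-1) a b => z w a b c; apply/andP; split; lra.
rewrite -JE; apply: (cvg_unique _ cv) => //.
by rewrite (_ : nu \o J = fun=> 1%E); [exact: cvg_cst|apply/funext => n /=].
Qed.

(* The scale is [2 ^ (1 / gam)]. *)
Lemma stable_doubling gam : 1 < gam -> stable_law gam nu ->
  exists s c, 0 < s < 2 /\ forall y,
    fine (product_measure1 nu nu [set p : R * R | p.1 + p.2 <= y]) = F ((y - c) / s).
Proof.
move=> gam1 [_ st]; have [c hc] := st 1 1 ltr01 ltr01.
set s := _ `^ gam^-1 in hc.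
have s2 : s = 2 `^ gam^-1 by rewrite /s !powR1.
have s0 : 0 < s by rewrite s2 powR_gt0.
exists s, c; split.
  rewrite s0 s2 /powR pnatr_eq0 /= -[ltRHS]lnK ?posrE // ltr_expR.
  have l2 : 0 < ln (2 : R) by rewrite ln_gt0 // ltr1n.
  by rewrite -[ltRHS]mul1r ltr_pM2r // invf_lt1 //; lra.
move=> y; rewrite /cdfR; congr fine.
have := hc `]-oo, y]%classic (measurable_itv _).
have -> : [set p : R * R | `]-oo, y]%classic (1 * p.1 + 1 * p.2)] = [set p | p.1 + p.2 <= y].
  by apply/seteqP; split=> p /=; rewrite in_itv /= !mul1r.
move=> ->; congr (nu _); apply/seteqP; split=> x /=; rewrite !in_itv /= ler_pdivlMr // mulrC; lra.
Qed.

End IncreasePoints.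

(** * Growth of the normalisation and tail bound *)

Section Attraction.
Variables (R : realType) (mu : nat -> R).
Hypothesis prob : is_prob_nat mu.
Hypothesis mean1 : series (fun k => k%:R * mu k) @ \oo --> (1 : R).
Variables (gam : R) (nu : probability R R) (an bn : nat -> R).
Hypothesis gam1 : 1 < gam.
Hypothesis st : stable_law gam nu.
Hypothesis an0 : forall n, 0 < an n.
Hypothesis conv : forall x : R, {for x, continuous (cdfR nu)} ->
  (fun n => convpow_cdf mu n (bn n + an n * x)) @ \oo --> cdfR nu x.

Local Notation F := (cdfR nu).
Let Fm := cdfR_nondecreasing nu.

(** Adding the two comparisons eliminates [B] and [B']: [A (x1 - x2) < a (s g + 2 s e + 2 e)] with
    [g = p1 - p2] and [x1 - x2 > g - 4 e]. The factor 28 is what lets [(s + 2) / 2], midway between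
    [s] and 2, absorb all terms in [e]. *)
Lemma scale_ratio_arith (s c e x1 x2 p1 p2 A a B B' : R) : 0 < s -> s < 2 ->
  28 * e = (2 - s) * (p1 - p2) -> 0 < e -> p1 - 2 * e < x1 -> x2 < p2 + 2 * e ->
  B + A * x1 < B' + a * (s * (p1 + e) + c + e) ->
  B' + a * (s * (p2 - e) + c - e) < B + A * x2 -> 0 < A -> 0 < a -> A <= (s + 2) / 2 * a.
Proof.
move=> s0 s2 eE e0 h1 h2 k1 k2 A0 a0; pose g := p1 - p2.
have g0 : 0 < g by rewrite -(pmulr_rgt0 _ (_ : 0 < 2 - s)) ?subr_gt0 // -eE mulr_gt0.
have sg : 0 < s * g by apply: mulr_gt0.
have se : s * e <= 2 * e by rewrite ler_pM2r // ltW.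
have eE' : 28 * e = 2 * g - s * g by rewrite eE /g; ring.
have q0 : 0 < g - 4 * e by lra.
have step1 : A * (g - 4 * e) <= A * (x1 - x2).
  by apply: ler_wpM2l; [exact: ltW|rewrite /g; lra].
have step3 : a * (s * (g + 2 * e) + 2 * e) <= a * ((s + 2) / 2 * (g - 4 * e)).
  by apply: ler_wpM2l; [exact: ltW|lra].
rewrite -(ler_pM2r q0) [_ * a]mulrC -mulrA; apply: le_trans step1 (le_trans _ step3).
by rewrite /g; lra.
Qed.

(* Convergence of types: compare [S_(2n)] normalised by [an (2n)] with the sum of
   two copies of [S_n] normalised by [an n], near two points of increase of [F]. *)
Lemma scale_ratio : exists rho : R, 1 < rho < 2 /\
  \forall n \near \oo, an (n + n)%N <= rho * an n.
Proof.
have [s [c [/andP[s0 s2] Ps]]] := stable_doubling gam1 st.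
have [p1 [p2 [p21 inc]]] := increase_points st.1.
pose rho := (s + 2) / 2; have rhoE : 2 * rho = s + 2 by rewrite /rho; lra.
exists rho; split; first by apply/andP; split; lra.
pose g := p1 - p2; have g0 : 0 < g by rewrite subr_gt0.
pose e := (2 - s) * g / 28.
have eE : 28 * e = (2 - s) * g by rewrite /e; lra.
have e0 : 0 < e by rewrite /e divr_gt0 // mulr_gt0 // subr_gt0.
have [i1 i2] := inc e e0.
have [x1 /andP[x1l x1r] j1] := exists_small_jump Fm (ltac:(lra) : p1 - 2 * e < p1 - e).
have [x2 /andP[x2l x2r] j2] := exists_small_jump Fm (ltac:(lra) : p2 + e < p2 + 2 * e).
have cv1 := conv (small_jump_continuous Fm j1).
have cv2 := conv (small_jump_continuous Fm j2).
have Fx1 : F x1 <= F (p1 - e) by apply: Fm; lra.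
have Fx2 : F (p2 + e) <= F x2 by apply: Fm; lra.
pose y1 := s * (p1 + e) + c + e; pose y2 := s * (p2 - e) + c - e.
(* A third of the increase: one part for each of the two limits, and one that keeps the comparison
   strict. *)
pose h1 := (F (p1 + e) - F (p1 - e)) / 3; have h10 : 0 < h1 by rewrite divr_gt0 // subr_gt0.
pose h2 := (F (p2 + e) - F (p2 - e)) / 3; have h20 : 0 < h2 by rewrite divr_gt0 // subr_gt0.
have h1E : 3 * h1 = F (p1 + e) - F (p1 - e) by rewrite /h1; lra.
have h2E : 3 * h2 = F (p2 + e) - F (p2 - e) by rewrite /h2; lra.
have D1 := doubled_sum_limit prob an0 conv y1 e0 h10.
have D2 := doubled_sum_limit prob an0 conv y2 e0 h20.
have P1 : fine (product_measure1 nu nu [set p : R * R | p.1 + p.2 <= y1 - e]) = F (p1 + e).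
  by rewrite Ps; congr F; rewrite /y1; field; rewrite gt_eqF.
have P2 : fine (product_measure1 nu nu [set p : R * R | p.1 + p.2 <= y2 + e]) = F (p2 - e).
  by rewrite Ps; congr F; rewrite /y2; field; rewrite gt_eqF.
have {cv1}[N1 _ cv1] : \forall n \near \oo, `|F x1 - convpow_cdf mu n (bn n + an n * x1)| < h1.
  by move/cvgrPdist_lt : cv1; apply.
have {cv2}[N2 _ cv2] : \forall n \near \oo, `|F x2 - convpow_cdf mu n (bn n + an n * x2)| < h2.
  by move/cvgrPdist_lt : cv2; apply.
near=> n.
have n1 : (N1 <= n + n)%N by apply: leq_trans (leq_addr n n); near: n; exact: nbhs_infty_ge.
have n2 : (N2 <= n + n)%N by apply: leq_trans (leq_addr n n); near: n; exact: nbhs_infty_ge.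
have d1 : F (p1 + e) - h1 <= convpow_cdf mu (n + n) (bn n + bn n + an n * y1).
  by rewrite -P1; near: n; apply: filterS D1 => n /andP[].
have d2 : convpow_cdf mu (n + n) (bn n + bn n + an n * y2) <= F (p2 - e) + h2.
  by rewrite -P2; near: n; apply: filterS D2 => n /andP[].
have := cv1 _ n1; have := cv2 _ n2; rewrite /= !ltr_norml => /andP[_ c2] /andP[c1 _].
have k1 : bn (n + n)%N + an (n + n)%N * x1 < bn n + bn n + an n * y1.
  rewrite ltNge; apply/negP => /(convpow_cdf_mono prob (n + n)) k; lra.
have k2 : bn n + bn n + an n * y2 < bn (n + n)%N + an (n + n)%N * x2.
  rewrite ltNge; apply/negP => /(convpow_cdf_mono prob (n + n)) k; lra.
exact: (scale_ratio_arith _ _ eE e0 x1l x2r k1 k2 (an0 _) (an0 _)).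
Unshelve. all: end_near. Qed.

(** [L] is the width of a band that carries all but a small part of the limit law. An error 1/22 in
    the tails of [F] and 1/22 in the convergence make up the 1/11 of [largest_summand_tail]. *)
Lemma attraction_tail : exists L : R, 0 < L /\
  \forall n \near \oo, forall K : nat, an n * L + 2 <= K%:R ->
    n%:R * (1 - \sum_(0 <= j < K.+1) mu j) <= 1.
Proof.
have e0 : 0 < 22^-1 :> R by [].
have [A1 hA1] := cdfR_pinfty nu e0; have [A2 hA2] := cdfR_ninfty nu e0.
have [L1 /andP[l1 _] j1] := exists_small_jump Fm (ltac:(lra) : A1 < A1 + 1).
have [L2 /andP[_ l2] j2] := exists_small_jump Fm (ltac:(lra) : - A2 - 1 < - A2).
have F1 := hA1 _ (ltW l1); have F2 := hA2 _ (ltW l2).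
have cv1 := conv (small_jump_continuous Fm j1).
have cv2 := conv (small_jump_continuous Fm j2).
exists (L1 - L2); split.
  by rewrite subr_gt0 ltNge; apply/negP => /Fm; lra.
near=> n => K hK.
have : `|F L1 - convpow_cdf mu n (bn n + an n * L1)| < 22^-1.
  by near: n; move/cvgrPdist_lt : cv1; apply.
have : `|F L2 - convpow_cdf mu n (bn n + an n * L2)| < 22^-1.
  by near: n; move/cvgrPdist_lt : cv2; apply.
rewrite !ltr_norml => /andP[c2 _] /andP[_ c1].
set hi := bn n + an n * L1 in c1; set lo := bn n + an n * L2 in c2.
pose N := (Num.truncn (`|hi| + `|lo|) + K).+1.
have Nb : `|hi| + `|lo| < N%:R.
  by apply: lt_le_trans (truncnS_gt _) _; rewrite ler_nat ltnS leq_addr.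
have hN : hi < N%:R by apply: le_lt_trans Nb; apply: le_trans (ler_norm _) _; rewrite lerDl.
have lN : lo < N%:R by apply: le_lt_trans Nb; apply: le_trans (ler_norm _) _; rewrite lerDr.
rewrite (convpow_cdf_Pr mu n hN) in c1; rewrite (convpow_cdf_Pr mu n lN) in c2.
have law := prob_cap_law N prob.
have := largest_summand_tail law (cap_mean_le1 prob mean1 N) (n := n) (K := K) (lo := lo) (hi := hi).
have -> : Pr (cap mu N) (fun j => (K < j)%N) = 1 - \sum_(0 <= j < K.+1) mu j.
  have KN : (K < N)%N by rewrite ltnS leq_addl.
  rewrite /Pr Ex_cap KN mulr1 !(big_cat_nat (leq0n K.+1) KN) /=.
  rewrite [X in X + _ + _]big_nat_cond [X in X + _ + _]big1 ?add0r; last first.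
    by move=> j /andP[/andP[_ jK] _]; rewrite ltnNge -ltnS jK mulr0.
  rewrite [X in X + _](_ : _ = \sum_(K.+1 <= j < N) mu j); first by ring.
  by apply: eq_big_nat => j /andP[Kj _]; rewrite Kj mulr1.
apply.
- by rewrite /hi /lo; lra.
- have -> : Pr (iid (cap mu N) n) (fun s => hi < (sumn s)%:R) =
      1 - Pr (iid (cap mu N) n) (fun s => (sumn s)%:R <= hi).
    rewrite -PrC; last exact: iid_law.
    by apply: eq_Ex => s; rewrite ltNge.
  lra.
- lra.
Unshelve. all: end_near. Qed.

End Attraction.

(** * Truncated means from dyadic tail bounds *)

Section TailFromScale.
Variables (R : realType) (mu : nat -> R).
Hypothesis prob : is_prob_nat mu.
Hypothesis mean1 : series (fun k => k%:R * mu k) @ \oo --> (1 : R).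

Let mu0 k : 0 <= mu k. Proof. by case: prob => p _; apply: p. Qed.

(** Bernoulli's inequality for [2 / rho]. Over [r.+2] doublings of n the normalisation gains at most
    [2 ^+ r.+1], so the tail decays with exponent [(r + 2) / (r + 1) > 1]. *)
Lemma pow_half_lt2 (rho : R) : 1 < rho < 2 -> exists r, rho ^+ r.+2 <= 2 ^+ r.+1.
Proof.
move=> /andP[r1 r2].
pose x := 2 / rho - 1; have x0 : 0 < x by rewrite subr_gt0 ltr_pdivlMr; lra.
have bern n : 1 + n%:R * x <= (2 / rho) ^+ n.
  elim: n => [|n IH]; first by rewrite mul0r addr0.
  have n0 : 0 <= n%:R :> R by [].
  have -> : 2 / rho = 1 + x by rewrite /x; ring.
  rewrite exprS; apply: le_trans (_ : (1 + x) * (1 + n%:R * x) <= _).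
    by rewrite -[n.+1%:R]natr1; nra.
  by apply: ler_wpM2l; [lra|rewrite (_ : 1 + x = 2 / rho) // /x; ring].
pose r := Num.truncn x^-1; exists r.
have : 2 <= (2 / rho) ^+ r.+2.
  apply: le_trans (bern _); have : x^-1 < r.+1%:R by apply: truncnS_gt.
  by rewrite -[x^-1]mul1r ltr_pdivrMr // -[r.+2%:R]natr1; lra.
rewrite expr_div_n ler_pdivlMr ?exprn_gt0 //; last by lra.
by rewrite [in X in _ <= X -> _]exprS ler_pM2l.
Qed.

Variables (r B : nat).
Let K l := (B * 2 ^ (r.+1 * l))%N.
Hypothesis B0 : (0 < B)%N.
Hypothesis tailK : forall l, 2 ^+ (r.+2 * l) * (1 - \sum_(0 <= j < (K l).+1) mu j) <= 1.

Let K_le l l' : (l <= l')%N -> (K l <= K l')%N.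
Proof. by move=> ll; rewrite /K leq_mul2l leq_exp2l // leq_mul2l ll !orbT. Qed.

Let C1 : R := B%:R * 2 ^+ r.+1.

(** The values are at most [K l.+1] and their mass at most [2 ^ - (r.+2 l)]; the exponents differ by
    [l], which makes the blocks geometric. *)
Lemma dyadic_block l : \sum_((K l).+1 <= j < (K l.+1).+1) mu j * j%:R <= C1 * (2 ^+ l)^-1.
Proof.
have kk : ((K l).+1 <= (K l.+1).+1)%N by rewrite ltnS K_le.
apply: (@le_trans _ _ ((K l.+1)%:R * (1 - \sum_(0 <= j < (K l).+1) mu j))).
  apply: (@le_trans _ _ ((K l.+1)%:R * \sum_((K l).+1 <= j < (K l.+1).+1) mu j)).
    rewrite mulr_sumr; apply: ler_sum_nat => j /andP[_ jK].
    by rewrite mulrC ler_wpM2r // ler_nat.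
  apply: ler_wpM2l => //; have := prob_mass_le1 prob (K l.+1).+1.
  by rewrite (big_cat_nat (leq0n _) kk) /=; lra.
have t : 1 - \sum_(0 <= j < (K l).+1) mu j <= (2 ^+ (r.+2 * l))^-1.
  by rewrite -[leRHS]mul1r ler_pdivlMr ?exprn_gt0 // mulrC tailK.
apply: le_trans (ler_wpM2l _ t) _ => //.
rewrite /K natrM natrX /C1 -!mulrA; apply: ler_wpM2l => //.
rewrite ler_pdivrMr ?exprn_gt0 // -!mulrA; rewrite mulnS exprD; apply: ler_wpM2l; first exact: exprn_ge0.
have -> : (r.+2 * l = l + r.+1 * l)%N by rewrite mulSn.
by rewrite exprD mulrA mulVf ?mul1r ?expf_neq0.
Qed.

Lemma dyadic_blocks l t : \sum_((K l).+1 <= j < (K (l + t)).+1) mu j * j%:R <=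
  2 * C1 * ((2 ^+ l)^-1 - (2 ^+ (l + t))^-1).
Proof.
elim: t => [|t IH]; first by rewrite addn0 big_geq // subrr mulr0.
rewrite addnS (big_cat_nat (n := (K (l + t)).+1)) /= ?ltnS ?K_le ?leq_addr //.
apply: le_trans (lerD IH (dyadic_block (l + t))) _.
rewrite [2 ^+ (l + t).+1]exprS invfM; move: (_^-1) ((2 ^+ (l + t))^-1) => p q.
by rewrite le_eqVlt; apply/orP; left; apply/eqP; field.
Qed.

Lemma dyadic_tail l M : \sum_((K l).+1 <= j < M) mu j * j%:R <= 2 * C1 * (2 ^+ l)^-1.
Proof.
have C0 : 0 <= C1 by rewrite mulr_ge0 // exprn_ge0.
have i0 n : 0 <= (2 ^+ n)^-1 :> R by rewrite invr_ge0 exprn_ge0.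
have MK : (M <= (K (l + M)).+1)%N.
  rewrite leqW // /K (leq_trans (ltnW (ltn_expl M (isT : 1 < 2)%N))) //.
  apply: (@leq_trans (2 ^ (r.+1 * (l + M)))); last by rewrite leq_pmull.
  by rewrite leq_exp2l // mulnDr mulSn; lia.
have [KM|MK'] := leqP (K l).+1 M; last first.
  by rewrite big_geq 1?ltnW // !mulr_ge0.
apply: le_trans (le_trans (dyadic_blocks l M) _).
  rewrite (big_cat_nat KM MK) /= lerDl sumr_ge0 // => j _; exact: mulr_ge0.
by apply: ler_wpM2l; rewrite ?mulr_ge0 // lerBlDr lerDl.
Qed.

Lemma offspring_of_dyadic_tail : exists q (C : R), offspring mu q C.
Proof.
have C0 : 0 <= C1 by rewrite mulr_ge0 // exprn_ge0.
have C20 : 0 <= 2 * C1 by rewrite mulr_ge0.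
(* For [k >= 2] choose [l] with [k < 2 ^ l <= k ^ 2]. Then [k ^ B] absorbs the factor [B] of [K l]
   and [k ^ (2 r.+1)] its power of 2. The added 1 in the constant covers [k = 1]. *)
exists (B + 2 * r.+1)%N, (2 * C1 + 1); apply: offspring_of_tail => // [|k M k0].
  by rewrite addr_ge0.
have [k1|k2] := leqP k 1.
  have -> : k = 1%N by lia.
  rewrite divr1 exp1n; apply: le_trans (_ : 1 <= _); last by rewrite lerDr.
  apply: le_trans (mean_partial_le1 prob mean1 M).
  have [M1|M1] := leqP 1 M; last by rewrite big_geq ?sumr_ge0 // 1?ltnW // => j _; rewrite mulr_ge0.
  by rewrite (big_cat_nat (leq0n 1) M1) /= lerDr sumr_ge0 // => j _; rewrite mulr_ge0.
pose l := (trunc_log 2 k).+1.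
have kl : (k < 2 ^ l)%N by apply: trunc_log_ltn.
have lk : (2 ^ l <= k * k)%N.
  by rewrite /l expnS leq_mul // trunc_logP.
have Kq : ((K l).+1 <= k ^ (B + 2 * r.+1))%N.
  rewrite expnD; apply: (@leq_trans (B.+1 * (2 ^ l) ^ r.+1)).
    by rewrite mulSn /K mulnC [(r.+1 * l)%N]mulnC expnM mulnC -add1n leq_add2r expn_gt0 expn_gt0.
  apply: leq_mul; first by apply: leq_trans (ltn_expl B (isT : 1 < 2)%N) _; rewrite leq_exp2r.
  by rewrite expnM leq_exp2r // -mulnn.
apply: (@le_trans _ _ (2 * C1 * (2 ^+ l)^-1)).
  apply: le_trans (dyadic_tail l M).
  have [qM|Mq] := leqP (k ^ (B + 2 * r.+1)) M.
    by rewrite (big_cat_nat Kq qM) /= lerDr sumr_ge0 // => j _; rewrite mulr_ge0.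
  by rewrite big_geq 1?ltnW // sumr_ge0 // => j _; rewrite mulr_ge0.
have kR : 0 < k%:R :> R by rewrite ltr0n.
apply: (@le_trans _ _ (2 * C1 / k%:R)).
  by apply: ler_wpM2l => //; rewrite lef_pV2 ?posrE ?exprn_gt0 // -natrX ler_nat ltnW.
by apply: ler_wpM2r; [rewrite invr_ge0 ltW|rewrite lerDl].
Qed.

End TailFromScale.

(** Iterating [scale_ratio] along powers of 2 bounds the normalisation at [2 ^ (i0 + r.+2 l)] by a
    constant times [2 ^ (r.+1 l)], so [attraction_tail] applies at the level [K l] and gives the
    dyadic tail bound. *)
Lemma offspring_of_attraction (R : realType) (mu : nat -> R) (gam : R) :
  is_prob_nat mu -> series (fun k => k%:R * mu k) @ \oo --> (1 : R) -> 1 < gam ->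
  domain_of_attraction gam mu -> exists q (C : R), offspring mu q C.
Proof.
move=> prob mean1 gam1 [nu [an [bn [st [an0 conv]]]]].
have [rho [rho12 [N1 _ hN1]]] := scale_ratio prob gam1 st an0 conv.
have [L [L0 [N2 _ hN2]]] := attraction_tail prob mean1 conv.
have [r hr] := pow_half_lt2 rho12; have /andP[r1 r2] := rho12.
pose i0 := maxn N1 N2.
have i0N1 i : (i0 <= i)%N -> (N1 <= 2 ^ i)%N.
  by move=> h; apply: leq_trans (ltnW (ltn_expl i (isT : 1 < 2)%N)); apply: leq_trans h; rewrite leq_maxl.
have i0N2 i : (i0 <= i)%N -> (N2 <= 2 ^ i)%N.
  by move=> h; apply: leq_trans (ltnW (ltn_expl i (isT : 1 < 2)%N)); apply: leq_trans h; rewrite leq_maxr.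
have a1 t : an (2 ^ (i0 + t))%N <= an (2 ^ i0)%N * rho ^+ t.
  elim: t => [|t IH]; first by rewrite addn0 mulr1.
  have := hN1 _ (i0N1 _ (leq_addr t i0)) => /=.
  rewrite addnn -mul2n -expnS -addnS => h; apply: le_trans h _.
  by rewrite exprS mulrCA; apply: ler_wpM2l => //; lra.
pose a := an (2 ^ i0)%N; have a0 : 0 < a by apply: an0.
have a2 l : an (2 ^ (i0 + r.+2 * l))%N <= a * 2 ^+ (r.+1 * l).
  apply: le_trans (a1 _) _; apply: ler_wpM2l; first exact: ltW.
  by rewrite !exprM; apply: lerXn2r => //; rewrite nnegrE exprn_ge0 //; lra.
pose B := (Num.truncn (a * L + 2)).+1.
apply: (@offspring_of_dyadic_tail _ _ prob mean1 r B) => // l.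
set K := (B * _)%N.
have e1 : 1 <= 2 ^+ (r.+1 * l) :> R by rewrite exprn_ege1 // ler1n.
have := hN2 _ (i0N2 _ (leq_addr (r.+2 * l) i0)) K => /=.
have -> : an (2 ^ (i0 + r.+2 * l))%N * L + 2 <= K%:R.
  have Bb : a * L + 2 < B%:R by apply: truncnS_gt.
  apply: (@le_trans _ _ ((a * L + 2) * 2 ^+ (r.+1 * l))); last first.
    by rewrite /K natrM natrX; apply: ler_wpM2r; [exact: exprn_ge0|exact: ltW].
  have : an (2 ^ (i0 + r.+2 * l))%N * L <= a * 2 ^+ (r.+1 * l) * L by rewrite ler_pM2r.
  by rewrite mulrDl -[a * L * _]mulrA [L * _]mulrC mulrA; lra.
move=> /(_ isT); rewrite expnD natrM !natrX; apply: le_trans.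
have T0 : 0 <= 1 - \sum_(0 <= j < K.+1) mu j by rewrite subr_ge0 prob_mass_le1.
by rewrite -mulrA; apply: ler_peMl; [apply: mulr_ge0 => //; apply: exprn_ge0|rewrite exprn_ege1 // ler1n].
Qed.

(** * Convergence of the conditional probabilities *)

Section Conclusion.
Variables (R : realType) (mu : nat -> R) (q : nat) (C : R) (b : nat).
Hypotheses (H : offspring mu q C) (b2 : (2 <= b)%N) (mu00 : 0 < mu 0) (ap : aperiodic mu).
Variable k0 : nat.
Hypotheses (k02 : (2 <= k0)%N) (muk0 : 0 < mu k0).
Variable c : R.
Hypotheses (c01 : 0 <= c <= 1) (freshc : (fun m => fresh mu b m m) @ \oo --> c).

Lemma cond_prob_cvg0 eps (E : nat -> {fset word} -> {fmap word -> word} -> Prop) : 0 < eps ->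
  (forall n t y, is_plane_tree t -> #|` t| = n -> is_labelling t y -> E n t y ->
     bad_prefix n eps c (map (lab y) (Defs.dfs t))) ->
  (fun n => cond_prob mu b n (E n)) @ \oo --> (0 : R).
Proof.
move=> eps0 EB; have [K [Y rate]] := cond_prob_rate H b2 mu00 ap k02 muk0 c01 freshc eps0.
apply/cvgrPdist_lt => e e0; have [Z hZ] := eventually_nat_ge ((`|K| + 1) / e).
set P := rate_exp q in rate.
have P0 : (0 < P)%N by rewrite /P /rate_exp addn1.
exists ((Y + Z + 1) ^ P).+1 => // -[//|m] /= mY.
(* The integer [P]-th root of [m], which links the rate [K / y] to the size of the tree. *)
have [y /andP[ym my]] := root_between m P0.
have Yy : (Y + Z + 1 <= y)%N by rewrite -ltnS -(ltn_exp2r _ _ P0) (leq_ltn_trans _ my).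
have /andP[p0 p1] : 0 <= cond_prob mu b m.+1 (E m.+1) <= K / y%:R.
  apply: rate; [by move: Yy; clear; lia|by rewrite ym|].
  by move=> t y' pt tm; apply: EB.
rewrite sub0r normrN ger0_norm //; apply: le_lt_trans p1 _.
have yR : 0 < y%:R :> R by rewrite ltr0n; move: Yy; clear; lia.
have : (`|K| + 1) / e <= y%:R by apply: hZ; move: Yy; clear; lia.
rewrite ler_pdivrMr // ltr_pdivrMr // => h.
by have := ler_norm K; rewrite [e * _]mulrC; lra.
Qed.

End Conclusion.

Lemma range_size_upto t y : is_plane_tree t -> range_size t y = range_upto t y #|` t|.
Proof.
move=> pt; have [pd _ _] := dfs_facts pt.
have pm : perm_eq (map (lab y) t) (map (lab y) (Defs.dfs t)) by rewrite perm_map // perm_sym.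
rewrite /range_size /range_upto take_oversize -?(perm_size pd) //.
by apply/perm_size/perm_undup/perm_mem.
Qed.

Theorem theorem1p1 (R : realType) (gam : R) (b : nat) (mu : nat -> R) :
  1 < gam <= 2 -> (2 <= b)%N ->
  is_prob_nat mu ->
  (* (H1) mean one *)
  series (fun k => k%:R * mu k) @ \oo --> (1 : R) ->
  (* (H2) aperiodicity *)
  aperiodic mu ->
  (* (H3) *)
  ((gam = 2 /\ cvg (series (fun k => (k ^ 2)%:R * mu k) @ \oo)) \/
   (gam < 2 /\ domain_of_attraction gam mu)) ->
  exists c : R, 0 < c /\
    (forall eps : R, 0 < eps ->
       (fun n : nat => cond_prob mu b n
          (fun t y => exists k : nat, (1 <= k <= n)%N /\
             eps < n%:R^-1 * `| (range_upto t y k)%:R - c * k%:R |))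
       @ \oo --> (0 : R)) /\
    (forall eps : R, 0 < eps ->
       (fun n : nat => cond_prob mu b n
          (fun t y => eps < `| n%:R^-1 * (range_size t y)%:R - c |))
       @ \oo --> (0 : R)).
Proof.
move=> /andP[gam1 gam2] b2 prob mean1 ap tail.
(* If [mu 0 = 0], the conditioning event has mass 0 and [cond_prob] is 0 by the convention on
   division by zero; the constant 1 is then an arbitrary choice. *)
have [mu00|mu00] := leP (mu 0) 0.
  have m0 : mu 0 = 0 by apply/eqP; rewrite eq_le mu00; case: prob => h _; apply: h.
  have cp n E : cond_prob mu b n E = 0 by rewrite /cond_prob size_prob0 //= invr0 mulr0.
  by exists 1; split=> //; split=> eps _; under eq_fun do rewrite cp; exact: cvg_cst.
have [q [C H]] : exists q (C : R), offspring mu q C.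
  case: tail => [[_ var]|[_ doa]]; first exact: offspring_of_variance var.
  exact: offspring_of_attraction gam1 doa.
have [k0 k02 muk0] := mean_one_atom_ge2 prob mean1 mu00.
have [c [c0 c1 freshc]] := fresh_limit H b2 (mean_one_mu0_lt1 prob mean1).
have c01 : 0 <= c <= 1 by rewrite ltW.
have bad n t y k eps : (1 <= k <= n)%N ->
    eps < n%:R^-1 * `|(range_upto t y k)%:R - c * k%:R| ->
    bad_prefix n eps c (map (lab y) (Defs.dfs t)).
  move=> /andP[k1 kn] h; apply/existsP; exists (Ordinal (kn : (k < n.+1)%N)).
  by rewrite /= k1 -map_take.
exists c; split=> //; split=> eps eps0.
  apply: (cond_prob_cvg0 H b2 mu00 ap k02 muk0 c01 freshc eps0) => n t y _ _ _ [k [kn h]].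
  exact: bad h.
apply: (cond_prob_cvg0 H b2 mu00 ap k02 muk0 c01 freshc eps0) => n t y pt tn _ h.
have n0 : (0 < n)%N by rewrite -tn cardfs_gt0; apply/fset0Pn; exists [::]; case: pt.
have nR : 0 < n%:R :> R by rewrite ltr0n.
apply: (bad n t y n); first by rewrite n0 leqnn.
rewrite -tn -range_size_upto // tn -[n%:R^-1]gtr0_norm ?invr_gt0 // -normrM.
by rewrite mulrBr [c * _]mulrC mulrA mulVf ?mul1r // gt_eqF.
Qed.
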